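(* For a matchless clan $\gamma\in\mathrm{Clan}_{p,q}$, $F_\gamma=s_{\lambda^+(\gamma)}\,s_{\lambda^-(\gamma)}$, where $s_\mu$ denotes the Schur function of the partition $\mu$.
   Context: Fix integers $p,q\ge0$, $n=p+q$, $[n]=\{1,\dots,n\}$. A $(p,q)$-clan is an involution $\gamma$ of $[n]$ each of whose fixed points is labelled $+$ or $-$, with (number of $+$) $-$ (number of $-$) $=p-q$; $\mathrm{Clan}_{p,q}$ is the set of these, $\iota(\gamma)$ the underlying involution, and $i\neq j$ are matched if $\iota(\gamma)(i)=j$. Let $s_i=(i\;i{+}1)$ and $\ell(w)$ the number of inversions of a permutation $w$. For $1\le i<n$, $s_i\gamma s_i$ is the clan with underlying involution $s_i\iota(\gamma)s_i$, fixed points keeping their signs except that the signs of $i,i+1$ (when fixed) become those of $i+1,i$ in $\gamma$. The partial operation $\gamma\ast s_i$: if $i,i+1$ are fixed points of opposite sign, $\gamma\ast s_i$ is $\gamma$ with $i,i+1$ matched; if $i,i+1$ are matched to each other or fixed of equal sign, undefined; otherwise $\gamma\ast s_i=s_i\gamma s_i$. With $m=\min(p,q)$, $\gamma_{p,q}$ has underlying involution $(1\;n)(2\;n{-}1)\cdots(m\;n{-}m{+}1)$ and all remaining fixed points of the sign of $p-q$. A word $a_1\cdots a_\ell$ is a reduced word for $\gamma$ if there are clans $\gamma_{p,q}=\delta_0,\dots,\delta_\ell=\gamma$ with $\delta_j\ast s_{a_j}$ defined, equal to $\delta_{j-1}$, and $\ell(\iota(\delta_{j-1}))>\ell(\iota(\delta_j))$;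 $\mathcal R(\gamma)$ is the set of them. A clan is matchless if $\iota(\gamma)$ is the identity. For matchless $\gamma$, $\phi^+(\gamma)$ (resp. $\phi^-(\gamma)$) is the increasing list of positions of $+$'s (resp. $-$'s), and $\lambda^+(\gamma)_i=\#\{j:\phi^-(\gamma)_j>\phi^+(\gamma)_i\}$ ($i=1,\dots,p$), $\lambda^-(\gamma)_i=\#\{j:\phi^+(\gamma)_j>\phi^-(\gamma)_i\}$ ($i=1,\dots,q$). For a word $a=a_1\cdots a_\ell$, a compatible sequence is a word $b_1\cdots b_\ell$ with $1\le b_1\le\cdots\le b_\ell$, $b_i\le a_i$, and $b_i<b_{i+1}$ whenever $a_i<a_{i+1}$; $\mathrm{comp}(a)$ is the set of them. $\mathfrak S_\gamma=\sum_{a\in\mathcal R(\gamma)}\sum_{b\in\mathrm{comp}(a)}x_{b_1}\cdots x_{b_\ell}$. For $\gamma\in\mathrm{Clan}_{p,q}$, $\gamma^{+1}\in\mathrm{Clan}_{p+1,q+1}$ is obtained by shifting $\gamma$ to $\{2,\dots,n+1\}$ (keeping signs) and matching $1$ with $n+2$; $\gamma^{+m}=(\gamma^{+(m-1)})^{+1}$; and $F_\gamma=\lim_{m\to\infty}\mathfrak S_{\gamma^{+m}}$. *)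

(* Defs.v *)
From mathcomp Require Import all_boot all_order all_fingroup all_algebra.
From mathcomp Require Import finmap multiset.
From mathcomp Require Import boolp classical_sets functions cardinality fsbigop.

Set Implicit Arguments.
Unset Strict Implicit.
Unset Printing Implicit Defensive.

Import GRing.Theory.

Local Open Scope classical_set_scope.
Local Open Scope ring_scope.

(* Positions 1, ..., n are the ordinals 0, ..., n-1.  The label [sgn g i] is
   [Some true] for +, [Some false] for -, and [None] when i is not a fixed
   point; this last convention is enforced by [is_clan] below. *)
Record clan (n : nat) := Clan {
  invol : {perm 'I_n};
  sgn : {ffun 'I_n -> option bool} }.

(* The last conjunct is #(+) - #(-) = p - q, written without subtraction. *)
Definition is_clan (p q n : nat) (g : clan n) : bool :=
  [&& n == (p + q)%N,
      [forall i, invol g (invol g i) == i],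
      [forall i, (sgn g i != None) == (invol g i == i)]
    & (#|[set i | sgn g i == Some true]%SET| + q ==
       #|[set i | sgn g i == Some false]%SET| + p)%N].

Definition matchless (n : nat) (g : clan n) : Prop := invol g = 1%g.

Definition num_inv (n : nat) (w : {perm 'I_n}) : nat :=
  #|[set ij : 'I_n * 'I_n | (ij.1 < ij.2)%N && (w ij.2 < w ij.1)%N]%SET|.

(* In the next two operations j is the position following i. *)
Definition clan_conj (n : nat) (g : clan n) (i j : 'I_n) : clan n :=
  Clan (tperm i j * invol g * tperm i j)%g [ffun k => sgn g (tperm i j k)].

(* [None] means undefined. *)
Definition clan_star (n : nat) (g : clan n) (i j : 'I_n) : option (clan n) :=
  match sgn g i, sgn g j with
  | Some b, Some c =>
      if b == c then None
      else Some (Clan (invol g * tperm i j)%g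
                      [ffun k => if (k == i) || (k == j) then None else sgn g k])
  | _, _ => if invol g i == j then None else Some (clan_conj g i j)
  end.

(* The i-th factor transposes the 1-based positions i+1 and n-i. *)
Definition clan_top (p q n : nat) : clan n :=
  let w := (\prod_(i < n | (i < minn p q)%N) tperm i (rev_ord i))%g in
  Clan w [ffun i => if w i == i then Some (q < p)%N else None].

(* The 1-based positions a and a+1 are the ordinals of values a-1 and a. *)
Definition clan_step (n : nat) (d : clan n) (a : nat) (e : clan n) : Prop :=
  exists i j : 'I_n, [/\ i.+1 = a, j = a :> nat, clan_star d i j = Some e
                       & (num_inv (invol d) < num_inv (invol e))%N].

Definition reduced_words (p q n : nat) (g : clan n) : set (seq nat) :=
  [set a | exists d : nat -> clan n,
     [/\ forall k, (k <= size a)%N -> is_clan p q (d k),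
         d 0%N = clan_top p q n,
         d (size a) = g
       & forall k, (k < size a)%N -> clan_step (d k.+1) (nth 0%N a k) (d k)]].

Definition compatible (a : seq nat) : set (seq nat) :=
  [set b | [/\ size b = size a,
               all (leq 1%N) b,
               sorted leq b,
               forall k, (k < size a)%N -> (nth 0%N b k <= nth 0%N a k)%N
             & forall k, (k.+1 < size a)%N ->
                 (nth 0%N a k < nth 0%N a k.+1)%N ->
                 (nth 0%N b k < nth 0%N b k.+1)%N]].

(* Formal power series over the integers in x_0, x_1, x_2, ...: a monomial
   x_(b_1) ... x_(b_l) is the multiset {b_1, ..., b_l}, and a series maps each
   monomial to its coefficient.  The variable x_0 never actually occurs. *)
Definition pseries : Type := {mset nat}%mset -> int.

Definition ps_monom (b : seq nat) : pseries := fun m => (m == seq_mset b)%:R.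

(* The sum runs over the finitely many factorizations of the monomial m. *)
Definition ps_mul (f g : pseries) : pseries := fun m =>
  \sum_(uv \in [set uv : {mset nat}%mset * {mset nat}%mset |
                 msetD uv.1 uv.2 = m]) f uv.1 * g uv.2.

(* Coefficientwise limits. *)
Definition ps_cvg (u : nat -> pseries) (f : pseries) : Prop :=
  forall m, exists N, forall k, (N <= k)%N -> u k m = f m.

Definition ps_lim (u : nat -> pseries) : pseries :=
  xget (fun=> 0) [set f | ps_cvg u f].

Definition clan_schubert (p q n : nat) (g : clan n) : pseries := fun m =>
  \sum_(a \in reduced_words p q g) \sum_(b \in compatible a) ps_monom b m.

Definition clan_pad1 (n : nat) (g : clan n) : clan n.+2 :=
  Clan (lift_perm ord0 ord0 (lift_perm ord_max ord_max (invol g))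
          * tperm ord0 ord_max)%g
       [ffun i => obind (sgn g) (obind (unlift ord_max) (unlift ord0 i))].

(* [pad_size m n] is n + 2m. *)
Fixpoint pad_size (m n : nat) : nat :=
  if m is m'.+1 then (pad_size m' n).+2 else n.

Fixpoint clan_pad (m n : nat) (g : clan n) : clan (pad_size m n) :=
  if m is m'.+1 then clan_pad1 (clan_pad m' g) else g.

Definition clan_approx (p q n : nat) (g : clan n) (m : nat) : pseries :=
  clan_schubert (p + m) (q + m) (clan_pad m g).

Definition clan_F (p q n : nat) (g : clan n) : pseries :=
  ps_lim (clan_approx p q g).

(* [phi true] is phi^+ and [phi false] is phi^-; [enum 'I_n] is increasing. *)
Definition phi (s : bool) (n : nat) (g : clan n) : seq 'I_n :=
  [seq i <- enum 'I_n | sgn g i == Some s].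

Definition lam (s : bool) (n : nat) (g : clan n) : seq nat :=
  [seq count (fun j : 'I_n => (i < j)%N) (phi (~~ s) g) | i : 'I_n <- phi s g].

(* Semistandard Young tableaux of shape mu (English notation), with positive
   entries, given by the list of their rows; trailing zero parts of mu yield
   empty rows. *)
Definition ssyt (mu : seq nat) : set (seq (seq nat)) :=
  [set T | [/\ shape T = mu,
               all (all (leq 1%N)) T,
               all (sorted leq) T
             & forall r c, (c < nth 0%N mu r.+1)%N ->
                 (nth 0%N (nth [::] T r) c < nth 0%N (nth [::] T r.+1) c)%N]].

Definition schur (mu : seq nat) : pseries := fun m =>
  \sum_(T \in ssyt mu) ps_monom (flatten T) m.

(* Main.v *)
Require Import Defs.
From mathcomp Require Import all_boot all_order all_fingroup all_algebra.
From mathcomp Require Import finmap multiset mpoly.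
From mathcomp Require Import boolp classical_sets fsbigop.
From mathcomp Require Import zify ring.

Set Implicit Arguments.
Unset Strict Implicit.
Unset Printing Implicit Defensive.

Import GRing.Theory Num.Theory.

(* A clan polynomial f satisfies D_i f_g = f_g' whenever g * s_i steps up to g',
   and D_i f_g = 0 otherwise, where D_i is the i-th divided difference; the top
   clan has f = 1.  Start from the opposite end: for a sign word b, let A(b) be
   the polynomial with A(+^p -^q) = (z_0 ... z_(p-1))^q on which D_i moves a plus
   sign past the minus sign on its right, and give the matchless clan with sign
   word b the polynomial A(b) A(-b).  Applying divided differences along chains
   towards the top clan assigns a polynomial to every clan; that the result does
   not depend on the chain is an induction on the number of inversions.  The clan
   obtained from b by adding m outer arcs gets A(-^m b +^m) A(-^m (-b) +^m).

   A homogeneous polynomial whose divided differences are known has as its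
   coefficients numbers of words with a given compatible sequence.  For clans
   these are the coefficients of the clan Schubert polynomial.  For A(b) the
   words record how a tableau is filled with boxes in weakly increasing order of
   their entries, the rows corresponding to the plus signs of b; only the flag
   conditions "entries of the row of i are at most i" distinguish A(b) from a
   Schur function, and they become vacuous on a given monomial once m is large. *)

(** The obstacle is that divided differences obey only the nil, commutation and braid relations,
    while two chains from matchless clans to the same clan may differ by more: the sign chosen where
    an arc is opened, the order in which an alternating triple is matched, and the letter by which
    two crossing arcs become nested. These further coincidences hold only on particular polynomials,
    so they are proved in one induction together with uniqueness and vanishing. All of them reduce
    to three facts about matchless clans, [F0_same], [F0_opp] and [F0_alt]. The product A(b) A(-b)
    satisfies these because at least one factor is symmetric in z_i and z_(i+1): where b reads + -,
    the word -b reads - +. The coefficient formula asks four things of a family of polynomials: the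
    rule for D_i along a step, vanishing without a step, independence of the last variable, and the
    constant term. It is therefore proved once and used both for clans and for sign words. *)

Definition sw (i k : nat) : nat :=
  if k == i then i.+1 else if k == i.+1 then i else k.

Variant sw_spec (i k : nat) : nat -> Type :=
  | SwL of k = i : sw_spec i k i.+1
  | SwR of k = i.+1 : sw_spec i k i
  | SwD of k <> i & k <> i.+1 : sw_spec i k k.

Lemma swP i k : sw_spec i k (sw i k).
Proof. by rewrite /sw; case: eqP => [|h1]; [|case: eqP => h2]; constructor. Qed.

Lemma swL i : sw i i = i.+1.
Proof. by rewrite /sw eqxx. Qed.

Lemma swR i : sw i i.+1 = i.
Proof. by rewrite /sw eqxx; case: eqP => //; lia. Qed.

Lemma swD i k : k != i -> k != i.+1 -> sw i k = k.
Proof. by rewrite /sw => /negbTE-> /negbTE->. Qed.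

Lemma swK i : involutive (sw i).
Proof. by move=> k; case: (swP i k) => [->|->|h1 h2]; rewrite ?swL ?swR ?swD //; apply/eqP. Qed.

Lemma sw_inj i : injective (sw i).
Proof. exact: inv_inj (swK i). Qed.

Lemma sw_lt N i k : i.+1 < N -> (sw i k < N) = (k < N).
Proof. by move=> h; case: swP; lia. Qed.

Lemma sw_comm i j k : i.+1 < j -> sw i (sw j k) = sw j (sw i k).
Proof.
move=> h; case: (swP j k) => [->|->|h1 h2]; rewrite ?(@swD i j) ?(@swD i j.+1) ?swL ?swR //; try lia.
by case: (swP i k) => [_|_|h3 h4]; rewrite swD //; lia.
Qed.

Lemma sw_braid i k : sw i (sw i.+1 (sw i k)) = sw i.+1 (sw i (sw i.+1 k)).
Proof.
have e1 : sw i.+1 i = i by rewrite swD //; lia.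
have e2 : sw i i.+2 = i.+2 by rewrite swD //; lia.
case: (swP i k) => [->|->|h1 h2]; rewrite ?swL ?swR ?e1 ?e2 ?swL ?swR ?e1 ?e2 //.
case: (swP i.+1 k) => [e|_|h3 h4]; rewrite ?swL ?swR ?e1 ?e2 ?swL ?swR //.
by rewrite !swD //; apply/eqP.
Qed.

Lemma sw_above i : sw i i.+2 = i.+2.
Proof. by rewrite swD //; lia. Qed.

Lemma sw_below i : sw i.+1 i = i.
Proof. by rewrite swD //; lia. Qed.

Ltac natb := repeat (progress (rewrite ?eqxx ?ltnn ?leqnn /=) || match goal with
  | |- context [leq ?a ?b] =>
      first [rewrite [leq a b](_ : _ = true); [|by lia] | rewrite [leq a b](_ : _ = false); [|by lia]]
  | |- context [eq_op ?a ?b] =>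
      first [rewrite [eq_op a b](_ : _ = true); [|by lia] | rewrite [eq_op a b](_ : _ = false); [|by lia]]
  end); rewrite ?andbT ?andbF ?orbT ?orbF /=.

(* A clan on the positions 0, ..., N-1, extended to all of nat by the identity.
   The sign of a position is [true] for a fixed point labelled +; it is [false]
   for a fixed point labelled - and also, by convention, at every other position. *)
Record st := St { io : nat -> nat; sg : nat -> bool }.

Lemma st_eq s t : io s =1 io t -> sg s =1 sg t -> s = t.
Proof. by case: s t => [f a] [g b] /= /funext-> /funext->. Qed.

Definition cconj i s := St (fun k => sw i (io s (sw i k))) (fun k => sg s (sw i k)).

Definition mat i s :=
  St (fun k => io s (sw i k)) (fun k => [&& sg s k, k != i & k != i.+1]).

Definition unm i e s :=
  St (fun k => if (k == i) || (k == i.+1) then k else io s k)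
     (fun k => if k == i then e else if k == i.+1 then ~~ e else sg s k).

Lemma conjK i s : cconj i (cconj i s) = s.
Proof. by apply: st_eq => k /=; rewrite !swK. Qed.

Lemma conj_comm i j s : i.+1 < j -> cconj i (cconj j s) = cconj j (cconj i s).
Proof. by move=> h; apply: st_eq => k /=; rewrite !(sw_comm _ h). Qed.

Lemma conj_braid i s :
  cconj i (cconj i.+1 (cconj i s)) = cconj i.+1 (cconj i (cconj i.+1 s)).
Proof. by apply: st_eq => k /=; rewrite !sw_braid. Qed.

Lemma unm_comm i j e e' s : i.+1 < j -> unm i e (unm j e' s) = unm j e' (unm i e s).
Proof.
move=> h; apply: st_eq => k /=;
  case: (k =P i) => k1; case: (k =P i.+1) => k2; case: (k =P j) => k3; case: (k =P j.+1) => k4 //=;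
  exfalso; lia.
Qed.

(** * Upward steps between clans and their effect on inversions *)

Section Clans.

Variable N : nat.

Definition valid s := [/\ forall k, io s (io s k) = k, forall k, N <= k -> io s k = k
  & forall k, sg s k -> io s k = k /\ k < N].

(** This is the operation with s_i restricted to the steps that add inversions. Unless both
    positions are fixed, conjugation adds inversions exactly when [io s i < io s i.+1]; the test
    also rules out [i] and [i.+1] matched to each other. *)
Definition clan_up i s :=
  if i.+1 < N then
    if (io s i == i) && (io s i.+1 == i.+1) then
      if sg s i == sg s i.+1 then None else Some (mat i s)
    else if io s i < io s i.+1 then Some (cconj i s) else None
  else None.

Lemma validI s k l : valid s -> io s k = l -> io s l = k.
Proof. by case=> h _ _ <-. Qed.

Lemma valid_inj s : valid s -> injective (io s).
Proof. by case=> h _ _; apply: can_inj h. Qed.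

Lemma valid_lt s k : valid s -> k < N -> io s k < N.
Proof.
move=> v h; rewrite ltnNge; apply/negP => h1.
have [h2 h3 _] := v; have := h3 _ h1; rewrite h2; lia.
Qed.

Lemma valid_sg s k : valid s -> io s k != k -> sg s k = false.
Proof. by case=> _ _ h /eqP h1; apply/negP => /h []. Qed.

Lemma valid_conj i s : i.+1 < N -> valid s -> valid (cconj i s).
Proof.
move=> hi [h1 h2 h3]; split=> k /=; first by rewrite swK h1 swK.
  by move=> hk; rewrite swD ?h2 ?swD //; lia.
by move=> /h3 [-> h]; rewrite swK -(sw_lt _ hi).
Qed.

Lemma valid_mat i s : i.+1 < N -> io s i = i -> io s i.+1 = i.+1 -> valid s -> valid (mat i s).
Proof.
move=> hi e1 e2 v; have [h1 h2 h3] := v; split=> k /=.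
- case: (swP i k) => [->|->|k1 k2]; rewrite ?e1 ?e2 ?swL ?swR //.
  rewrite swD ?h1 //; apply/eqP => h.
    by have := validI v h; rewrite e1; lia.
  by have := validI v h; rewrite e2; lia.
- by move=> hk; rewrite swD ?h2 //; lia.
- by case/and3P => /h3 [h h'] k1 k2; rewrite swD.
Qed.

Lemma matched_lt s i : valid s -> io s i = i.+1 -> i.+1 < N.
Proof.
move=> v e; case: ltnP => // h; have [_ h2 _] := v.
by have := validI v e; rewrite h2 //; lia.
Qed.

Lemma valid_unm i e s : io s i = i.+1 -> valid s -> valid (unm i e s).
Proof.
move=> ei v; have hi := matched_lt v ei; have ej := validI v ei.
have [h1 h2 h3] := v; split=> k /=.
- case: (k =P i) => [->|k1] /=; first by rewrite eqxx.
  case: (k =P i.+1) => [->|k2] /=; first by rewrite eqxx orbT.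
  case: eqP => [h|_] /=; last rewrite ?h1 //; try by exfalso; move: (validI v h); rewrite ei; lia.
  by case: eqP => [h|_] /=; last rewrite ?h1 //; try by exfalso; move: (validI v h); rewrite ej; lia.
- by move=> hk; case: ifP => //; rewrite h2.
- case: eqP => [->|k1] /=; first by split => //; lia.
  by case: eqP => [->|k2] /=; [split|exact: h3].
Qed.

Lemma valid_ne s k l m : valid s -> io s l = m -> k <> l -> io s k <> m.
Proof. by move=> v h kl h'; apply: kl; rewrite -(validI v h) -(validI v h'). Qed.

Lemma conj_unm i e s : valid s -> io s i = i.+1 -> cconj i (unm i e s) = unm i (~~ e) s.
Proof.
move=> v ei; have ej := validI v ei; apply: st_eq => k /=.
  case: (swP i k) => [->|->|k1 k2]; rewrite ?eqxx ?orbT ?swL ?swR //.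
  rewrite !ifF //; try lia.
  by rewrite swD //; apply/eqP; [exact: (valid_ne v ej)|exact: (valid_ne v ei)].
case: (swP i k) => [->|->|k1 k2]; rewrite ?eqxx !ifF ?negbK //; lia.
Qed.

Lemma conj_unm_comm i j e s : valid s -> io s j = j.+1 -> (i.+1 < j) || (j.+1 < i) ->
  cconj i (unm j e s) = unm j e (cconj i s).
Proof.
move=> v ei h; have ej := validI v ei.
have e1 k : (sw i k == j) = (k == j) by case: (swP i k); lia.
have e2 k : (sw i k == j.+1) = (k == j.+1) by case: (swP i k); lia.
apply: st_eq => k /=; rewrite e1 e2 //.
by case: ifP => // _; rewrite swK.
Qed.

Lemma up_unm i e s : valid s -> io s i = i.+1 -> clan_up i (unm i e s) = Some s.
Proof.
move=> v ei; have hi := matched_lt v ei; have ej := validI v ei.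
rewrite /clan_up hi /= !eqxx orbT eqxx (_ : (i.+1 == i) = false); last lia.
have -> : (e == ~~ e) = false by case: e.
congr Some; apply: st_eq => k /=.
  case: (swP i k) => [->|->|/eqP/negbTE-> /eqP/negbTE->] //; rewrite eqxx ?orbT //.
case: eqP => [->|_]; first by rewrite andbF valid_sg // ei; lia.
case: eqP => [->|_]; first by rewrite andbF valid_sg // ej; lia.
by rewrite !andbT.
Qed.

Lemma up_conj i s : i.+1 < N -> valid s -> io s i.+1 < io s i -> io s i != i.+1 ->
  clan_up i (cconj i s) = Some s.
Proof.
move=> hi v h1 h2; rewrite /clan_up hi /= swL swR conjK.
have h3 : io s i.+1 <> i by move=> h; move: h2; rewrite (validI v h) eqxx.
case: ifP => [/andP[/eqP e1 /eqP e2]|_].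
  have e3 : io s i.+1 = i.+1 by rewrite -[LHS](swK i) e1 swL.
  have e4 : io s i = i by rewrite -[LHS](swK i) e2 swR.
  by move: h1; rewrite e3 e4; lia.
by case: ifP => //; case: (swP i (io s i)); case: (swP i (io s i.+1)); lia.
Qed.

(** Conjugation undoes itself, but undoing a matching leaves the sign [e] free. The two predecessors
    in the matched case are what makes [F0_opp] necessary. *)
Lemma up_inv i s s1 : valid s1 -> clan_up i s1 = Some s ->
  [/\ i.+1 < N, valid s &
   (io s i = i.+1 /\ exists e, s1 = unm i e s) \/
   [/\ io s i != i.+1, io s i.+1 < io s i & s1 = cconj i s]].
Proof.
move=> v; rewrite /clan_up; case: ifP => // hi.
case: ifP => [/andP[/eqP e1 /eqP e2]|e0].
  case: ifP => // /negbT hs [<-]; split=> //; first exact: valid_mat.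
  left; rewrite /= swL e2; split=> //; exists (sg s1 i).
  apply: st_eq => k /=.
    by case: (swP i k) => [->|->|/eqP/negbTE-> /eqP/negbTE->] //; rewrite eqxx ?orbT.
  case: (k =P i) => [->//|k1]; case: (k =P i.+1) => [->|k2]; last by rewrite !andbT.
  by case: (sg s1 i) (sg s1 i.+1) hs => [] [].
case: ifP => // h [<-]; split=> //; first exact: valid_conj.
right; rewrite /= swL swR conjK.
have hh : io s1 i = i.+1 -> False by move=> h1; move: h; rewrite (validI v h1) h1; lia.
split=> //.
  apply/eqP => h1; have h2 : io s1 i.+1 = i by rewrite -[LHS](swK i) h1 swR.
  by apply: hh; apply: validI v _.
case: (swP i (io s1 i)); case: (swP i (io s1 i.+1)); lia.
Qed.

Definition inv_set (f : nat -> nat) :=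
  [set ab : 'I_N * 'I_N | (ab.1 < ab.2) && (f ab.2 < f ab.1)].

Definition ninv (f : nat -> nat) := #|inv_set f|.

Lemma ninv_sw_r i f : i.+1 < N -> f i < f i.+1 -> ninv (fun k => f (sw i k)) = (ninv f).+1.
Proof.
move=> hi hf; have hi0 : i < N by lia.
pose oi := Ordinal hi0; pose oj := Ordinal hi.
have swp (k : 'I_N) : sw i k < N by rewrite sw_lt.
pose t (k : 'I_N) : 'I_N := Ordinal (swp k).
have tK : involutive t by move=> k; apply: val_inj; rewrite /= swK.
pose tt (ab : 'I_N * 'I_N) := (t ab.1, t ab.2).
have ttK : involutive tt by case=> a b; rewrite /tt /= !tK.
rewrite /ninv; have -> : inv_set (fun k => f (sw i k)) = (oi, oj) |: (tt @: inv_set f).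
  apply/setP => -[a b]; rewrite in_setU1 -{3}[(a, b)]ttK mem_imset; last exact: inv_inj ttK.
  rewrite !inE /= xpair_eqE -!val_eqE /=.
  case: (swP i a) => [->|->|a1 a2]; case: (swP i b) => [->|->|b1 b2];
    rewrite ?eqxx ?ltnn ?ltnSn ?hf /=; lia.
rewrite cardsU1 card_imset; last exact: inv_inj ttK.
rewrite -[(oi, oj)]ttK mem_imset; last exact: inv_inj ttK.
by rewrite !inE /= swL swR (_ : (i.+1 < i) = false) //; lia.
Qed.

Lemma ninv_sw_l i a b f : a < b < N -> injective f -> f a = i -> f b = i.+1 ->
  ninv (fun k => sw i (f k)) = (ninv f).+1.
Proof.
move=> /andP[hab hb] fi ha hb'; have ha0 : a < N by lia.
pose oa := Ordinal ha0; pose ob := Ordinal hb.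
rewrite /ninv; have -> : inv_set (fun k => sw i (f k)) = (oa, ob) |: inv_set f.
  apply/setP => -[c d]; rewrite in_setU1 !inE /= xpair_eqE -!val_eqE /=.
  case: (nat_of_ord c =P a) => [->|ca]; case: (nat_of_ord d =P b) => [->|db];
    rewrite ?ha ?hb' ?swL ?swR /=.
  - by rewrite hab ltnSn.
  - case: (swP i (f d)) => [e|e|e1 e2]; try lia.
    by have e' := fi _ _ (etrans e (esym hb')); lia.
  - case: (swP i (f c)) => [e|e|e1 e2]; try lia.
    by have e' := fi _ _ (etrans e (esym ha)); lia.
  - have h1 : f c <> i by move=> e; apply: ca; apply: fi; rewrite e ha.
    have h2 : f d <> i.+1 by move=> e; apply: db; apply: fi; rewrite e hb'.
    have h3 : f c = i.+1 -> nat_of_ord c = b by move=> e; apply: fi; rewrite e hb'.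
    have h4 : f d = i -> nat_of_ord d = a by move=> e; apply: fi; rewrite e ha.
    by case: (swP i (f c)) h3; case: (swP i (f d)) h4; lia.
by rewrite cardsU1 !inE /= ha hb' (_ : (i.+1 < i) = false) ?andbF //; lia.
Qed.

(** Matching composes with the transposition on one side and adds one inversion; conjugation
    composes on both sides and adds two. *)
Lemma ninv_up i s s1 : valid s1 -> clan_up i s1 = Some s -> ninv (io s1) < ninv (io s).
Proof.
move=> v; rewrite /clan_up; case: ifP => // hi.
case: ifP => [/andP[/eqP e1 /eqP e2]|e0].
  by case: ifP => // _ [<-] /=; rewrite ninv_sw_r // e1 e2.
case: ifP => // h [<-] /=.
have fi := valid_inj v; have hi0 : i < N by lia.
have l1 := valid_lt v hi0; have l2 := valid_lt v hi.
rewrite (ninv_sw_r (f := fun k => sw i (io s1 k))) //; last first.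
  by case: (swP i (io s1 i)); case: (swP i (io s1 i.+1)); lia.
rewrite ltnS; apply: ltnW.
have [h1 _ _] := v.
by rewrite (@ninv_sw_l i (io s1 i) (io s1 i.+1)) // h.
Qed.

Lemma up_none_dn i s s1 : valid s1 -> clan_up i s1 = Some s -> clan_up i s = None.
Proof.
move=> v /(up_inv v) [hi vs [[h _]|[_ h _]]]; rewrite /clan_up hi.
  by rewrite h (validI vs h) !ifF //; lia.
by rewrite !ifF //; lia.
Qed.

(** A strictly increasing map satisfies [k <= io s k]; for an involution the same inequality at
    [io s k] is the reverse one. *)
Lemma no_descent s : valid s -> (forall i, i.+1 < N -> io s i < io s i.+1) -> io s =1 id.
Proof.
move=> v h; have [h1 h2 _] := v.
have inc i j : i < j < N -> io s i < io s j.
  elim: j => [|j IH]; first lia.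
  case: (ltngtP i j) => [ij hj|?|->]; [|lia|by case/andP=> _; apply: h].
  by apply: ltn_trans (IH _) (h _ _); lia.
have ge k : k < N -> k <= io s k.
  elim: k => // k IH hk; have := h k hk; have := IH (ltnW hk); lia.
move=> k; case: (ltnP k N) => hk; last exact: h2.
apply/eqP; rewrite eqn_leq ge // andbT -{2}[k]h1.
by apply: ge; apply: valid_lt.
Qed.

Lemma descentP s : valid s ->
  (io s =1 id) \/ exists i, i.+1 < N /\ io s i.+1 < io s i.
Proof.
move=> v; case: (pselect (exists i, i.+1 < N /\ io s i.+1 < io s i)); first by right.
move=> h; left; apply: no_descent => // i hi; case: (ltngtP (io s i) (io s i.+1)) => // [g|e].
  by case: h; exists i.
by have := valid_inj v e; lia.
Qed.

End Clans.

(** * Independence of the chain *)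

Ltac sst := repeat first
  [ progress rewrite ?swL ?swR
  | match goal with H : io ?s ?a = _ |- context [io ?s ?a] => rewrite H end
  | match goal with |- context [sw ?a ?b] => rewrite (@swD a b); [|by lia|by lia] end
  | match goal with |- context [if ?b then _ else _] =>
      first [rewrite (_ : b = true); [|by lia] | rewrite (_ : b = false); [|by lia]] end ].

Ltac swcases := repeat match goal with |- context [sw ?a ?b] =>
  lazymatch b with context [sw _ _] => fail | _ => case: (swP a b) => * end end; lia.

Section Consistency.

Variables (N : nat) (V : Type) (V0 : V) (D : nat -> V -> V).
Hypothesis D_0 : forall i, D i V0 = V0.
Hypothesis D_nil : forall i v, D i (D i v) = V0.
Hypothesis D_comm : forall i j v, i.+1 < j -> D i (D j v) = D j (D i v).
Hypothesis D_braid : forall i v, i.+2 < N -> D i (D i.+1 (D i v)) = D i.+1 (D i (D i.+1 v)).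

Variable F0 : (nat -> bool) -> V.
Hypothesis F0_same : forall i a, i.+1 < N -> a i = a i.+1 -> D i (F0 a) = V0.
Hypothesis F0_opp : forall i a, i.+1 < N -> a i <> a i.+1 ->
  D i (F0 a) = D i (F0 (fun k => a (sw i k))).
Hypothesis F0_alt : forall i a, i.+2 < N -> a i <> a i.+1 -> a i = a i.+2 ->
  D i (D i.+1 (F0 a)) = D i.+1 (D i (F0 a)).

Local Notation valid := (valid N).
Local Notation up := (clan_up N).
Local Notation ninv s := (ninv N (io s)).

(** Three conjugations carry the end of an arc across three fixed points. Braid and commutation
    relations then transport the commutation for the shifted triple, at the letters [i.+1] and
    [i.+2], to the original one, at [i] and [i.+1]. [word_left] is the mirror image. *)
Lemma word_right i v : i.+3 < N -> D i.+1 (D i.+2 v) = D i.+2 (D i.+1 v) ->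
  D i (D i.+1 (D i.+2 (D i.+1 (D i v)))) = D i.+1 (D i (D i.+2 (D i.+1 (D i v)))).
Proof.
move=> hi T; have h : i.+1 < i.+2 by [].
have hi' : i.+2 < N by lia.
rewrite (D_braid (D i v) hi) -(D_comm v h) (D_comm (D i.+1 _) h) (D_braid _ hi') T.
rewrite [in RHS](D_comm (D i.+1 _) h) (D_braid v hi') (D_braid _ hi).
by rewrite (D_comm (D i.+1 v) h).
Qed.

Lemma word_left i v : i.+3 < N -> D i (D i.+1 v) = D i.+1 (D i v) ->
  D i.+1 (D i.+2 (D i (D i.+1 (D i.+2 v)))) = D i.+2 (D i.+1 (D i (D i.+1 (D i.+2 v)))).
Proof.
move=> hi T; have h : i.+1 < i.+2 by [].
have hi' : i.+2 < N by lia.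
rewrite -(D_comm (D i.+1 (D i.+2 v)) h) -(D_braid v hi) -(D_braid _ hi') (D_comm (D i.+1 v) h) T.
rewrite -(D_braid (D i.+2 v) hi') -(D_comm (D i.+1 (D i (D i.+2 v))) h) (D_comm v h).
by rewrite -(D_braid (D i v) hi).
Qed.

(** In the signs + - + - two alternating triples overlap. Their two commutations together identify
    the letters [i] and [i.+2] on the crossing arcs from [i] to [i.+2] and from [i.+1] to [i.+3]. *)
Lemma word_link i v : i.+3 < N -> D i (D i.+1 v) = D i.+1 (D i v) ->
  D i.+1 (D i.+2 v) = D i.+2 (D i.+1 v) ->
  D i (D i.+1 (D i (D i.+2 v))) = D i.+2 (D i.+1 (D i (D i.+2 v))).
Proof.
move=> hi T1 T2; have h : i.+1 < i.+2 by [].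
have hi' : i.+2 < N by lia.
by rewrite (D_braid _ hi') T2 (D_comm (D i.+1 v) h) T1 (D_braid (D i v) hi) -(D_comm v h).
Qed.

(** Some chain from a matchless clan up to [s] produces [v]. This is a relation because independence
    of the chain is the point to be proved. *)
Inductive Rep : st -> V -> Prop :=
  | Rep_base a of valid (St id a) : Rep (St id a) (F0 a)
  | Rep_up s v i s' of Rep s v & up i s = Some s' : Rep s' (D i v).

Definition step i s1 s := valid s1 /\ up i s1 = Some s.

Lemma Rep_valid s v : Rep s v -> valid s.
Proof. by elim=> // {}s {}v i s' _ vs /(up_inv vs) []. Qed.

Lemma step_inv i s1 s : step i s1 s -> ninv s1 < ninv s.
Proof. by case=> v /(ninv_up v). Qed.

Lemma step_desc i s1 s : step i s1 s -> io s i.+1 < io s i.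
Proof.
case=> v /(up_inv v) [_ vs [[h _]|[]//]].
by rewrite h (validI vs h).
Qed.

Lemma step_conj i s : valid s -> i.+1 < N -> io s i.+1 < io s i -> io s i != i.+1 ->
  step i (cconj i s) s.
Proof. by move=> v h1 h2 h3; split; [exact: valid_conj|exact: up_conj]. Qed.

Lemma step_unm i e s : valid s -> io s i = i.+1 -> step i (unm i e s) s.
Proof. by move=> v h; split; [exact: valid_unm|exact: up_unm]. Qed.

Lemma step_ex i s : valid s -> i.+1 < N -> io s i.+1 < io s i -> exists s1, step i s1 s.
Proof.
move=> v hi h; case: (io s i =P i.+1) => [e|/eqP e].
  by exists (unm i true s); apply: step_unm.
by exists (cconj i s); apply: step_conj.
Qed.

Lemma Rep_ex s : valid s -> exists v, Rep s v.
Proof.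
have [n] := ubnP (ninv s); elim: n s => // n IH s hn v.
case: (descentP v) => [e|[i [hi h]]].
  exists (F0 (sg s)); have -> : s = St id (sg s) by apply: st_eq.
  by apply: Rep_base; rewrite -(_ : s = St id (sg s)) //; apply: st_eq.
have [s1 h1] := step_ex v hi h; have h2 := step_inv h1.
have [|v1 hv1] := IH s1 _ (h1.1); first lia.
by exists (D i v1); apply: Rep_up hv1 (h1.2).
Qed.

Definition Wp s := forall v i s1 v1, Rep s v -> Rep s1 v1 -> step i s1 s -> v = D i v1.

(** [Q_O], [Q_T] and [Q_L] are the coincidences that the relations among the D do not supply: the
    two ways of placing opposite signs before matching them, the two orders of steps on an
    alternating triple, and crossing arcs which the letters [i] and [j] turn into the same nested
    pair. Uniqueness for a clan uses them for clans with fewer inversions, and conversely. *)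
Record Qp s : Prop := {
  Q_uniq : forall v v', Rep s v -> Rep s v' -> v = v';
  Q_W : Wp s;
  Q_Z : forall v i, Rep s v -> i.+1 < N -> up i s = None -> D i v = V0;
  Q_O : forall v v' i, Rep s v -> Rep (cconj i s) v' -> i.+1 < N ->
    io s i = i -> io s i.+1 = i.+1 -> sg s i <> sg s i.+1 -> D i v = D i v';
  Q_T : forall v i, Rep s v -> i.+2 < N -> io s i = i -> io s i.+1 = i.+1 ->
    io s i.+2 = i.+2 -> sg s i <> sg s i.+1 -> sg s i = sg s i.+2 ->
    D i (D i.+1 v) = D i.+1 (D i v);
  Q_L : forall v i j, Rep s v -> i.+1 < j -> io s i = j -> io s i.+1 = j.+1 ->
    D i v = D j v }.

Lemma pull s v i s1 : Wp s -> Rep s v -> step i s1 s -> exists v1, Rep s1 v1 /\ v = D i v1.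
Proof.
move=> w r h; have [v1 r1] := Rep_ex (h.1).
by exists v1; split=> //; apply: w h.
Qed.

Lemma Rep_inv s v : Rep s v ->
  io s =1 id \/ exists s0 v0 j, [/\ step j s0 s, Rep s0 v0 & v = D j v0].
Proof.
case=> [a va|{}s {}v i s' r e]; [by left|right; exists s, v, i; split=> //].
by split=> //; apply: Rep_valid r.
Qed.

Lemma Rep_matchless s v : Rep s v -> io s =1 id -> v = F0 (sg s).
Proof.
case=> [//|{}s {}v i s' r e] h; have := step_desc (conj (Rep_valid r) e).
by rewrite !h; lia.
Qed.

Section Induction.

Variable s : st.
Hypothesis vs : valid s.
Hypothesis IH : forall s', valid s' -> ninv s' < ninv s -> Qp s'.

Lemma IHstep i s1 : step i s1 s -> Qp s1.
Proof. by move=> h; apply: IH; [case: h|apply: step_inv h]. Qed.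

Lemma Q_step s1 i s2 : Qp s1 -> ninv s1 < ninv s -> step i s2 s1 -> Qp s2.
Proof. by move=> _ h1 h2; apply: IH; [case: h2|apply: ltn_trans (step_inv h2) h1]. Qed.

Lemma unm_unm_W i e e' v v' : io s i = i.+1 -> Rep (unm i e s) v -> Rep (unm i e' s) v' ->
  D i v = D i v'.
Proof.
move=> ei r r'; have q := IHstep (step_unm e vs ei).
case: (e =P e') => [ee|/eqP ee].
  by rewrite -ee in r'; rewrite (Q_uniq q r r').
have {ee} ee : e' = ~~ e by case: e e' ee {r r' q} => [] [].
have hi := matched_lt vs ei.
have f : (i.+1 == i) = false by lia.
by apply: (Q_O q r); rewrite ?(conj_unm e vs ei) -?ee //= ?eqxx ?orbT ?f //; case: (e). 
Qed.

(** Distant descents can be undone in either order, except for nested arcs from [i] to [j.+1] and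
    from [i.+1] to [j]: undoing one descent there removes the other as well. In that case both
    predecessors agree ([linked_cconj]) and [Q_L] is applied to them. *)
Lemma far_square i j s1 s2 : i.+1 < j -> step i s1 s -> step j s2 s ->
  ~ (io s i = j.+1 /\ io s i.+1 = j) ->
  exists s0, step j s0 s1 /\ step i s0 s2.
Proof.
move=> hij h1 h2 hl.
have [hi _ H1] := up_inv h1.1 h1.2; have [hj _ H2] := up_inv h2.1 h2.2.
have d1 := step_desc h1; have d2 := step_desc h2.
have hl' : ~ (io s j = i.+1 /\ io s j.+1 = i).
  by case=> a b; apply: hl; rewrite (validI vs a) (validI vs b).
have v1 := h1.1; have v2 := h2.1.
case: H2 => [[ej [e' E2]]|[ej _ E2]]; case: H1 => [[ei [e E1]]|[ei _ E1]]; subst s1 s2.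
- exists (unm i e (unm j e' s)); split; last first.
    by apply: step_unm => //=; rewrite !ifF //; lia.
  by rewrite unm_comm //; apply: step_unm => //=; rewrite !ifF //; lia.
- exists (cconj i (unm j e' s)); split.
    rewrite (conj_unm_comm e' vs ej) ?hij //; apply: step_unm => //=.
    by rewrite (@swD i j) ?ej ?swD //; lia.
  by apply: step_conj => //=; rewrite !ifF //; lia.
- exists (cconj j (unm i e s)); split.
    by apply: step_conj => //=; rewrite !ifF //; lia.
  rewrite (conj_unm_comm e vs ei) ?hij ?orbT //; apply: step_unm => //=.
  by rewrite (@swD j i) ?ei ?swD //; lia.
- exists (cconj i (cconj j s)); split.
    rewrite conj_comm //; apply: step_conj => //=; rewrite (@swD i j) ?(@swD i j.+1) //; try lia.
      by case: (swP i (io s j)); case: (swP i (io s j.+1)); lia.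
    by case: (swP i (io s j)); lia.
  apply: step_conj => //=; rewrite (@swD j i) ?(@swD j i.+1) //; try lia.
    by case: (swP j (io s i)); case: (swP j (io s i.+1)); lia.
  by case: (swP j (io s i)); lia.
Qed.

Lemma linked_cconj i j : i.+1 < j -> io s i = j.+1 -> io s i.+1 = j -> cconj i s = cconj j s.
Proof.
move=> hij e1 e2; have e3 := validI vs e1; have e4 := validI vs e2.
have si k : k = i \/ k = i.+1 \/ k = j \/ k = j.+1 -> sg s k = false.
  by move=> h; apply: (valid_sg vs); case: h => [->|[->|[->|->]]]; rewrite ?e1 ?e2 ?e3 ?e4; lia.
apply: st_eq => k /=;
  case: (k =P i) => [e|k1]; try subst k; try by rewrite ?si; sst; rewrite ?si //; lia.
all: case: (k =P i.+1) => [e|k2]; try subst k; try by rewrite ?si; sst; rewrite ?si //; lia.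
all: case: (k =P j) => [e|k3]; try subst k; try by rewrite ?si; sst; rewrite ?si //; lia.
all: case: (k =P j.+1) => [e|k4]; try subst k; try by rewrite ?si; sst; rewrite ?si //; lia.
  have n1 := valid_ne vs e1 k1; have n2 := valid_ne vs e2 k2.
  have n3 := valid_ne vs e3 k4; have n4 := valid_ne vs e4 k3.
  by sst.
by sst.
Qed.

Lemma W_far i j s1 s2 v1 v2 : i.+1 < j -> step i s1 s -> step j s2 s ->
  Rep s1 v1 -> Rep s2 v2 -> D i v1 = D j v2.
Proof.
move=> hij h1 h2 r1 r2.
have q1 := IHstep h1; have q2 := IHstep h2.
case: (pselect (io s i = j.+1 /\ io s i.+1 = j)) => [[e1 e2]|hl].
  have [_ _ H1] := up_inv h1.1 h1.2; have [_ _ H2] := up_inv h2.1 h2.2.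
  have e3 := validI vs e1; have e4 := validI vs e2.
  case: H1 => [[]|[_ _ E1]]; first lia.
  case: H2 => [[]|[_ _ E2]]; first lia.
  have E3 : s2 = s1 by rewrite E1 E2 (linked_cconj hij).
  rewrite E3 in r2; rewrite (Q_uniq q1 r2 r1).
  by apply: (Q_L q1 r1) => //; rewrite E1 /=; sst.
have [s0 [h3 h4]] := far_square hij h1 h2 hl.
have [v0 [r0 E1]] := pull (Q_W q1) r1 h3.
by rewrite E1 (Q_W q2 r2 r0 h4) D_comm.
Qed.

Lemma unm_alt i : io s i = i.+2 -> io s i.+1 = i.+1 ->
  unm i.+1 (~~ sg s i.+1) (cconj i s) = unm i (sg s i.+1) (cconj i.+1 s).
Proof.
move=> e1 e2; have e3 := validI vs e1.
apply: st_eq => k /=;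
  case: (k =P i) => [e|k1]; try subst k; try by sst.
all: case: (k =P i.+1) => [e|k2]; try subst k; try by sst.
all: case: (k =P i.+2) => [e|k3]; try subst k; try by sst; rewrite ?negbK.
  have n1 := valid_ne vs e1 k1; have n2 := valid_ne vs e2 k2.
  by have n3 := valid_ne vs e3 k3; sst.
Qed.

Lemma pull2 j s1 s2 v : Qp s1 -> Rep s1 v -> step j s2 s1 -> ninv s1 < ninv s ->
  exists v2, [/\ Rep s2 v2, v = D j v2 & Qp s2].
Proof.
move=> q1 r1 h hn; have [v2 [r2 ->]] := pull (Q_W q1) r1 h.
by exists v2; split=> //; apply: Q_step hn h.
Qed.

Lemma unm_slide_r i e : io s i = i.+1 -> io s i.+2 < i ->
  cconj i (cconj i.+1 (unm i e s)) = unm i.+1 e (cconj i (cconj i.+1 s)).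
Proof.
move=> e1 l; have e3 := validI vs e1.
apply: st_eq => k /=;
  case: (k =P i) => [e0|k1]; try subst k; try by sst.
all: case: (k =P i.+1) => [e0|k2]; try subst k; try by sst.
all: case: (k =P i.+2) => [e0|k3]; try subst k; try by sst.
Qed.

Lemma unm_slide_l i e : io s i.+1 = i.+2 -> i.+2 < io s i ->
  cconj i.+1 (cconj i (unm i.+1 e s)) = unm i e (cconj i.+1 (cconj i s)).
Proof.
move=> e1 l; have e3 := validI vs e1.
apply: st_eq => k /=;
  case: (k =P i) => [e0|k1]; try subst k; try by sst.
all: case: (k =P i.+1) => [e0|k2]; try subst k; try by sst.
all: case: (k =P i.+2) => [e0|k3]; try subst k; try by sst.
Qed.

(** In general both descents continue to a common clan three steps below [s], and the braid relation
    closes the hexagon. If an arc from [i] to [i.+2] surrounds a fixed point, there are only two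
    steps, down to a clan with alternating signs at these positions, and [Q_T] takes the place of
    the braid relation. *)
Lemma W_adj i s1 s2 v1 v2 : step i s1 s -> step i.+1 s2 s ->
  Rep s1 v1 -> Rep s2 v2 -> D i v1 = D i.+1 v2.
Proof.
move=> h1 h2 r1 r2.
have q1 := IHstep h1; have q2 := IHstep h2.
have n1 := step_inv h1; have n2 := step_inv h2.
have v1' := h1.1; have v2' := h2.1.
have l1 := step_desc h1; have l2 := step_desc h2.
have [hi _ H1] := up_inv h1.1 h1.2; have [hj _ H2] := up_inv h2.1 h2.2.
case: (io s i =P i.+2) => [e1|ne1].
  have e3 := validI vs e1; have e2 : io s i.+1 = i.+1 by lia.
  case: H1 => [[]|[_ _ E1]]; first lia.
  case: H2 => [[]|[_ _ E2]]; first lia.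
  subst s1 s2.
  have h3 : step i.+1 (unm i.+1 (~~ sg s i.+1) (cconj i s)) (cconj i s).
    by apply: step_unm => //=; sst.
  have h4 : step i (unm i.+1 (~~ sg s i.+1) (cconj i s)) (cconj i.+1 s).
    by rewrite unm_alt //; apply: step_unm => //=; sst.
  have [v0 [r0 -> q0]] := pull2 q1 r1 h3 n1.
  rewrite (Q_W q2 r2 r0 h4).
  by apply: (Q_T q0 r0) => //=; sst; rewrite ?negbK //; case: (sg s _).
case: (io s i =P i.+1) => [e1|ne2].
  have e3 := validI vs e1.
  case: H1 => [[_ [e E1]]|[]]; last lia.
  case: H2 => [[]|[_ _ E2]]; first lia.
  have l : io s i.+2 < i by lia.
  subst s1 s2.
  have h3 : step i.+1 (cconj i.+1 (unm i e s)) (unm i e s) by apply: step_conj => //=; sst; lia.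
  have h4 : step i (cconj i (cconj i.+1 (unm i e s))) (cconj i.+1 (unm i e s)).
    by apply: step_conj => //=; [exact: h3.1| |]; sst; lia.
  have h5 : step i (cconj i (cconj i.+1 s)) (cconj i.+1 s).
    by apply: step_conj => //=; sst; lia.
  have h6 : step i.+1 (cconj i (cconj i.+1 (unm i e s))) (cconj i (cconj i.+1 s)).
    by rewrite unm_slide_r //; apply: step_unm => //=; [exact: h5.1|]; sst.
  have [w1 [rw1 -> qw1]] := pull2 q1 r1 h3 n1.
  have [w0 [rw0 -> qw0]] := pull2 qw1 rw1 h4 (ltn_trans (step_inv h3) n1).
  have [u1 [ru1 -> qu1]] := pull2 q2 r2 h5 n2.
  by rewrite (Q_W qu1 ru1 rw0 h6) D_braid.
case: (io s i.+1 =P i.+2) => [e1|ne3].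
  have e3 := validI vs e1.
  case: H2 => [[_ [e E2]]|[]]; last lia.
  case: H1 => [[]|[_ _ E1]]; first lia.
  have l : i.+2 < io s i by lia.
  subst s1 s2.
  have h3 : step i (cconj i (unm i.+1 e s)) (unm i.+1 e s) by apply: step_conj => //=; sst; lia.
  have h4 : step i.+1 (cconj i.+1 (cconj i (unm i.+1 e s))) (cconj i (unm i.+1 e s)).
    by apply: step_conj => //=; [exact: h3.1| |]; sst; lia.
  have h5 : step i.+1 (cconj i.+1 (cconj i s)) (cconj i s).
    by apply: step_conj => //=; sst; lia.
  have h6 : step i (cconj i.+1 (cconj i (unm i.+1 e s))) (cconj i.+1 (cconj i s)).
    by rewrite unm_slide_l //; apply: step_unm => //=; [exact: h5.1|]; sst.
  have [w1 [rw1 -> qw1]] := pull2 q2 r2 h3 n2.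
  have [w0 [rw0 -> qw0]] := pull2 qw1 rw1 h4 (ltn_trans (step_inv h3) n2).
  have [u1 [ru1 -> qu1]] := pull2 q1 r1 h5 n1.
  by rewrite (Q_W qu1 ru1 rw0 h6) D_braid.
case: H1 => [[]|[_ _ E1]]; first lia.
case: H2 => [[]|[_ _ E2]]; first lia.
subst s1 s2.
have nc1 : io s i.+2 <> i by move=> e; apply: ne1; rewrite (validI vs e).
have nc2 : io s i.+2 <> i.+1 by move=> e; apply: ne3; rewrite (validI vs e).
have nb : io s i.+1 <> i by move=> e; apply: ne2; rewrite (validI vs e).
have h3 : step i.+1 (cconj i.+1 (cconj i s)) (cconj i s).
  by apply: step_conj => //=; sst; swcases.
have h4 : step i (cconj i (cconj i.+1 (cconj i s))) (cconj i.+1 (cconj i s)).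
  by apply: step_conj => //=; [exact: h3.1| |]; sst; swcases.
have h5 : step i (cconj i (cconj i.+1 s)) (cconj i.+1 s).
  by apply: step_conj => //=; sst; swcases.
have h6 : step i.+1 (cconj i (cconj i.+1 (cconj i s))) (cconj i (cconj i.+1 s)).
  by rewrite conj_braid; apply: step_conj => //=; [exact: h5.1| |]; sst; swcases.
have [w1 [rw1 -> qw1]] := pull2 q1 r1 h3 n1.
have [w0 [rw0 -> qw0]] := pull2 qw1 rw1 h4 (ltn_trans (step_inv h3) n1).
have [u1 [ru1 -> qu1]] := pull2 q2 r2 h5 n2.
by rewrite (Q_W qu1 ru1 rw0 h6) D_braid.
Qed.

Lemma W_holds : Wp s.
Proof.
move=> v i s1 v1 r r1 h1.
have core j k t1 t2 w1 w2 : j <= k -> step j t1 s -> step k t2 s -> Rep t1 w1 -> Rep t2 w2 ->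
    D j w1 = D k w2.
  move=> hjk g1 g2 p1 p2; case: (ltngtP j.+1 k) => [hl|hl|e].
  - exact: W_far hl g1 g2 p1 p2.
  - have e : j = k by lia.
    subst k; have [_ _ H1] := up_inv g1.1 g1.2; have [_ _ H2] := up_inv g2.1 g2.2.
    case: H1 => [[ej [e1 E1]]|[/eqP ej _ E1]]; case: H2 => [[ek [e2 E2]]|[/eqP ek _ E2]] //.
      by subst t1 t2; apply: unm_unm_W p1 p2.
    have E : t2 = t1 by rewrite E1 E2.
    by rewrite E in p2; rewrite (Q_uniq (IHstep g1) p1 p2).
  - by subst k; apply: W_adj g1 g2 p1 p2.
case: (Rep_inv r) => [e|[s0 [v0 [j [h0 r0 ->]]]]].
  by have := step_desc h1; rewrite !e; lia.
by case: (leqP j i) => hij; [apply: core h0 h1 r0 r1|symmetry; apply: core h1 h0 r1 r0; lia].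
Qed.

Lemma step_fixed k s1 p : step k s1 s -> p <> k -> p <> k.+1 -> io s p = p ->
  io s1 p = p /\ sg s1 p = sg s p.
Proof.
move=> h n1 n2 e; have [_ _ H] := up_inv h.1 h.2.
case: H => [[_ [e' ->]]|[_ _ ->]] /=; first by sst.
by rewrite !(@swD k p) ?e ?swD //; apply/eqP.
Qed.

Lemma up_same t i : io t i = i -> io t i.+1 = i.+1 -> sg t i = sg t i.+1 -> up i t = None.
Proof. by move=> e1 e2 e3; rewrite /clan_up e1 e2 e3 !eqxx /= if_same. Qed.

Lemma D_commC i j v : i.+1 < j \/ j.+1 < i -> D i (D j v) = D j (D i v).
Proof. by case=> h; [|symmetry]; apply: D_comm. Qed.

(** A descent at [i] is settled by nilpotency. Otherwise [i] and [i.+1] carry equal signs; removing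
    a descent elsewhere keeps this pair, moved by one place through a braid relation if the descent
    touches it, until the clan is matchless. *)
Lemma Z_holds v i : Rep s v -> i.+1 < N -> up i s = None -> D i v = V0.
Proof.
move=> r hi hu; case: (ltngtP (io s i) (io s i.+1)) => [l|l|e]; last first.
- by have := valid_inj vs e; lia.
- have [s1 h1] := step_ex vs hi l; have [v1 [_ ->]] := pull W_holds r h1.
  by rewrite D_nil.
have [[e1 e2] e3] : (io s i = i /\ io s i.+1 = i.+1) /\ sg s i = sg s i.+1.
  move: hu; rewrite /clan_up hi l; case: andP => // -[/eqP-> /eqP->].
  by case: eqP.
case: (descentP vs) => [e|[k [hk d]]]; first by rewrite (Rep_matchless r e) F0_same.
have [s1 h1] := step_ex vs hk d.
have [v1 [r1 E1]] := pull W_holds r h1.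
have q1 := IHstep h1; have n1 := step_inv h1.
have [_ _ H1] := up_inv h1.1 h1.2.
case: (k =P i) => [?|ki]; first by subst k; lia.
case: (k =P i.+1) => [?|ki2].
  subst k; case: H1 => [[e4]|[e4 l4 ?]]; first lia.
  subst s1; have l5 : io s i.+2 < i by have := valid_ne vs e1 (k := i.+2); lia.
  have h2 : step i (cconj i (cconj i.+1 s)) (cconj i.+1 s).
    by apply: step_conj => //=; [exact: h1.1| |]; sst; lia.
  have [v2 [r2 E2 q2]] := pull2 q1 r1 h2 n1.
  rewrite E1 E2 D_braid // (Q_Z q2 r2) ?D_0 //.
  by apply: up_same => /=; sst.
case: (k.+1 =P i) => [?|ki3].
  subst i; case: H1 => [[e4]|[e4 l4 ?]]; first lia.
  subst s1; have l5 : k.+2 < io s k.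
    have := validI vs (erefl (io s k)); case: (io s k =P k.+2) => [->|]; rewrite ?e2; lia.
  have h2 : step k.+1 (cconj k.+1 (cconj k s)) (cconj k s).
    by apply: step_conj => //=; [exact: h1.1| |]; sst; lia.
  have [v2 [r2 E2 q2]] := pull2 q1 r1 h2 n1.
  rewrite E1 E2 -D_braid // (Q_Z q2 r2) ?D_0 //.
  by apply: up_same => /=; sst.
have [f1 g1] : io s1 i = i /\ sg s1 i = sg s i by apply: step_fixed h1 _ _ _; lia.
have [f2 g2] : io s1 i.+1 = i.+1 /\ sg s1 i.+1 = sg s i.+1.
  by apply: step_fixed h1 _ _ _; lia.
rewrite E1 D_commC; last lia.
by rewrite (Q_Z q1 r1) ?D_0 //; apply: up_same; rewrite ?g1 ?g2.
Qed.

End Induction.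

Section Induction2.

Variable s : st.
Hypothesis vs : valid s.
Hypothesis IH : forall s', valid s' -> ninv s' < ninv s -> Qp s'.

Local Notation IHs := (IHstep IH).
Local Notation pulls := (pull2 IH).
Local Notation Ws := (W_holds vs IH).

Lemma cconj_io i t : valid t -> io t i = i -> io t i.+1 = i.+1 -> io (cconj i t) = io t.
Proof.
move=> vt e1 e2; apply: funext => k /=.
case: (k =P i) => [?|k1]; first by subst k; sst.
case: (k =P i.+1) => [?|k2]; first by subst k; sst.
have n1 := valid_ne vt e1 k1; have n2 := valid_ne vt e2 k2.
by sst.
Qed.

(** Exchanging two signs does not change the involution, so the same descents can be removed from
    both clans until they are matchless. *)
Lemma O_holds v v' i : Rep s v -> Rep (cconj i s) v' -> i.+1 < N ->
  io s i = i -> io s i.+1 = i.+1 -> sg s i <> sg s i.+1 -> D i v = D i v'.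
Proof.
move=> r r' hi e1 e2 e3.
have ei := cconj_io vs e1 e2.
have vs' : valid (cconj i s) by apply: valid_conj.
have Ws' : Wp (cconj i s) by apply: W_holds => //; rewrite ei.
case: (descentP vs) => [e|[k [hk d]]].
  rewrite (Rep_matchless r e) (Rep_matchless r'); first exact: F0_opp.
  by rewrite ei.
have [s1 h1] := step_ex vs hk d.
have [v1 [r1 E1]] := pull Ws r h1.
have q1 := IHs h1; have n1 := step_inv h1.
have [_ _ H1] := up_inv h1.1 h1.2.
case: (k =P i) => [?|ki]; first by subst k; lia.
case: (k =P i.+1) => [?|ki2].
  subst k; case: H1 => [[e4]|[e4 l4 ?]]; first lia.
  subst s1; have l5 : io s i.+2 < i by have := valid_ne vs e1 (k := i.+2); lia.
  have h2 : step i (cconj i (cconj i.+1 s)) (cconj i.+1 s).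
    by apply: step_conj => //=; [exact: h1.1| |]; sst; lia.
  have [v2 [r2 E2 q2]] := pulls q1 r1 h2 n1.
  have h1' : step i.+1 (cconj i.+1 (cconj i s)) (cconj i s).
    by apply: step_conj; rewrite // ei.
  have h2' : step i (cconj i (cconj i.+1 (cconj i s))) (cconj i.+1 (cconj i s)).
    by apply: step_conj => //=; [exact: h1'.1| |]; sst; lia.
  have [w1 [rw1 F1]] := pull Ws' r' h1'.
  have n1' : ninv (cconj i.+1 (cconj i s)) < ninv s by rewrite -ei; apply: step_inv h1'.
  have [w2 [rw2 F2 _]] := pulls (IH h1'.1 n1') rw1 h2' n1'.
  rewrite E1 E2 F1 F2 !D_braid //; congr (D _ (D _ _)).
  rewrite conj_braid in rw2.
  by apply: (Q_O q2 r2 rw2) => //=; sst.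
case: (k.+1 =P i) => [?|ki3].
  subst i; case: H1 => [[e4]|[e4 l4 ?]]; first lia.
  subst s1; have l5 : k.+2 < io s k.
    have := validI vs (erefl (io s k)); case: (io s k =P k.+2) => [->|]; rewrite ?e2; lia.
  have h2 : step k.+1 (cconj k.+1 (cconj k s)) (cconj k s).
    by apply: step_conj => //=; [exact: h1.1| |]; sst; lia.
  have [v2 [r2 E2 q2]] := pulls q1 r1 h2 n1.
  have h1' : step k (cconj k (cconj k.+1 s)) (cconj k.+1 s).
    by apply: step_conj; rewrite // ei.
  have h2' : step k.+1 (cconj k.+1 (cconj k (cconj k.+1 s))) (cconj k (cconj k.+1 s)).
    by apply: step_conj => //=; [exact: h1'.1| |]; sst; lia.
  have [w1 [rw1 F1]] := pull Ws' r' h1'.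
  have n1' : ninv (cconj k (cconj k.+1 s)) < ninv s by rewrite -ei; apply: step_inv h1'.
  have [w2 [rw2 F2 _]] := pulls (IH h1'.1 n1') rw1 h2' n1'.
  rewrite E1 E2 F1 F2 -!D_braid //; congr (D _ (D _ _)).
  rewrite -conj_braid in rw2.
  by apply: (Q_O q2 r2 rw2) => //=; sst; lia.
have [f1 g1] : io s1 i = i /\ sg s1 i = sg s i by apply: step_fixed h1 _ _ _; lia.
have [f2 g2] : io s1 i.+1 = i.+1 /\ sg s1 i.+1 = sg s i.+1.
  by apply: step_fixed h1 _ _ _; lia.
have h1' : step k (cconj i s1) (cconj i s).
  case: H1 => [[e4 [e ->]]|[e4 l4 ->]].
    rewrite (conj_unm_comm e vs e4); last lia.
    by apply: step_unm; rewrite // ei.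
  have -> : cconj i (cconj k s) = cconj k (cconj i s).
    by case: (ltnP i.+1 k) => h; [|symmetry]; rewrite conj_comm //; lia.
  by apply: step_conj; rewrite // ei.
have [w1 [rw1 F1]] := pull Ws' r' h1'.
rewrite E1 F1 !(D_commC (i := i)); try lia.
by congr (D _ _); apply: (Q_O q1 r1 rw1); rewrite ?g1 ?g2.
Qed.

Lemma T_holds v i : Rep s v -> i.+2 < N -> io s i = i -> io s i.+1 = i.+1 ->
    io s i.+2 = i.+2 -> sg s i <> sg s i.+1 -> sg s i = sg s i.+2 ->
    D i (D i.+1 v) = D i.+1 (D i v).
Proof.
move=> r hi e1 e2 e3 g1 g2.
case: (descentP vs) => [e|[k [hk d]]]; first by rewrite (Rep_matchless r e) F0_alt.
have [s1 h1] := step_ex vs hk d.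
have [v1 [r1 E1]] := pull Ws r h1.
have q1 := IHs h1; have n1 := step_inv h1.
have [_ _ H1] := up_inv h1.1 h1.2.
case: (k =P i) => [?|ki]; first by subst k; lia.
case: (k =P i.+1) => [?|ki2]; first by subst k; lia.
case: (k =P i.+2) => [?|ki3].
  subst k; case: H1 => [[e4]|[e4 l4 ?]]; first lia.
  subst s1; have l5 : io s i.+3 < i.
    have := valid_ne vs e1 (k := i.+3); have := valid_ne vs e2 (k := i.+3); lia.
  have h2 : step i.+1 (cconj i.+1 (cconj i.+2 s)) (cconj i.+2 s).
    by apply: step_conj => //=; [exact: h1.1| |]; sst; lia.
  have [v2 [r2 E2 q2]] := pulls q1 r1 h2 n1.
  have n2 := ltn_trans (step_inv h2) n1.
  have h3 : step i (cconj i (cconj i.+1 (cconj i.+2 s))) (cconj i.+1 (cconj i.+2 s)).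
    by apply: step_conj => //=; [exact: h2.1|lia| |]; sst; lia.
  have [v3 [r3 E3 q3]] := pulls q2 r2 h3 n2.
  rewrite E1 E2 E3 word_right //.
  by apply: (Q_T q3 r3) => //=; sst.
case: (k.+1 =P i) => [?|ki4].
  subst i; case: H1 => [[e4]|[e4 l4 ?]]; first lia.
  subst s1; have l5 : k.+3 < io s k.
    have := valid_ne vs e2 (k := k); have := valid_ne vs e3 (k := k); lia.
  have h2 : step k.+1 (cconj k.+1 (cconj k s)) (cconj k s).
    by apply: step_conj => //=; [exact: h1.1|lia| |]; sst; lia.
  have [v2 [r2 E2 q2]] := pulls q1 r1 h2 n1.
  have n2 := ltn_trans (step_inv h2) n1.
  have h3 : step k.+2 (cconj k.+2 (cconj k.+1 (cconj k s))) (cconj k.+1 (cconj k s)).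
    by apply: step_conj => //=; [exact: h2.1| |]; sst; lia.
  have [v3 [r3 E3 q3]] := pulls q2 r2 h3 n2.
  rewrite E1 E2 E3 word_left //.
  by apply: (Q_T q3 r3) => //=; sst; lia.
have [f1 k1] : io s1 i = i /\ sg s1 i = sg s i by apply: step_fixed h1 _ _ _; lia.
have [f2 k2] : io s1 i.+1 = i.+1 /\ sg s1 i.+1 = sg s i.+1.
  by apply: step_fixed h1 _ _ _; lia.
have [f3 k3] : io s1 i.+2 = i.+2 /\ sg s1 i.+2 = sg s i.+2.
  by apply: step_fixed h1 _ _ _; lia.
have c1 x : D i (D k x) = D k (D i x) by apply: D_commC; lia.
have c2 x : D i.+1 (D k x) = D k (D i.+1 x) by apply: D_commC; lia.
rewrite E1 c2 !c1 c2.
by congr (D _ _); apply: (Q_T q1 r1); rewrite ?k1 ?k2 ?k3.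
Qed.

(** For [j = i.+2] the arcs can be opened to + - + -, where [word_link] applies. Otherwise one of
    the two pairs of neighbouring ends is moved towards the other by a braid relation, or, if
    neither can move, there is a descent strictly between them that commutes with both letters. *)
Lemma L_holds v i j : Rep s v -> i.+1 < j -> io s i = j -> io s i.+1 = j.+1 ->
    D i v = D j v.
Proof.
move=> r hij e1 e2; have e3 := validI vs e1; have e4 := validI vs e2.
have hj : j.+1 < N.
  by rewrite ltnNge; apply/negP => h; have [_ h2 _] := vs; have := h2 _ h; lia.
case: (j =P i.+2) => [ji|ji].
  rewrite ji in hij e1 e2 e3 e4 hj *; clear ji.
  have h1 : step i.+1 (cconj i.+1 s) s by apply: step_conj => //; sst; lia.
  have h2 : step i (unm i true (cconj i.+1 s)) (cconj i.+1 s).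
    by apply: step_unm => /=; [exact: h1.1|sst].
  have h3 : step i.+2 (unm i.+2 true (unm i true (cconj i.+1 s))) (unm i true (cconj i.+1 s)).
    by apply: step_unm => /=; [exact: h2.1|sst].
  have n1 := step_inv h1; have n2 := ltn_trans (step_inv h2) n1.
  have [v1 [r1 E1]] := pull Ws r h1.
  have [v2 [r2 E2 q2]] := pulls (IHs h1) r1 h2 n1.
  have [v3 [r3 E3 q3]] := pulls q2 r2 h3 n2.
  rewrite E1 E2 E3 word_link //.
    by apply: (Q_T q3 r3) => /=; sst; lia.
  by apply: (Q_T q3 r3) => /=; sst; lia.
case: (ltnP (io s i.+2) j) => l1.
  have h1 : step i.+1 (cconj i.+1 s) s by apply: step_conj => //; sst; lia.
  have h2 : step i (cconj i (cconj i.+1 s)) (cconj i.+1 s).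
    by apply: step_conj => //=; [exact: h1.1|lia| |]; sst; swcases.
  have n1 := step_inv h1.
  have [v1 [r1 E1]] := pull Ws r h1.
  have [v2 [r2 E2 q2]] := pulls (IHs h1) r1 h2 n1.
  have L : D i.+1 v2 = D j v2 by apply: (Q_L q2 r2) => /=; sst; lia.
  by rewrite E1 E2 D_braid ?L ?(D_commC (j := j)) //; lia.
have {}l1 : j.+1 < io s i.+2.
  have := valid_ne vs e1 (k := i.+2); have := valid_ne vs e2 (k := i.+2); lia.
case: j => // j in hij e1 e2 e3 e4 hj ji l1 *.
case: (ltnP i.+1 (io s j)) => l2.
  have ny1 := valid_ne vs e1 (k := j); have ny2 := valid_ne vs e2 (k := j).
  have h1 : step j (cconj j s) s by apply: step_conj => //; sst; lia.
  have h2 : step j.+1 (cconj j.+1 (cconj j s)) (cconj j s).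
    by apply: step_conj => //=; [exact: h1.1| |]; sst; swcases.
  have n1 := step_inv h1.
  have [v1 [r1 E1]] := pull Ws r h1.
  have [v2 [r2 E2 q2]] := pulls (IHs h1) r1 h2 n1.
  have L : D i v2 = D j v2 by apply: (Q_L q2 r2) => /=; sst; lia.
  by rewrite E1 E2 -D_braid // -L -!(D_commC (i := i)) //; lia.
have {}l2 : io s j < i.
  have := valid_ne vs e3 (k := j); have := valid_ne vs e4 (k := j); lia.
(* The values lie behind the right pair at [i.+2] and before the left pair at [j], so they drop
   somewhere in between. *)
have [k hk hd] : exists2 k, i.+1 < k < j & io s k.+1 < io s k.
  case: (pselect (exists2 k, i.+1 < k < j & io s k.+1 < io s k)) => // hn; exfalso.
  have mono m : i.+1 < m <= j -> j.+2 < io s m.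
    elim: m => // m IHm hm; case: (i.+1 =P m) => [<- //|ne].
    have h : j.+2 < io s m by apply: IHm; lia.
    rewrite ltnNge; apply/negP => h2; apply: hn; exists m; lia.
  by have := mono j; lia.
have hkN : k.+1 < N by lia.
have [s1 h1] := step_ex vs hkN hd.
have [v1 [r1 E1]] := pull Ws r h1.
have [_ _ H1] := up_inv h1.1 h1.2.
have [f1 f2] : io s1 i = j.+1 /\ io s1 i.+1 = j.+2.
  by case: H1 => [[_ [e ->]]|[_ _ ->]] /=; split; sst.
rewrite E1 !(D_commC (j := k)); try lia.
by congr (D _ _); apply: (Q_L (IHs h1) r1) => //; lia.
Qed.

End Induction2.

Lemma Q_holds s : valid s -> Qp s.
Proof.
have [n] := ubnP (ninv s); elim: n s => // n IHn s hn vs.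
have IH s' : valid s' -> ninv s' < ninv s -> Qp s'.
  by move=> vs' h; apply: IHn => //; lia.
have Ws := W_holds vs IH.
split=> //.
- move=> v v' r r'; case: (Rep_inv r) => [e|[s0 [v0 [j [h0 r0 ->]]]]].
    by rewrite (Rep_matchless r e) (Rep_matchless r' e).
  by rewrite (Ws _ _ _ _ r' r0 h0).
- by move=> v i r; apply: Z_holds.
- exact: O_holds.
- exact: T_holds.
- exact: L_holds.
Qed.

Lemma Rep_uniq s v v' : Rep s v -> Rep s v' -> v = v'.
Proof. by move=> r; apply: (Q_uniq (Q_holds (Rep_valid r))) r. Qed.

Lemma Rep_none s v i : Rep s v -> i.+1 < N -> up i s = None -> D i v = V0.
Proof. by move=> r; apply: (Q_Z (Q_holds (Rep_valid r))). Qed.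

End Consistency.

Local Open Scope ring_scope.

(** * Divided differences *)

Section DividedDifferences.

Variable N' : nat.
Local Notation N := N'.+1.
Local Notation P := {mpoly int[N]}.

Definition z (i : nat) : P := 'X_(inord i).

(* The substitution z_i |-> h i is kept opaque: unfolding it makes unification diverge. *)
Fact sub_subproof (T : comNzRingType) (h : nat -> T) :
  {f : {rmorphism P -> T} | forall i, (i < N)%N -> f (z i) = h i}.
Proof.
exists (mmap intr (fun i : 'I_N => h i)) => i iN.
by rewrite /= /z mmapX mmap1U inordK.
Qed.

Definition sub (T : comNzRingType) (h : nat -> T) : {rmorphism P -> T} :=
  sval (sub_subproof h).

Lemma sub_z (T : comNzRingType) (h : nat -> T) i : (i < N)%N -> sub h (z i) = h i.
Proof. exact: (svalP (sub_subproof h)). Qed.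

Lemma mpolyC_int (c : int) : c%:MP_[N] = c%:~R.
Proof. by rewrite -[in LHS](intz c) rmorph_int. Qed.

Lemma rmorph_mpolyX_eq (T : comNzRingType) (f g : {rmorphism P -> T}) :
  (forall i, (i < N)%N -> f (z i) = g (z i)) -> f =1 g.
Proof.
move=> fg p.
have fgX m : f 'X_[m] = g 'X_[m].
  rewrite mpolyXE_id (rmorph_prod f) (rmorph_prod g); apply: eq_bigr => i _.
  rewrite (rmorphXn f) (rmorphXn g); congr (_ ^+ _).
  by have := fg i (ltn_ord i); rewrite /z inord_val.
rewrite (mpolyE p) (rmorph_sum f) (rmorph_sum g); apply: eq_bigr => m _.
rewrite -mul_mpolyC (rmorphM f) (rmorphM g) fgX mpolyC_int.
by rewrite (rmorph_int f) (rmorph_int g).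
Qed.

Definition perm_vars (i : nat) : {rmorphism P -> P} := sub (fun k => z (sw i k)).
Local Notation s := perm_vars.

Lemma s_z i k : (i.+1 < N)%N -> (k < N)%N -> s i (z k) = z (sw i k).
Proof. by move=> hi hk; rewrite sub_z. Qed.

Lemma sK i : (i.+1 < N)%N -> involutive (s i).
Proof.
move=> hi p; apply: (rmorph_mpolyX_eq (f := s i \o s i) (g := idfun)) => k hk /=.
by rewrite !s_z ?swK ?sw_lt.
Qed.

Lemma s_comm i j : (i.+1 < j)%N -> (j.+1 < N)%N -> forall p, s i (s j p) = s j (s i p).
Proof.
move=> hij hj p; apply: (rmorph_mpolyX_eq (f := s i \o s j) (g := s j \o s i)) => k hk /=.
rewrite !s_z ?sw_lt //; try lia.
by rewrite sw_comm.
Qed.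

Lemma s_braid i : (i.+2 < N)%N ->
  forall p, s i (s i.+1 (s i p)) = s i.+1 (s i (s i.+1 p)).
Proof.
move=> hi p.
apply: (rmorph_mpolyX_eq (f := s i \o (s i.+1 \o s i)) (g := s i.+1 \o (s i \o s i.+1))).
move=> k hk /=; rewrite !s_z ?sw_lt //; try lia.
by rewrite sw_braid.
Qed.

Local Notation dz i := (z i - z i.+1).

Lemma dz_neq0 i : (i.+1 < N)%N -> dz i != 0.
Proof.
move=> hi; apply/eqP => /(congr1 (fun p => p@_U_(inord i))).
rewrite mcoeffB !mcoeffXU mcoeff0 eqxx; case: eqP => // /(congr1 val) /=.
by rewrite !inordK //; lia.
Qed.

(** Divisibility is clear for constants and variables, and the twisted Leibniz rule passes it on to
    products. *)
Lemma ddiff_exists i p : (i.+1 < N)%N -> exists g, dz i * g == p - s i p.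
Proof.
move=> hi; rewrite [p]mpolyE.
elim/big_ind: _ => [|p1 p2 [g1 /eqP h1] [g2 /eqP h2]|m _].
- by exists 0; rewrite rmorph0 subr0 mulr0.
- by exists (g1 + g2); rewrite mulrDr h1 h2 rmorphD opprD addrACA.
rewrite -mul_mpolyC.
have mulc p1 p2 : (exists g, dz i * g == p1 - s i p1) -> (exists g, dz i * g == p2 - s i p2) ->
    exists g, dz i * g == p1 * p2 - s i (p1 * p2).
  move=> [g1 /eqP h1] [g2 /eqP h2]; exists (g1 * p2 + s i p1 * g2); apply/eqP.
  by rewrite mulrDr mulrA h1 mulrCA h2 rmorphM; ring.
apply: (mulc _ _); first by exists 0; rewrite mulr0 mpolyC_int rmorph_int subrr.
rewrite mpolyXE_id; elim/big_ind: _ => [||k _]; first by exists 0; rewrite rmorph1 subrr mulr0.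
  by move=> p1 p2; apply: (mulc p1 p2).
elim: (m k) => [|e IH]; first by exists 0; rewrite expr0 rmorph1 subrr mulr0.
rewrite exprS; apply: (mulc _ _) => //.
have -> : 'X_k = z k by rewrite /z inord_val.
rewrite s_z // /sw; case: eqP => [->|_]; first by exists 1; rewrite mulr1.
case: eqP => [->|_]; first by exists (- 1); rewrite mulrN1 opprB.
by exists 0; rewrite mulr0 subrr.
Qed.

(* Opaque for the same reason as [sub]. *)
Fact ddiff_subproof (i : nat) : {d : P -> P |
  ((i.+1 < N)%N -> forall p, dz i * d p = p - s i p) /\
  ((i.+1 < N)%N = false -> forall p, d p = 0)}.
Proof.
case: (boolP (i.+1 < N)%N) => [hi|/negbTE hi]; last by exists (fun=> 0).
by exists (fun p => xchoose (ddiff_exists p hi)); split=> // _ p; apply/eqP/(xchooseP (ddiff_exists p hi)).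
Qed.

Definition ddiff (i : nat) : P -> P := sval (ddiff_subproof i).
Local Notation D := ddiff.

Lemma ddiffE i p : (i.+1 < N)%N -> dz i * D i p = p - s i p.
Proof. by move=> hi; apply: (svalP (ddiff_subproof i)).1. Qed.

Lemma ddiff_out i p : (i.+1 < N)%N = false -> D i p = 0.
Proof. by move=> hi; apply: (svalP (ddiff_subproof i)).2. Qed.

Lemma ddiff_uniq i p g : (i.+1 < N)%N -> dz i * g = p - s i p -> D i p = g.
Proof.
by move=> hi e; apply: (mulfI (dz_neq0 hi)); rewrite ddiffE.
Qed.

Lemma s_dz i : (i.+1 < N)%N -> s i (dz i) = - dz i.
Proof.
by move=> hi; rewrite rmorphB /= !s_z ?swL ?swR ?opprB //; apply: ltnW.
Qed.

Lemma sE i p : (i.+1 < N)%N -> s i p = p - dz i * D i p.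
Proof. by move=> hi; rewrite ddiffE // opprB addrC subrK. Qed.

Lemma ddiff0 i : D i 0 = 0.
Proof.
case hi: (i.+1 < N)%N; last by rewrite ddiff_out.
by apply: ddiff_uniq; rewrite // mulr0 rmorph0 subrr.
Qed.

Lemma s_ddiff i p : (i.+1 < N)%N -> s i (D i p) = D i p.
Proof.
move=> hi; apply: (mulfI (dz_neq0 hi)); rewrite ddiffE //.
have : s i (dz i * D i p) = s i (p - s i p) by rewrite ddiffE.
rewrite rmorphM s_dz // rmorphB sK // => e.
by rewrite -(opprB (s i p) p) -e mulNr opprK.
Qed.

Lemma ddiff_sym i p : (i.+1 < N)%N -> s i p = p -> D i p = 0.
Proof. by move=> hi e; apply: ddiff_uniq; rewrite // mulr0 e subrr. Qed.

Lemma sym_ddiff i p : (i.+1 < N)%N -> D i p = 0 -> s i p = p.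
Proof. by move=> hi e; rewrite sE // e mulr0 subr0. Qed.

Lemma ddiff_nil i p : D i (D i p) = 0.
Proof.
case hi: (i.+1 < N)%N; last by rewrite ddiff_out.
by apply: ddiff_sym; rewrite // s_ddiff.
Qed.

Lemma ddiffM i p q : (i.+1 < N)%N -> D i (p * q) = D i p * q + s i p * D i q.
Proof.
move=> hi; apply: ddiff_uniq => //; rewrite mulrDr mulrA ddiffE // mulrCA ddiffE //.
by rewrite rmorphM; ring.
Qed.

Lemma ddiffD i p q : D i (p + q) = D i p + D i q.
Proof.
case hi: (i.+1 < N)%N; last by rewrite !ddiff_out ?addr0.
by apply: ddiff_uniq => //; rewrite mulrDr !ddiffE // rmorphD opprD addrACA.
Qed.

Lemma ddiffB i p q : D i (p - q) = D i p - D i q.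
Proof. by rewrite -[in RHS](subrK q p) (ddiffD i (p - q) q) addrK. Qed.

Lemma ddiff_symM i p q : (i.+1 < N)%N -> s i p = p -> D i (p * q) = p * D i q.
Proof. by move=> hi e; rewrite ddiffM // e ddiff_sym // mul0r add0r. Qed.

Lemma s_ddiff_comm i j p : (i.+1 < N)%N -> (j.+1 < N)%N -> (i.+1 < j)%N || (j.+1 < i)%N ->
  s i (D j p) = D j (s i p).
Proof.
move=> hi hj hij.
have sc q : s i (s j q) = s j (s i q).
  by case/orP: hij => h; [rewrite s_comm | rewrite [RHS]s_comm].
have sd : s i (dz j) = dz j.
  by rewrite rmorphB /= !s_z ?swD //; lia.
by symmetry; apply: ddiff_uniq; rewrite // -sc -rmorphB -ddiffE // rmorphM sd.
Qed.

Lemma ddiff_comm i j p : (i.+1 < j)%N || (j.+1 < i)%N -> D i (D j p) = D j (D i p).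
Proof.
move=> hij.
case hi: (i.+1 < N)%N; last by rewrite !(ddiff_out _ hi) ddiff0.
case hj: (j.+1 < N)%N; last by rewrite !(ddiff_out _ hj) ddiff0.
have sd : s j (dz i) = dz i.
  by rewrite rmorphB /= !s_z ?swD //; lia.
apply: ddiff_uniq => //; rewrite s_ddiff_comm // -ddiffB -ddiffE //.
by rewrite ddiff_symM.
Qed.

(* Both sides, multiplied by the Vandermonde product of the three variables,
   are the antisymmetrization of p. *)
Lemma ddiff_braid i p : (i.+2 < N)%N ->
  D i (D i.+1 (D i p)) = D i.+1 (D i (D i.+1 p)).
Proof.
move=> ht; have hs : (i.+1 < N)%N by lia.
have hi : (i < N)%N by lia.
have half (T : comNzRingType) (a b c p0 sp tp tsp stp stsp u v x tu stu sv : T) :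
    (a - b) * u = p0 - sp -> (b - c) * v = u - tu -> (a - b) * x = v - sv ->
    (a - c) * tu = tp - tsp -> (a - c) * sv = u - stu -> (b - c) * stu = stp - stsp ->
    (a - b) * (b - c) * (a - c) * x = p0 - sp - tp + tsp + stp - stsp.
  move=> e1 e2 e3 e4 e5 e6.
  have -> : (a - b) * (b - c) * (a - c) * x = (b - c) * (a - c) * ((a - b) * x) by ring.
  have -> : p0 - sp - tp + tsp + stp - stsp = (p0 - sp) - (tp - tsp) + (stp - stsp) by ring.
  rewrite e3 -e1 -e4 -e6.
  have -> : (b - c) * (a - c) * (v - sv) = (a - c) * ((b - c) * v) - (b - c) * ((a - c) * sv) by ring.
  by rewrite e2 e5; ring.
have sz1 : s i (z i) = z i.+1 by rewrite s_z // swL.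
have sz2 : s i (z i.+1) = z i by rewrite s_z // swR.
have sz3 : s i (z i.+2) = z i.+2 by rewrite s_z // swD //; lia.
have tz1 : s i.+1 (z i) = z i by rewrite s_z // swD //; lia.
have tz2 : s i.+1 (z i.+1) = z i.+2 by rewrite s_z // swL.
have tz3 : s i.+1 (z i.+2) = z i.+1 by rewrite s_z // swR.
have dzac : (z i - z i.+2) != 0.
  have <- : s i.+1 (dz i) = z i - z i.+2 by rewrite rmorphB /= tz1 tz2.
  by rewrite (inv_eq (sK ht)) rmorph0 dz_neq0.
apply: (mulfI (mulf_neq0 (mulf_neq0 (dz_neq0 hs) (dz_neq0 ht)) dzac)).
rewrite (half _ _ _ _ p (s i p) (s i.+1 p) (s i.+1 (s i p)) (s i (s i.+1 p)) (s i (s i.+1 (s i p)))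
  (D i p) (D i.+1 (D i p)) _ (s i.+1 (D i p)) (s i (s i.+1 (D i p))) (s i (D i.+1 (D i p)))).
- have -> : (z i - z i.+1) * (z i.+1 - z i.+2) * (z i - z i.+2) * D i.+1 (D i (D i.+1 p)) =
    (z i.+2 - z i.+1) * (z i.+1 - z i) * (z i.+2 - z i) * - D i.+1 (D i (D i.+1 p)).
    by generalize (z i) (z i.+1) (z i.+2) (D i.+1 (D i (D i.+1 p))) => a b c d; ring.
  rewrite (half _ _ _ _ p (s i.+1 p) (s i p) (s i (s i.+1 p)) (s i.+1 (s i p)) (s i.+1 (s i (s i.+1 p)))
    (- D i.+1 p) (D i (D i.+1 p)) _ (- s i (D i.+1 p)) (- s i.+1 (s i (D i.+1 p))) (s i.+1 (D i (D i.+1 p)))).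
  + by rewrite s_braid // -!addrA; congr (_ + _); rewrite addrCA; congr (_ + (_ + _)); rewrite addrCA.
  + by rewrite mulrN -mulNr opprB ddiffE.
  + by rewrite opprK [RHS]addrC -(opprB (D i.+1 p)) -ddiffE // -mulNr opprB.
  + by rewrite mulrN -mulNr opprB ddiffE.
  + by rewrite mulrN -rmorphB -ddiffE // rmorphM rmorphB /= sz2 sz3 -mulNr opprB.
  + rewrite opprK -[z i.+2 - z i]opprB mulNr.
    have <- : s i.+1 (dz i) = z i - z i.+2 by rewrite rmorphB /= tz1 tz2.
    by rewrite -rmorphM ddiffE // rmorphB s_ddiff // opprB addrC.
  + by rewrite mulrN -!rmorphB -ddiffE // !rmorphM !rmorphB /= sz2 sz3 tz1 tz3 -mulNr opprB.
- exact: ddiffE.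
- exact: ddiffE.
- exact: ddiffE.
- by rewrite -rmorphB -ddiffE // rmorphM rmorphB /= tz1 tz2.
- have <- : s i (dz i.+1) = z i - z i.+2 by rewrite rmorphB /= sz2 sz3.
  by rewrite -rmorphM ddiffE // rmorphB s_ddiff.
- by rewrite -!rmorphB -ddiffE // !rmorphM !rmorphB /= tz1 tz2 sz1 sz3.
Qed.

End DividedDifferences.

(** * Degree in one variable, homogeneity and constant terms *)

Section Degrees.

Variable N' : nat.
Local Notation N := N'.+1.
Local Notation P := {mpoly int[N]}.
Local Notation z := (@z N').
Local Notation s := (@perm_vars N').
Local Notation D := (@ddiff N').
Local Notation sub := (@sub N' _).
Local Notation dz i := (z i - z i.+1).

Definition uni (k : nat) : {rmorphism P -> {poly P}} :=
  sub (fun j => if j == k then 'X else (z j)%:P).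

Lemma uni_z k j : (j < N)%N -> uni k (z j) = if j == k then 'X else (z j)%:P.
Proof. exact: sub_z. Qed.

Definition degle (k r : nat) (f : P) : bool := (size (uni k f) <= r.+1)%N.

Lemma uni_s i k f : (i.+1 < N)%N -> (k < N)%N ->
  uni k (s i f) = map_poly (s i) (uni (sw i k) f).
Proof.
move=> hi hk.
apply: (rmorph_mpolyX_eq (f := uni k \o s i) (g := map_poly (s i) \o uni (sw i k))) => j hj.
have hj' : (sw i j < N)%N by rewrite sw_lt.
rewrite [LHS]/= [RHS]/= s_z // uni_z // uni_z // -(inj_eq (@sw_inj i)) swK.
by case: eqP => _; rewrite ?map_polyX // map_polyC /= s_z.
Qed.

Lemma degleW k r r' f : (r <= r')%N -> degle k r f -> degle k r' f.
Proof. by rewrite /degle => h h'; apply: leq_trans h' _; lia. Qed.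

Lemma degleM k r r' f g : degle k r f -> degle k r' g -> degle k (r + r') (f * g).
Proof.
rewrite /degle rmorphM => h h'; apply: leq_trans (size_polyMleq _ _) _.
by move: (size _) (size _) h h' => a b; lia.
Qed.

Lemma degle1 k : degle k 0 1.
Proof. by rewrite /degle rmorph1 size_poly1. Qed.

Lemma degle_z k j : (j < N)%N -> degle k (j == k) (z j).
Proof. by move=> hj; rewrite /degle uni_z //; case: eqP => _; rewrite ?size_polyX ?size_polyC ?leq_b1. Qed.

Lemma degleX k r f e : degle k r f -> degle k (r * e) (f ^+ e).
Proof.
move=> h; elim: e => [|e IH]; first by rewrite muln0 expr0 degle1.
by rewrite exprS mulnS degleM.
Qed.

Lemma size_uni_s_sub i k r f : (i.+1 < N)%N -> (k < N)%N -> degle k r f -> degle (sw i k) r f ->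
  (size (uni k (dz i * D i f)%R) <= r.+1)%N.
Proof.
move=> hi hk h1 h2; rewrite ddiffE // rmorphB; apply: leq_trans (size_polyD _ _) _.
rewrite size_polyN geq_max -/(degle k r f) h1 uni_s //; apply: leq_trans h2.
exact: size_poly.
Qed.

Lemma degle_ddiff_out i k r f : (i.+1 < N)%N -> (k < N)%N -> k != i -> k != i.+1 ->
  degle k r f -> degle k r (D i f).
Proof.
move=> hi hk ki ki1 h.
have := size_uni_s_sub hi hk h; rewrite swD // => /(_ h).
rewrite rmorphM rmorphB uni_z ?uni_z //; last exact: ltnW.
rewrite !ifF; try by [apply/negbTE; rewrite eq_sym].
rewrite -polyCB mul_polyC => h'; apply: leq_trans h'.
have [->|nz] := eqVneq (uni k (D i f)) 0; first by rewrite size_poly0.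
by rewrite -mul_polyC size_mul ?polyC_eq0 ?dz_neq0 // size_polyC dz_neq0.
Qed.

(** The divisor z_i - z_(i+1) has degree one in either variable. Since s_i exchanges the two
    degrees, the numerator is controlled only if both are bounded. *)
Lemma degle_ddiff_in i k r f : (i.+1 < N)%N -> (k == i) || (k == i.+1) ->
  degle i r.+1 f -> degle i.+1 r.+1 f -> degle k r (D i f).
Proof.
move=> hi hk h1 h2.
have hkN : (k < N)%N by case/orP: hk => /eqP->; lia.
have g1 : degle k r.+1 f by case/orP: hk => /eqP->.
have g2 : degle (sw i k) r.+1 f by case/orP: hk => /eqP->; rewrite ?swL ?swR.
have := size_uni_s_sub hi hkN g1 g2.
rewrite /degle; have [->|nz] := eqVneq (uni k (D i f)) 0; first by rewrite size_poly0.
rewrite rmorphM size_mul //; last first.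
  rewrite rmorphB uni_z ?uni_z //; last exact: ltnW.
  case/orP: hk => /eqP->; rewrite eqxx.
    by rewrite ifF ?polyXsubC_eq0 //; lia.
  by rewrite ifF; [rewrite -opprB oppr_eq0 polyXsubC_eq0|lia].
suff -> : size (uni k (dz i)) = 2%N by rewrite add2n /= => h; rewrite -ltnS.
rewrite rmorphB uni_z ?uni_z //; last exact: ltnW.
case/orP: hk => /eqP->; rewrite eqxx.
  by rewrite ifF ?size_XsubC //; lia.
by rewrite ifF; [rewrite -opprB size_polyN size_XsubC|lia].
Qed.

Lemma degle0_sub (T : comNzRingType) (h h' : nat -> T) k f : degle k 0 f ->
  (forall j, j != k -> h j = h' j) -> sub h f = sub h' f.
Proof.
move=> /size1_polyC e hh.
have E g : (forall j, j != k -> g j = h' j) -> sub g f = sub h' (uni k f)`_0.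
  move=> hg.
  have -> : sub g f = (map_poly (sub h') (uni k f)).[g k].
    apply: (rmorph_mpolyX_eq (f := sub g) (g := horner_eval (g k) \o map_poly (sub h') \o uni k)) => j hj.
    rewrite sub_z // [RHS]/= uni_z //; case: eqP => [->|/eqP jk]; first by rewrite map_polyX /horner_eval hornerX.
    by rewrite map_polyC /horner_eval hornerC /= sub_z // hg.
  by rewrite e map_polyC /= hornerC coefC.
by rewrite (E h) // (E h').
Qed.

Definition scal2 : {rmorphism P -> P} := sub (fun k => 2%:R * z k).

Lemma scal2_z k : (k < N)%N -> scal2 (z k) = 2%:R * z k.
Proof. exact: sub_z. Qed.

Definition ghom (a b : nat) (f : P) : Prop := 2%:R ^+ a * scal2 f = 2%:R ^+ b * f.

Lemma ghomM a b a' b' f g : ghom a b f -> ghom a' b' g -> ghom (a + a') (b + b') (f * g).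
Proof. by rewrite /ghom => h h'; rewrite rmorphM !exprD mulrACA h h' mulrACA. Qed.

Lemma ghom1 : ghom 0 0 1.
Proof. by rewrite /ghom rmorph1. Qed.

Lemma ghom_z k : (k < N)%N -> ghom 0 1 (z k).
Proof. by move=> hk; rewrite /ghom expr0 mul1r expr1 scal2_z. Qed.

Lemma ghomX a b e f : ghom a b f -> ghom (a * e) (b * e) (f ^+ e).
Proof.
move=> h; elim: e => [|e IH]; first by rewrite !muln0 expr0; apply: ghom1.
by rewrite exprS !mulnS; apply: ghomM.
Qed.

Lemma ghom_ddiff a b i f : (i.+1 < N)%N -> ghom a b f -> ghom a.+1 b (D i f).
Proof.
move=> hi h; have sc : scal2 (s i f) = s i (scal2 f).
  apply: (rmorph_mpolyX_eq (f := scal2 \o s i) (g := s i \o scal2)) => j hj.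
  transitivity (scal2 (z (sw i j))); first by congr (scal2 _); rewrite s_z.
  transitivity (s i (2%:R * z j)); last by congr (s i _); rewrite scal2_z.
  by rewrite scal2_z ?sw_lt // rmorphM rmorph_nat s_z.
rewrite /ghom; apply: (mulfI (dz_neq0 hi)).
have -> : dz i * (2%:R ^+ a.+1 * scal2 (D i f)) = 2%:R ^+ a * scal2 (dz i * D i f).
  rewrite rmorphM rmorphB scal2_z ?scal2_z //; last exact: ltnW.
  by rewrite exprS; ring.
rewrite ddiffE // rmorphB sc mulrBr mulrCA ddiffE // mulrBr h.
congr (_ - _); transitivity (s i (2%:R ^+ a * scal2 f)).
  by rewrite rmorphM rmorphXn rmorph_nat.
by rewrite h rmorphM rmorphXn rmorph_nat.
Qed.

Lemma pow2_inj a b : (2%:R : P) ^+ a = 2%:R ^+ b -> a = b.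
Proof.
rewrite -!natrX => /(congr1 (mcoeff 0%MM)).
rewrite -!mpolyC_nat !mcoeffC eqxx !mulr1 => /eqP; rewrite eqr_nat => /eqP.
exact: expnI.
Qed.

Lemma ghom_one a b : ghom a b 1 -> a = b.
Proof. by rewrite /ghom rmorph1 !mulr1; apply: pow2_inj. Qed.

Definition cst : {rmorphism P -> int} := sub (fun=> 0).

Lemma cst_z k : (k < N)%N -> cst (z k) = 0.
Proof. exact: sub_z. Qed.

Lemma cst_ghom a b f : ghom a b f -> a <> b -> cst f = 0.
Proof.
move=> h ab; have e : cst (scal2 f) = cst f.
  apply: (rmorph_mpolyX_eq (f := cst \o scal2) (g := cst)) => j hj.
  by rewrite [LHS]/= scal2_z // rmorphM cst_z // mulr0.
move/(congr1 cst): h; rewrite !rmorphM !rmorphXn !rmorph_nat e -!natrX => /eqP.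
rewrite -subr_eq0 -mulrBl mulf_eq0 subr_eq0 eqr_nat => /orP[/eqP/expnI|/eqP//].
by move=> /(_ isT).
Qed.

Lemma mcoeff0_sub (h : nat -> P) f : (forall j, (j < N)%N -> (h j)@_0%MM = 0) ->
  (sub h f)@_0%MM = cst f.
Proof.
move=> hh; apply: (rmorph_mpolyX_eq (f := mcoeff 0%MM \o sub h) (g := cst)) => j hj.
by rewrite [LHS]/= sub_z // hh // cst_z.
Qed.

End Degrees.

(** * Polynomials of sign words and clans *)

Section SignPolynomials.

Variable N' : nat.
Local Notation N := N'.+1.
Local Notation P := {mpoly int[N]}.
Local Notation z := (@z N').
Local Notation s := (@perm_vars N').
Local Notation D := (@ddiff N').

Definition mono (p : nat) : P := \prod_(j < p) z j.

Lemma monoS p : mono p.+1 = mono p * z p.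
Proof. exact: big_ord_recr. Qed.

Lemma s_mono i p : (i.+1 < N)%N -> (p <= N)%N -> i.+1 <> p -> s i (mono p) = mono p.
Proof.
move=> hi hp ip; case: (ltnP i.+1 p) => h.
  have hi0 : (i < p)%N by lia.
  have swp (j : 'I_p) : (sw i j < p)%N by rewrite sw_lt.
  pose t (j : 'I_p) : 'I_p := Ordinal (swp j).
  have tK : involutive t by move=> j; apply: val_inj; rewrite /= swK.
  rewrite /mono [RHS](reindex_inj (inv_inj tK)) rmorph_prod; apply: eq_bigr => j _.
  by rewrite s_z //; apply: leq_trans (ltn_ord j) hp.
rewrite /mono rmorph_prod; apply: eq_bigr => j _; have hj := ltn_ord j.
by rewrite s_z ?swD //; lia.
Qed.

Lemma degle_mono k p : (p <= N)%N -> degle k (k < p) (mono p).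
Proof.
elim: p => [|p IH] hp; first by rewrite /mono big_ord0 degle1.
rewrite monoS; apply: (@degleW _ _ ((k < p) + (p == k))); first by lia.
by apply: degleM; [apply: IH; lia|apply: degle_z].
Qed.

Lemma ghom_mono p : (p <= N)%N -> ghom 0 p (mono p).
Proof.
elim: p => [|p IH] hp; first by rewrite /mono big_ord0; apply: ghom1.
by rewrite monoS -(addn1 p); apply: (@ghomM N' 0 p 0 1); [apply: IH; lia|apply: ghom_z].
Qed.

(* Divided differences of a power: the complete homogeneous polynomial of
   degree r - t in the variables z_k, ..., z_(k+t). *)
Fixpoint hpow (k t r : nat) : P :=
  if t is t'.+1 then D (k + t') (hpow k t' r) else z k ^+ r.

Lemma hpowS k t r : hpow k t.+1 r = D (k + t) (hpow k t r).
Proof. by []. Qed.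

Lemma hpow0 k r : hpow k 0 r = z k ^+ r.
Proof. by []. Qed.

Arguments hpow : simpl never.

Lemma ddiff_z i : (i.+1 < N)%N -> D i (z i) = 1.
Proof. by move=> hi; apply: ddiff_uniq; rewrite // mulr1 s_z ?swL //; lia. Qed.

Lemma ddiff_hpow0 k t r m : (k + t < m)%N -> D m (hpow k t r) = 0.
Proof.
elim: t => [|t IH] h.
  case hm : (m.+1 < N)%N; last by rewrite ddiff_out.
  by apply: ddiff_sym => //; rewrite hpow0 rmorphXn s_z ?swD //; lia.
by rewrite hpowS ddiff_comm ?IH ?ddiff0 //; lia.
Qed.

Lemma hpow_rec k t r : (k + t.+1 < N)%N ->
  hpow k t.+1 r.+1 = z (k + t.+1) * hpow k t.+1 r + hpow k t r.
Proof.
elim: t => [|t IH] h.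
  rewrite !hpowS !hpow0 addn0 exprS ddiffM ?ddiff_z ?s_z ?swL; try lia.
  by rewrite mul1r addrC addn1.
rewrite [LHS]hpowS IH; last lia.
rewrite ddiffD ddiffM ?addnS ?ddiff_z ?s_z ?swL; try lia.
by rewrite mul1r (@ddiff_hpow0 k t) // addr0 [LHS]addrC [in RHS]hpowS addnS.
Qed.

Lemma hpow_lt k t r : (k + t < N)%N -> (r < t)%N -> hpow k t r = 0.
Proof.
elim: r t => [|r IH] [|t] // h hr; last first.
  by rewrite hpow_rec // !IH ?mulr0 ?addr0 //; lia.
elim: t {h hr} => [|t IHt]; last by rewrite hpowS IHt ddiff0.
case hm : (k.+1 < N)%N; first by rewrite hpowS hpow0 addn0 ddiff_sym // rmorph1.
by rewrite hpowS addn0 ddiff_out.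
Qed.

Lemma hpow_eq k t : (k + t < N)%N -> hpow k t t = 1.
Proof.
elim: t => [|t IH] h; first by rewrite hpow0 expr0.
by rewrite hpow_rec // hpow_lt // mulr0 add0r IH //; lia.
Qed.

Implicit Type b : nat -> bool.

Definition supp b := forall k, b k -> (k < N)%N.
Definition swap i b := fun k => b (sw i k).

Inductive RA : (nat -> bool) -> P -> Prop :=
  | RA_dom p of (p <= N)%N : RA (fun k => k < p)%N (mono p ^+ (N - p))
  | RA_step b f i of RA b f & (i.+1 < N)%N & b i & ~~ b i.+1 : RA (swap i b) (D i f).

(** This counts the pairs of a minus sign before a plus sign, that is, the moves made since the
    dominant word with all plus signs in front. *)
Definition mu b := ninv N (fun k => ~~ b k).

Lemma mu_swap i b : (i.+1 < N)%N -> b i -> ~~ b i.+1 -> mu (swap i b) = (mu b).+1.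
Proof.
by move=> hi h1 /negbTE h2; rewrite /mu (ninv_sw_r (f := fun k => ~~ b k)) // h1 h2.
Qed.

Lemma swapK i : involutive (swap i).
Proof. by move=> b; apply: funext => k; rewrite /swap swK. Qed.

Lemma mu_desc i b : (i.+1 < N)%N -> ~~ b i -> b i.+1 -> mu b = (mu (swap i b)).+1.
Proof.
move=> hi h1 h2; have := @mu_swap i (swap i b) hi; rewrite swapK; apply.
  by rewrite /swap swL.
by rewrite /swap swR.
Qed.

Lemma supp_swap i b : (i.+1 < N)%N -> supp b -> supp (swap i b).
Proof. by move=> hi h k /h; rewrite sw_lt. Qed.

Lemma RA_supp b f : RA b f -> supp b.
Proof. by elim=> [p hp k|b' f' i _ h hi _ _]; [move=> /leq_trans; apply|apply: supp_swap]. Qed.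

Lemma dom_or_desc b : supp b -> (exists2 p, (p <= N)%N & b = (fun k => k < p)%N) \/
  exists i, [/\ (i.+1 < N)%N, ~~ b i & b i.+1].
Proof.
move=> sb; case: (pselect (exists i, [/\ (i.+1 < N)%N, ~~ b i & b i.+1])); first by right.
move=> h; left; have ex : exists k, ~~ b k by exists N; apply/negP => /sb; rewrite ltnn.
case: (ex_minnP ex) => p hp min; exists p.
  by apply: min; apply/negP => /sb; rewrite ltnn.
have nb k : (p <= k)%N -> b k = false.
  elim: k => [|k IH] hk; first by apply/negbTE; rewrite (_ : 0%N = p) //; lia.
  move: hk; rewrite leq_eqVlt => /orP[/eqP <-|hk]; first exact/negbTE.
  apply/negP => h1; apply: h; exists k; split=> //; first exact: sb.
  by rewrite IH.
apply: funext => k; case: (ltnP k p) => hk; last exact: nb.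
by apply/negPn/negP => /min; lia.
Qed.

Lemma RA_down b f i : RA (swap i b) f -> (i.+1 < N)%N -> ~~ b i -> b i.+1 -> RA b (D i f).
Proof.
move=> r hi h1 h2; rewrite -(swapK i b); apply: RA_step r hi _ _; first by rewrite /swap swL.
by rewrite /swap swR.
Qed.

Lemma RA_ex b : supp b -> exists f, RA b f.
Proof.
have [n] := ubnP (mu b); elim: n b => // n IH b hn sb.
case: (dom_or_desc sb) => [[p hp ->]|[i [hi h1 h2]]].
  by exists (mono p ^+ (N - p)); apply: RA_dom.
have e := mu_desc hi h1 h2.
have [|f hf] := IH (swap i b) _ (supp_swap hi sb); first lia.
by exists (D i f); apply: RA_down hf hi h1 h2.
Qed.

Lemma RA_inv b f : RA b f ->
  (exists p, [/\ (p <= N)%N, b = (fun k => k < p)%N & f = mono p ^+ (N - p)]) \/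
  exists i f0, [/\ (i.+1 < N)%N, ~~ b i, b i.+1, RA (swap i b) f0 & f = D i f0].
Proof.
case=> [p hp|{}b {}f i r hi h1 h2]; first by left; exists p.
by right; exists i, f; rewrite swapK; split=> //; rewrite /swap ?swL ?swR.
Qed.

Definition flat i b := ~~ (b i && ~~ b i.+1).

Record QA b : Prop := {
  QA_uniq : forall f f', RA b f -> RA b f' -> f = f';
  QA_flat : forall f i, RA b f -> (i.+1 < N)%N -> flat i b -> D i f = 0 }.

(** Sign words need no further coincidences: two different places reading - + are never adjacent, so
    commutation joins any two chains. At a flat position that is not a descent the two signs are
    equal, and the pair is followed down to the dominant word as in [Z_holds]. *)
Lemma QA_holds b : supp b -> QA b.
Proof.
have [n] := ubnP (mu b); elim: n b => // n IHn b hn sb.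
have IH i : (i.+1 < N)%N -> ~~ b i -> b i.+1 -> QA (swap i b) /\ mu b = (mu (swap i b)).+1.
  move=> hi h1 h2; have e := mu_desc hi h1 h2.
  by split=> //; apply: IHn; [lia|apply: supp_swap].
have W f i f0 : RA b f -> (i.+1 < N)%N -> ~~ b i -> b i.+1 -> RA (swap i b) f0 -> f = D i f0.
  move=> r hi h1 h2 r0; case: (RA_inv r) => [[p [hp eb _]]|[j [f1 [hj g1 g2 r1 ->]]]].
    by move: h1 h2; rewrite eb; lia.
  have core i' j' f0' f1' : (i' <= j')%N -> (i'.+1 < N)%N -> ~~ b i' -> b i'.+1 -> 
      (j'.+1 < N)%N -> ~~ b j' -> b j'.+1 -> RA (swap i' b) f0' -> RA (swap j' b) f1' ->
      D i' f0' = D j' f1'.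
    move=> hij ki k1 k2 kj k3 k4 p0 p1.
    have [q0 _] := IH _ ki k1 k2; have [q1 _] := IH _ kj k3 k4.
    move: hij; rewrite leq_eqVlt => /orP[/eqP ?|hij].
      by subst j'; rewrite (QA_uniq q0 p0 p1).
    have {}hij : (i'.+1 < j')%N.
      by rewrite ltn_neqAle hij andbT; apply/eqP => e; move: k3; rewrite -e k2.
    have sj : supp (swap j' (swap i' b)) by do 2!apply: supp_swap => //.
    have [g r'] := RA_ex sj.
    have E : swap j' (swap i' b) = swap i' (swap j' b).
      by apply: funext => k; rewrite /swap (sw_comm k hij).
    have e0 : f0' = D j' g.
      apply: (QA_uniq q0 p0); apply: (RA_down r') => //; rewrite /swap swD //; lia.
    have e1 : f1' = D i' g.
      apply: (QA_uniq q1 p1); rewrite E in r'.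
      apply: (RA_down r') => //; rewrite /swap swD //; lia.
    by rewrite e0 e1 ddiff_comm // hij.
  case: (leqP i j) => hij; [symmetry|]; apply: core => //; lia.
split=> [f f' r r'|f i r hi fl].
  case: (RA_inv r) => [[p [hp eb ->]]|[j [f1 [hj g1 g2 r1 ->]]]].
    case: (RA_inv r') => [[p' [hp' eb' ->]]|[j [f1 [hj g1 g2 _ _]]]].
      suff -> : p = p' by [].
      have E k : (k < p)%N = (k < p')%N by rewrite -[LHS]/((fun k => k < p)%N k) -eb eb'.
      by have := E p; have := E p'; rewrite !ltnn; lia.
    by move: g1 g2; rewrite eb; lia.
  by rewrite (W _ _ _ r' hj g1 g2 r1).
case: (boolP (~~ b i && b i.+1)) => [/andP[h1 h2]|nd].
  have [f0 r0] := RA_ex (supp_swap hi sb).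
  by rewrite (W _ _ _ r hi h1 h2 r0) ddiff_nil.
have {fl nd} e : b i = b i.+1 by move: fl nd; rewrite /flat; case: (b i); case: (b i.+1).
case: (dom_or_desc sb) => [[p hp eb]|[k [hk h1 h2]]].
  case: (RA_inv r) => [[p' [hp' eb' ->]]|[j [f1 [hj g1 g2 _ _]]]]; last first.
    by move: g1 g2; rewrite eb; lia.
  apply: ddiff_sym => //; rewrite rmorphXn s_mono // => h.
  by move: e; rewrite eb' -h; lia.
have [f1 r1] := RA_ex (supp_swap hk sb); have [q1 n1] := IH _ hk h1 h2.
rewrite (W _ _ _ r hk h1 h2 r1).
case: (k =P i) => [?|ki]; first by subst k; move: h1; rewrite e h2.
have pull j : (j.+1 < N)%N -> ~~ b (sw k j) -> b (sw k j.+1) ->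
    exists f2, [/\ RA (swap j (swap k b)) f2, f1 = D j f2 & QA (swap j (swap k b))].
  move=> hj g1 g2; have s2 := supp_swap hj (supp_swap hk sb).
  have [f2 r2] := RA_ex s2; exists f2.
  have r3 : RA (swap k b) (D j f2) by apply: RA_down r2 hj g1 g2.
  split=> //; first exact: (QA_uniq q1).
  by apply: IHn => //; have := mu_desc (b := swap k b) hj g1 g2; lia.
case: (k =P i.+1) => [?|ki2].
  subst k; have [||f2 [r2 -> q2]] := pull i hi; rewrite ?swL ?swD ?e //; try lia.
  have g1 : sw i.+1 (sw i i.+1) = i by rewrite swR sw_below.
  have g2 : sw i.+1 (sw i i.+2) = i.+1 by rewrite sw_above swR.
  rewrite ddiff_braid // (QA_flat q2 r2) ?ddiff0 // /flat /swap g1 g2 e.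
  by case: (b _).
case: (k.+1 =P i) => [?|ki3].
  subst i; have [||f2 [r2 -> q2]] := pull k.+1 hi; rewrite ?swR ?swD -?e //; try lia.
  have g1 : sw k (sw k.+1 k) = k.+1 by rewrite sw_below swL.
  have g2 : sw k (sw k.+1 k.+1) = k.+2 by rewrite swL sw_above.
  have F : D k f2 = 0.
    apply: (QA_flat q2 r2); first exact: ltnW.
    by rewrite /flat /swap g1 g2 e; case: (b _).
  by rewrite -ddiff_braid // F !ddiff0.
rewrite ddiff_comm ?(QA_flat q1 r1) ?ddiff0 //; last lia.
by rewrite /flat /swap !swD ?e; try lia; case: (b _).
Qed.

Definition A b : P :=
  if pselect (exists f, RA b f) is left h then sval (cid h) else 0.

Lemma A_RA b : supp b -> RA b (A b).
Proof. by move=> /RA_ex h; rewrite /A; case: pselect => // h'; case: (cid h'). Qed.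

Lemma RA_A b f : RA b f -> f = A b.
Proof. by move=> r; apply: (QA_uniq (QA_holds (RA_supp r)) r); apply: A_RA; apply: RA_supp r. Qed.

Lemma A_up b i : supp b -> (i.+1 < N)%N -> b i -> ~~ b i.+1 -> D i (A b) = A (swap i b).
Proof. by move=> sb hi h1 h2; apply: RA_A; apply: RA_step => //; apply: A_RA. Qed.

Lemma A_flat b i : supp b -> (i.+1 < N)%N -> flat i b -> D i (A b) = 0.
Proof. by move=> sb; apply: (QA_flat (QA_holds sb)); apply: A_RA. Qed.

Definition minus_after b k := (\sum_(k.+1 <= j < N) ~~ b j)%N.

Lemma tail_rec b k : (k.+1 < N)%N -> minus_after b k = (~~ b k.+1 + minus_after b k.+1)%N.
Proof. by move=> hk; rewrite /minus_after big_ltn. Qed.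

Lemma tail_swap_gt b i k : (i < k)%N -> minus_after (swap i b) k = minus_after b k.
Proof.
move=> ik; rewrite /minus_after; apply: eq_big_nat => j hj.
by rewrite /swap swD //; lia.
Qed.

Lemma tail_swap_lt b i k : (i.+1 < N)%N -> (k < i)%N -> minus_after (swap i b) k = minus_after b k.
Proof.
move=> hi; have [n] := ubnP (i - k); elim: n k => // n IH k hn ki.
have hk : (k.+1 < N)%N by lia.
rewrite (tail_rec b hk) (tail_rec (swap i b) hk).
case: (k.+1 =P i) => [->|ne].
  rewrite (tail_rec b hi) (tail_rec (swap i b) hi) tail_swap_gt // /swap swL swR.
  by rewrite addnCA.
by rewrite IH; [rewrite /swap swD //; lia|lia|lia].
Qed.

(** A move at [i] lowers the degrees in z_i and z_(i+1) to the number of minus signs behind [i.+1].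
    After the plus sign has moved there, this is the count for both positions. *)
Lemma RA_degle b f k : RA b f -> (k < N)%N -> degle k (minus_after b k) f.
Proof.
move=> r; elim: r k => {b f} [p hp k hk|b f i _ IH hi h1 h2 k hk].
  apply: (@degleW _ _ ((k < p) * (N - p))); last by apply: degleX; apply: degle_mono.
  case: ltnP => // kp; rewrite mul1n /minus_after.
  rewrite (big_cat_nat (n := p)) //=.
  rewrite big_nat_cond big1 => [|j]; last by lia.
  rewrite add0n -[X in (X <= _)%N]muln1 -sum_nat_const_nat big_nat [X in (_ <= X)%N]big_nat.
  by apply: leq_sum => j hj; lia.
case: (ltngtP k i) => [ki|ki|->].
- rewrite tail_swap_lt //; apply: degle_ddiff_out => //; [lia|lia|exact: IH].
- case: (k =P i.+1) => [->|ki1]; last first.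
    by rewrite tail_swap_gt //; apply: degle_ddiff_out => //; [lia|lia|exact: IH].
  rewrite tail_swap_gt //; apply: degle_ddiff_in => //; first by rewrite eqxx orbT.
    by have := IH i (ltnW hi); rewrite (tail_rec b hi) h2.
  by apply: degleW (IH _ hi).
- have -> : minus_after (swap i b) i = minus_after b i.+1.
    by rewrite (tail_rec (swap i b) hi) tail_swap_gt // /swap swR h1.
  apply: degle_ddiff_in => //; first by rewrite eqxx.
    by have := IH i (ltnW hi); rewrite (tail_rec b hi) h2.
  by apply: degleW (IH _ hi).
Qed.

Lemma A_degle b k : supp b -> (k < N)%N -> degle k (minus_after b k) (A b).
Proof. by move=> sb; apply: RA_degle; apply: A_RA. Qed.

Lemma RA_ghom b f : RA b f -> exists a c, ghom a c f.
Proof.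
elim=> {b f} [p hp|b f i _ [a [c h]] hi _ _].
  by exists (0 * (N - p))%N, (p * (N - p))%N; apply: ghomX; apply: ghom_mono.
by exists a.+1, c; apply: ghom_ddiff.
Qed.

Lemma A_ghom b : supp b -> exists a c, ghom a c (A b).
Proof. by move=> sb; apply: RA_ghom (A_RA sb). Qed.

(** The plus signs travel to the right end one at a time, the last one first; [r] counts those that
    have arrived. The one starting at position c contributes z_c^q and crosses q minus signs, so its
    factor ends as a complete homogeneous polynomial of degree 0. *)
Lemma A_top q : (q <= N)%N -> A (fun k => (q <= k) && (k < N))%N = 1.
Proof.
move=> hq; pose p := (N - q)%N.
suff H r : (r <= p)%N -> RA (fun k => (k < p - r) || (N - r <= k < N))%N (mono (p - r) ^+ q).
  symmetry; apply: RA_A; have := H p (leqnn p).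
  rewrite subnn /mono big_ord0 expr1n; congr RA; apply: funext => k; rewrite /p; lia.
elim: r => [|r IH] hr.
  have := @RA_dom p (leq_subr _ _); rewrite subn0 [in X in _ -> RA _ (_ ^+ X)](_ : q = N - p)%N; last by rewrite /p; lia.
  by congr RA; apply: funext => k; lia.
set c := (p - r.+1)%N; have ec : (p - r = c.+1)%N by rewrite /c; lia.
suff H t : (t <= q)%N -> RA (fun k => [|| k < c, k == c + t | N - r <= k < N])%N
    (mono c ^+ q * hpow c t q).
  have := H q (leqnn q); rewrite hpow_eq ?mulr1; last by rewrite /c /p; lia.
  by congr RA; apply: funext => k; rewrite /c /p; lia.
elim: t => [|t IHt] ht.
  have := IH (ltnW hr); rewrite ec monoS exprMn hpow0 addn0.
  by congr RA; apply: funext => k; lia.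
have hi : ((c + t).+1 < N)%N by rewrite /c /p; lia.
have := RA_step (i := (c + t)%N) (IHt (ltnW ht)) hi _ _.
rewrite ddiff_symM //; last by rewrite rmorphXn s_mono // /c /p; lia.
rewrite -hpowS addnS => h; have {h} := h _ _; rewrite eqxx orbT.
have -> : swap (c + t) (fun k => [|| k < c, k == c + t | N - r <= k < N])%N =
   (fun k => [|| k < c, k == (c + t).+1 | N - r <= k < N])%N.
  apply: funext => k; rewrite /swap; have hc : (c + q = N - r - 1)%N by rewrite /c /p; lia.
  by case: swP => [->|->|k1 k2]; lia.
by apply=> //; rewrite /c /p; lia.
Qed.

End SignPolynomials.

(** * Products over a sign word and its negative, and their values on nested clans *)

Section ClanPolynomials.

Variable N' : nat.
Local Notation N := N'.+1.
Local Notation P := {mpoly int[N]}.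
Local Notation D := (@ddiff N').
Local Notation A := (@A N').
Local Notation supp := (@supp N').

Implicit Type b : nat -> bool.

Definition trunc b k := (k < N)%N && b k.
Definition neg b k := (k < N)%N && ~~ b k.

Lemma supp_trunc b : supp (trunc b).
Proof. by move=> k /andP[]. Qed.

Lemma supp_neg b : supp (neg b).
Proof. by move=> k /andP[]. Qed.

Lemma truncE b : supp b -> trunc b = b.
Proof. by move=> sb; apply: funext => k; rewrite /trunc; case hb: (b k) => /=; rewrite ?andbF // (sb _ hb). Qed.

Lemma trunc_swap i b : (i.+1 < N)%N -> trunc (swap i b) = swap i (trunc b).
Proof. by move=> hi; apply: funext => k; rewrite /trunc /swap sw_lt. Qed.

Lemma neg_swap i b : (i.+1 < N)%N -> neg (swap i b) = swap i (neg b).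
Proof. by move=> hi; apply: funext => k; rewrite /neg /swap sw_lt. Qed.

Lemma negK b : neg (neg b) = trunc b.
Proof. by apply: funext => k; rewrite /trunc /neg; case: (k < N)%N => //=; rewrite negbK. Qed.

Lemma ddiff_A_flat i b f : supp b -> (i.+1 < N)%N -> flat i b -> D i (A b * f) = A b * D i f.
Proof. by move=> sb hi h; rewrite ddiff_symM // sym_ddiff // A_flat. Qed.

Lemma ddiff_AA i b c : supp b -> supp c -> (i.+1 < N)%N -> b i -> ~~ b i.+1 -> flat i c ->
  D i (A b * A c) = A (swap i b) * A c.
Proof. by move=> sb sc hi h1 h2 h; rewrite mulrC ddiff_A_flat // A_up // mulrC. Qed.

Definition F0 b : P := A (trunc b) * A (neg b).

Lemma F0C b : F0 b = F0 (neg b).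
Proof.
rewrite /F0 mulrC (truncE (@supp_neg b)).
by rewrite negK.
Qed.

Lemma F0_up i b : (i.+1 < N)%N -> b i -> ~~ b i.+1 ->
  D i (F0 b) = A (swap i (trunc b)) * A (neg b).
Proof.
move=> hi h1 h2; rewrite ddiff_AA //; [exact: supp_trunc|exact: supp_neg|..].
- by rewrite /trunc h1 andbT; lia.
- by rewrite /trunc (negbTE h2) andbF.
- by rewrite /flat /neg h1 andbF.
Qed.

Lemma F0_same i b : (i.+1 < N)%N -> b i = b i.+1 -> D i (F0 b) = 0.
Proof.
move=> hi e; have hi0 : (i < N)%N by lia.
rewrite ddiff_A_flat ?A_flat ?mulr0 //; try exact: supp_trunc; try exact: supp_neg.
  by rewrite /flat /neg hi hi0 /= e andbN.
by rewrite /flat /trunc hi hi0 /= e andbN.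
Qed.

(** If b reads + - at [i], then D_i moves the sign in the factor of b on one side, and in the factor
    of the negated word on the other. Both results are the product of A(s_i b) and A(-b). *)
Lemma F0_opp i b : (i.+1 < N)%N -> b i <> b i.+1 -> D i (F0 b) = D i (F0 (swap i b)).
Proof.
have core (c : nat -> bool) : (i.+1 < N)%N -> c i -> ~~ c i.+1 -> D i (F0 c) = D i (F0 (swap i c)).
  move=> hi h1 h2; have hi0 : (i < N)%N by lia.
  have u : neg (swap i c) i by rewrite /neg /swap swL hi0.
  have w : ~~ neg (swap i c) i.+1 by rewrite /neg /swap swR h1 andbF.
  rewrite F0_up // (F0C (swap i c)) F0_up // (truncE (@supp_neg _)) negK.
  by rewrite neg_swap // swapK trunc_swap // mulrC.
move=> hi; have hi0 : (i < N)%N by lia.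
case h1: (b i); case h2: (b i.+1) => // _; first by apply: core; rewrite ?h1 ?h2.
rewrite F0C core ?/neg ?h1 ?h2 ?hi ?hi0 // -neg_swap //.
by rewrite -F0C.
Qed.

(** On + - + the letter [i] moves a sign of b and the letter [i.+1] a sign of -b. Each acts on its
    own factor and treats the other as a constant, before and after the other move. *)
Lemma F0_alt i b : (i.+2 < N)%N -> b i <> b i.+1 -> b i = b i.+2 ->
  D i (D i.+1 (F0 b)) = D i.+1 (D i (F0 b)).
Proof.
have core (c : nat -> bool) : (i.+2 < N)%N -> c i -> ~~ c i.+1 -> c i.+2 ->
    D i (D i.+1 (F0 c)) = D i.+1 (D i (F0 c)).
  move=> hi h1 h2 h3; have hi1 : (i.+1 < N)%N by lia.
  have hi0 : (i < N)%N by lia.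
  have st : supp (trunc c) by apply: supp_trunc.
  have sn : supp (neg c) by apply: supp_neg.
  have u : neg c i.+1 by rewrite /neg hi1 h2.
  have w : ~~ neg c i.+2 by rewrite /neg h3 andbF.
  rewrite (F0_up hi1 h1 h2) (F0C c) (F0_up hi u w) truncE // negK.
  rewrite [in LHS]mulrC (ddiff_AA (b := trunc c)) //.
  - rewrite [in RHS]mulrC (ddiff_AA (b := neg c)) //; first by rewrite mulrC.
      exact: supp_swap.
    by rewrite /flat /swap sw_above /trunc h3 hi !andbF.
  - exact: supp_swap.
  - by rewrite /trunc hi0.
  - by rewrite /trunc (negbTE h2) andbF.
  - by rewrite /flat /swap sw_below /neg h1 andbF.
move=> hi; have hi1 : (i.+1 < N)%N by lia.
have hi0 : (i < N)%N by lia.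
case h1: (b i); case h2: (b i.+1) => // _ h3; first by apply: core; rewrite ?h1 ?h2 -?h3.
by rewrite F0C core // /neg ?hi ?hi0 ?hi1 ?h1 ?h2 -?h3.
Qed.

Definition clan_rep := @Rep N P D F0.

Lemma clan_rep_uniq s f g : clan_rep s f -> clan_rep s g -> f = g.
Proof.
apply: (@Rep_uniq N P 0 D) => //.
- exact: ddiff0.
- exact: ddiff_nil.
- by move=> i j p h; rewrite ddiff_comm // h.
- by move=> i p h; apply: ddiff_braid.
- exact: F0_same.
- exact: F0_opp.
- exact: F0_alt.
Qed.

Lemma clan_rep_none s f i : clan_rep s f -> (i.+1 < N)%N -> clan_up N i s = None -> D i f = 0.
Proof.
apply: (@Rep_none N P 0 D) => //.
- exact: ddiff0.
- exact: ddiff_nil.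
- by move=> j k p h; rewrite ddiff_comm // h.
- by move=> j p h; apply: ddiff_braid.
- exact: F0_same.
- exact: F0_opp.
- exact: F0_alt.
Qed.

Lemma clan_rep_valid s f : clan_rep s f -> valid N s.
Proof. exact: Rep_valid. Qed.

Lemma clan_rep_up s f i s' : clan_rep s f -> clan_up N i s = Some s' -> clan_rep s' (D i f).
Proof. exact: Rep_up. Qed.

Lemma tail_sum b k : (minus_after N' (trunc b) k + minus_after N' (neg b) k = N' - k)%N.
Proof.
rewrite /minus_after -big_split /= big_nat (eq_bigr (fun=> 1%N)).
  by rewrite -big_nat sum_nat_const_nat muln1.
by move=> j hj; rewrite /trunc /neg (_ : (j < N)%N = true); [case: (b j)|lia].
Qed.

(** At a matchless clan the bounds of the two factors add up to the number of all positions behind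
    [k], and divided differences preserve this bound. At the last position it says that f does not
    involve the last variable. *)
Lemma clan_rep_degle s f k : clan_rep s f -> (k < N)%N -> degle k (N' - k) f.
Proof.
move=> r; elim: r k => {s f} [b _ k hk|s f i s' _ IH hu k hk].
  rewrite -(tail_sum b k); apply: degleM; apply: A_degle => //.
    exact: supp_trunc.
  exact: supp_neg.
have hi : (i.+1 < N)%N by move: hu; rewrite /clan_up; case: ifP.
case: (boolP ((k == i) || (k == i.+1))) => [h|]; last first.
  by rewrite negb_or => /andP[h1 h2]; apply: degle_ddiff_out => //; apply: IH.
apply: degle_ddiff_in => //.
  by apply: degleW (IH i (ltnW hi)); lia.
by apply: degleW (IH _ hi); lia.
Qed.

Lemma clan_rep_ghom s f : clan_rep s f -> exists a c, ghom a c f.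
Proof.
elim=> {s f} [b _|s f i s' _ [a [c h]] hu].
  have [a1 [c1 h1]] := A_ghom (@supp_trunc b); have [a2 [c2 h2]] := A_ghom (@supp_neg b).
  by exists (a1 + a2)%N, (c1 + c2)%N; apply: ghomM.
by exists a.+1, c; apply: ghom_ddiff => //; move: hu; rewrite /clan_up; case: ifP.
Qed.

Definition nest m (b : nat -> bool) := St
  (fun k => if (k < N) && ((k < m) || (N - m <= k)) then N' - k else k)%N
  (fun k => (m <= k < N - m)%N && b k).

(* The sign word -^m b +^m, where b is read on the positions m, ..., N-m-1. *)
Definition pad_signs m (b : nat -> bool) k := [&& k < N, m <= k & (N - m <= k) || b k]%N.

(* The outermost m + 1 arcs, the innermost of which only reaches from m to
   m + 1 + t; the remaining positions carry the signs of b in order. *)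
Definition slide m t (b : nat -> bool) := St
  (fun k => if k == m then m.+1 + t else if k == m.+1 + t then m else
            if (k < N) && ((k < m) || (N - m <= k)) then N' - k else k)%N
  (fun k => [&& m < k, k < N - m, k != m.+1 + t & if k < m.+1 + t then b k else b k.-1])%N.

(** In both factors the unfinished arc counts as a minus sign at its left end and a plus sign at its
    right end, just as the finished arcs do in [pad_signs]. *)
Definition slide_signs m t (b : nat -> bool) k :=
  [&& k < N, m < k & if k < m.+1 + t then b k else (k == m.+1 + t) || (if k < N - m then b k.-1 else true)]%N.

Lemma supp_slide m t b : supp (slide_signs m t b).
Proof. by move=> k /and3P[]. Qed.

Lemma slide_signs_next m t b : (m.+1 + t < N - m.+1)%N ->
  swap (m.+1 + t) (slide_signs m t b) = slide_signs m t.+1 b.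
Proof.
move=> h; apply: funext => k; rewrite /swap /slide_signs addnS.
case: (swP (m.+1 + t) k) => [->|->|k1 k2]; try by natb.
by case: (ltngtP k (m.+1 + t)) => // hk; natb.
Qed.

(** Exchanging two plus signs leaves the word unchanged. Hence, as the right end of the arc passes a
    sign, exactly one of the words for b and -b moves, and the other factor is symmetric there. *)
Lemma slide_signs_fix m t b : (m.+1 + t < N - m.+1)%N -> b (m.+1 + t)%N ->
  slide_signs m t b = slide_signs m t.+1 b.
Proof.
move=> h hb; apply: funext => k; rewrite /slide_signs addnS.
case: (k =P (m.+1 + t)%N) => [->|k1]; first by natb; rewrite hb.
case: (k =P (m.+1 + t).+1) => [->|k2]; first by natb; rewrite hb.
by case: (ltngtP k (m.+1 + t)) => // hk; natb.
Qed.

Lemma slide_signs_at m t b : (m.+1 + t < N - m.+1)%N -> slide_signs m t b (m.+1 + t).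
Proof. by move=> h; rewrite /slide_signs; natb. Qed.

Lemma slide_signs_atS m t b : (m.+1 + t < N - m.+1)%N ->
  slide_signs m t b (m.+1 + t).+1 = b (m.+1 + t)%N.
Proof. by move=> h; rewrite /slide_signs; natb. Qed.

Lemma up_slide m t b : (m.+1 + t < N - m.+1)%N ->
  clan_up N (m.+1 + t) (slide m t b) = Some (slide m t.+1 b).
Proof.
move=> h; rewrite /clan_up /=; natb.
congr Some; apply: st_eq => k /=.
  case: (swP (m.+1 + t) k) => [->|->|k1 k2]; try by natb; sst.
  case: (k =P m) => [?|k3]; natb; first by rewrite swL addnS.
  by case: ifP => hk; rewrite swD //; lia.
case: (swP (m.+1 + t) k) => [->|->|k1 k2]; try by natb.
by case: (ltngtP k (m.+1 + t)) => // hk; natb.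
Qed.

Lemma valid_nest m b : (m.*2 <= N)%N -> valid N (nest m b).
Proof.
move=> hm; split=> k /=.
- case h : ((k < N) && ((k < m) || (N - m <= k)))%N; last by rewrite h.
  by rewrite ifT; lia.
- by move=> hk; rewrite ifF //; lia.
- by case/andP => hk _; rewrite ifF //; lia.
Qed.

Definition clan_rep_nest m := forall b, clan_rep (nest m b)
  (A (pad_signs m b) * A (pad_signs m (fun k => ~~ b k))).

Lemma rep_nest0 : clan_rep_nest 0.
Proof.
move=> b; have -> : nest 0 b = St id (trunc b).
  by apply: st_eq => k /=; [rewrite ifF //; lia|rewrite subn0].
have e (c : nat -> bool) : pad_signs 0 c = trunc c.
  apply: funext => k; rewrite /pad_signs /trunc subn0 leq0n /=.
  by case: ltnP => //= h; rewrite leqNgt h.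
have -> : A (pad_signs 0 b) * A (pad_signs 0 (fun k => ~~ b k)) = F0 (trunc b).
  rewrite /F0 !e (truncE (@supp_trunc b)); congr (_ * A _).
  by apply: funext => k; rewrite /trunc /neg; case: (k < N)%N.
by apply: Rep_base; split=> // k /andP[].
Qed.

Lemma rep_slide0 m b : (m.+1.*2 <= N)%N -> clan_rep_nest m ->
  clan_rep (slide m 0 b) (A (slide_signs m 0 b) * A (slide_signs m 0 (fun k => ~~ b k))).
Proof.
move=> hm IH.
(* The new arc is created from a plus sign at [m] and a minus sign at [m.+1], with the signs of b
   shifted behind them. The factor of [b'] turns from + - to - +, and the factor of its negation
   already reads - + there. *)
pose b' k := (k == m) || (m.+1 < k)%N && b k.-1.
have hi : (m.+1 < N)%N by lia.
have hi0 : (m < N)%N by lia.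
have hu : clan_up N m (nest m b') = Some (slide m 0 b).
  rewrite /clan_up /= /b'; natb; congr Some; apply: st_eq => k /=.
    by case: (swP m k) => [->|->|k1 k2]; natb; rewrite ?addn0.
  case: (k =P m) => [?|k1]; first by subst k; natb.
  case: (k =P m.+1) => [?|k2]; first by subst k; rewrite addn0; natb.
  by case: (ltngtP k m) => // hk; natb; case: ltnP => //=; rewrite ?andbT // ; natb.
have := clan_rep_up (IH b') hu; rewrite ddiff_AA //.
- congr clan_rep; congr (A _ * A _).
    apply: funext => k; rewrite /swap /pad_signs /slide_signs addn0 /b'.
    case: (swP m k) => [->|->|k1 k2]; natb => //.
    by case: (ltngtP k m) => // hk; natb => //; case: (leqP (N - m) k) => // h; natb.
  apply: funext => k; rewrite /pad_signs /slide_signs addn0 /b'.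
  case: (k =P m) => [?|k1]; first by subst k; natb.
  case: (k =P m.+1) => [?|k2]; first by subst k; natb.
  by case: (ltngtP k m) => // hk; natb => //; case: (leqP (N - m) k) => // h; natb.
- by move=> k /and3P[].
- by move=> k /and3P[].
- by rewrite /pad_signs /b'; natb.
- by rewrite /pad_signs /b'; natb.
- by rewrite /flat /pad_signs /b'; natb.
Qed.

Lemma rep_slide m t b : (m.+1.*2 <= N)%N -> (m.+1 + t < N - m)%N -> clan_rep_nest m ->
  clan_rep (slide m t b) (A (slide_signs m t b) * A (slide_signs m t (fun k => ~~ b k))).
Proof.
move=> hm ht IH; elim: t ht => [|t IHt] ht; first exact: rep_slide0.
have h : (m.+1 + t < N - m.+1)%N by lia.
have hi : ((m.+1 + t).+1 < N)%N by lia.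
have := clan_rep_up (IHt _) (up_slide b h); rewrite -/(_ + t)%N.
have sb c : supp (slide_signs m t c) by apply: supp_slide.
case hb : (b (m.+1 + t)%N).
  rewrite (slide_signs_fix h hb) [A _ * _]mulrC ddiff_AA //.
  - by rewrite slide_signs_next // mulrC; apply; lia.
  - exact: supp_slide.
  - exact: slide_signs_at.
  - by rewrite slide_signs_atS // hb.
  - by rewrite /flat -(slide_signs_fix h hb) slide_signs_atS // hb andbF.
have hn : ~~ b (m.+1 + t)%N by rewrite hb.
rewrite (slide_signs_fix (b := fun k => ~~ b k) h hn) ddiff_AA //.
- by rewrite slide_signs_next //; apply; lia.
- exact: supp_slide.
- exact: slide_signs_at.
- by rewrite slide_signs_atS // hb.
- by rewrite /flat -(slide_signs_fix (b := fun k => ~~ b k) h hn) slide_signs_atS // hn andbF.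
Qed.

Lemma rep_nest m : (m.*2 <= N)%N -> clan_rep_nest m.
Proof.
elim: m => [|m IH] hm; first exact: rep_nest0.
move=> b; have hm' : (m.*2 <= N)%N by lia.
(* The right end starts at [m.+1] and has to reach [N - m.+1], which takes [N - m.+1.*2] slides. *)
have ht : (m.+1 + (N - m.+1.*2) < N - m)%N by lia.
have := rep_slide b hm ht (IH hm').
have et : (m.+1 + (N - m.+1.*2) = N - m.+1)%N by lia.
have e c : slide_signs m (N - m.+1.*2) c = pad_signs m.+1 c.
  apply: funext => k; rewrite /slide_signs et /pad_signs.
  by case: (ltngtP k (N - m.+1)) => hk; natb.
rewrite !e; congr clan_rep; apply: st_eq => k /=; rewrite et.
  case: (k =P m) => [?|k1]; first by subst k; natb; lia.
  case: (k =P (N - m.+1)%N) => [?|k2]; first by subst k; natb; lia.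
  by case: (ltnP k N) => h; natb => //; case: (ltnP k m) => h1; natb => //; case: (leqP (N - m) k) => h2; natb.
by case: (ltngtP k (N - m.+1)) => hk; natb.
Qed.

Lemma rep_top m (e : bool) : (m.*2 <= N)%N -> clan_rep (nest m (fun=> e)) 1.
Proof.
move=> hm; have := rep_nest hm (fun=> e).
have e1 : A (pad_signs m (fun=> true)) = 1.
  rewrite -(@A_top N' m); last lia.
  by congr A; apply: funext => k; rewrite /pad_signs orbT andbT andbC.
have e2 : A (pad_signs m (fun=> false)) = 1.
  rewrite -(@A_top N' (N - m)); last lia.
  by congr A; apply: funext => k; rewrite /pad_signs orbF; lia.
by case: e; rewrite /= e1 e2 mulr1.
Qed.

End ClanPolynomials.

(** * Coefficients and tableaux *)

Section WordCount.

Variable N' : nat.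
Local Notation N := N'.+1.
Local Notation P := {mpoly int[N]}.
Local Notation z := (@z N').
Local Notation s := (@perm_vars N').
Local Notation D := (@ddiff N').
Local Notation sub := (@sub N' _).
Local Notation cst := (@cst N').

Definition kill (Q : pred nat) : {rmorphism P -> P} := sub (fun i => if Q i then z i else 0).

Lemma killX (Q : pred nat) (m : 'X_{1..N}) :
  kill Q 'X_[m] = if [forall i : 'I_N, (m i != 0%N) ==> Q i] then 'X_[m] else 0.
Proof.
have e (i : 'I_N) : kill Q ('X_i ^+ m i) = if (m i != 0%N) ==> Q i then 'X_i ^+ m i else 0.
  have -> : 'X_i = z i by rewrite /z inord_val.
  rewrite rmorphXn /= /kill sub_z //; case: (m i) => [|c] /=; first by rewrite !expr0.
  by case: (Q i) => //=; rewrite expr0n.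
rewrite mpolyXE_id rmorph_prod; case: ifP => [/forallP h|/negbT].
  by apply: eq_bigr => i _; rewrite e h.
by rewrite negb_forall => /existsP[i /negbTE hi]; rewrite (bigD1 i) //= e hi mul0r.
Qed.

Lemma mcoeff_kill (Q : pred nat) (m : 'X_{1..N}) f :
  (kill Q f)@_m = if [forall i : 'I_N, (m i != 0%N) ==> Q i] then f@_m else 0.
Proof.
rewrite {1}(mpolyE f) rmorph_sum raddf_sum /=.
transitivity (\sum_(m' <- msupp f) (if [forall i : 'I_N, (m' i != 0%N) ==> Q i]
    then (f@_m' *: 'X_[m'])@_m else 0)).
  apply: eq_bigr => m' _; rewrite -mul_mpolyC rmorphM mpolyC_int rmorph_int killX.
  by case: ifP => _; rewrite ?mulr0 ?mcoeff0 // -mpolyC_int.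
case: ifP => h.
  rewrite [in RHS](mpolyE f) raddf_sum /=; apply: eq_bigr => m' _.
  case: ifP => // h'; rewrite mcoeffZ mcoeffX; case: eqP => [e|]; last by rewrite mulr0.
  by move: h'; rewrite e h.
apply: big1 => m' _; case: ifP => // h'; rewrite mcoeffZ mcoeffX.
by case: eqP => [e|]; [move: h; rewrite -e h'|rewrite mulr0].
Qed.

Definition mnm_of (rb : seq nat) : 'X_{1..N} := [multinom count_mem (i : nat) rb | i < N].

Lemma mnm_ofE rb (i : 'I_N) : mnm_of rb i = count_mem (i : nat) rb.
Proof. exact: mnmE. Qed.

Lemma mnm_of_nil : mnm_of [::] = 0%MM.
Proof. by apply/mnmP => i; rewrite [RHS]mnm0E mnm_ofE. Qed.

Lemma mnm_of_cons k rb : (k < N)%N -> mnm_of (k :: rb) = (U_(inord k) + mnm_of rb)%MM.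
Proof.
move=> hk; apply/mnmP => i; rewrite mnmDE mnm1E !mnm_ofE /=; congr (_ + _)%N.
by rewrite -val_eqE /= inordK.
Qed.

Lemma mnm_of_neq0 rb (i : 'I_N) : (mnm_of rb i != 0%N) = (nat_of_ord i \in rb).
Proof. by rewrite mnm_ofE -lt0n -has_count has_pred1. Qed.

(** This is the stage at which the variable z_k is being extracted and the letters below [j] have
    been tried: z_k stands in for z_j, and the remaining later variables are zero. *)
Definition spec (k j : nat) : {rmorphism P -> P} :=
  sub (fun i => if (i < k)%N then z i else if i == j then z k else 0).

Lemma spec_z k j i : (i < N)%N -> spec k j (z i) = if (i < k)%N then z i else if i == j then z k else 0.
Proof. exact: sub_z. Qed.

Lemma kill_z Q i : (i < N)%N -> kill Q (z i) = if Q i then z i else 0.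
Proof. exact: sub_z. Qed.

Lemma spec_id f : spec N' N' f = f.
Proof.
apply: (rmorph_mpolyX_eq (f := spec N' N') (g := idfun)) => i hi.
rewrite spec_z //=; case: ltnP => // h; rewrite (_ : i = N') ?eqxx //; lia.
Qed.

(** Under [spec k j.+1] the variable z_j vanishes and z_(j+1) becomes z_k. So the divisor of D_j
    becomes - z_k, and composing with s_j gives [spec k j]. The two summands are the cases where the
    letter [j] is skipped and where it is used at the price of one z_k. *)
Lemma spec_step k j f : (k <= j)%N -> (j.+1 < N)%N ->
  spec k j f = spec k j.+1 f + z k * spec k j.+1 (D j f).
Proof.
move=> kj hj.
have e : spec k j.+1 (s j f) = spec k j f.
  apply: (rmorph_mpolyX_eq (f := spec k j.+1 \o s j) (g := spec k j)) => i hi.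
  rewrite [LHS]/= s_z // !spec_z ?(sw_lt _ hj) //.
  case: (swP j i) => [->|->|i1 i2]; natb => //.
have hj0 : (j < N)%N by lia.
have := congr1 (spec k j.+1) (ddiffE f hj).
rewrite rmorphM !rmorphB (spec_z _ _ hj0) (spec_z _ _ hj).
rewrite e; natb.
rewrite sub0r mulNr => h.
by rewrite -[z k * _]opprK h opprB addrC subrK.
Qed.

Lemma spec_last k f : (k <= N')%N -> degle N' 0 f -> spec k N' f = kill (fun i => i < k)%N f.
Proof.
move=> hk h; apply: (degle0_sub h) => j jN.
by case: ltnP => // _; rewrite (negbTE jN).
Qed.

Lemma kill_spec k j b f : (b < k)%N -> (k <= j)%N -> (k <= N')%N ->
  kill (fun i => i < b.+1)%N (spec k j f) = spec b b f.
Proof.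
move=> bk kj hk.
apply: (rmorph_mpolyX_eq (f := kill _ \o spec k j) (g := spec b b)) => i hi.
rewrite [LHS]/= spec_z // spec_z //.
case: (ltngtP i b) => [h|h|->].
- by rewrite ifT ?kill_z ?ltnS ?ifT //; lia.
- case: ifP => h1; first by rewrite kill_z // ifF //; lia.
  case: eqP => [e|]; last by rewrite rmorph0.
  by rewrite kill_z ?ifF //; lia.
- by rewrite bk kill_z ?ltnSn //; lia.
Qed.

Variables (S : Type) (up : nat -> S -> option S) (istop : S -> bool) (Rp : S -> P -> Prop).
Hypothesis Rp_up : forall x f i y, Rp x f -> up i x = Some y -> Rp y (D i f).
Hypothesis Rp_none : forall x f i, Rp x f -> (i.+1 < N)%N -> up i x = None -> D i f = 0.
Hypothesis Rp_last : forall x f, Rp x f -> degle N' 0 f.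
Hypothesis Rp_cst : forall x f, Rp x f -> cst f = (istop x)%:R.

(* Number of words from x to the top compatible with the weakly increasing
   sequence [rev rb]: the letters are read from the last one on, k is the
   previously read entry of the sequence and j a lower bound for the next
   letter if the entry does not change. *)
Fixpoint wcount (rb : seq nat) (k j : nat) (x : S) : nat :=
  if rb is b :: rb' then
    let lo := if b == k then j else b in
    \sum_(lo <= i < N') (if up i x is Some y then wcount rb' b i.+1 y else 0)%N
  else istop x.

Lemma mcoeff_spec rb k j x f : Rp x f -> sorted geq rb -> all (fun b => b <= k)%N rb ->
  (k <= j <= N')%N -> (spec k j f)@_(mnm_of rb) = (wcount rb k j x)%:R.
Proof.
elim: rb k j x f => [|b rb IH] k j x f r.
  move=> _ _ hkj; rewrite mnm_of_nil -(Rp_cst r) /spec; apply: mcoeff0_sub => i hi.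
  have z0 l : (z l)@_0%MM = 0 by rewrite /z mcoeffX; case: eqP => // /mnmP/(_ (inord l)); rewrite mnm0E mnm1E eqxx.
  by case: ifP => _; [|case: ifP => _]; rewrite ?mcoeff0.
move=> /= hs /andP[bk ak].
have hs' := path_sorted hs.
have ab : all (fun b' => b' <= b)%N rb by apply: order_path_min hs; apply: (rev_trans leq_trans).
have core l : (b <= l <= N')%N -> (b <= N')%N -> 
    (spec b l f)@_(mnm_of (b :: rb)) =
    (\sum_(l <= i < N') (if up i x is Some y then wcount rb b i.+1 y else 0)%N)%:R.
  move=> /andP[bl lN] bN; have hbN : (b < N)%N by rewrite ltnS.
  have [n] := ubnP (N' - l); elim: n l bl lN => // n IHn l bl lN hn.
  move: lN; rewrite leq_eqVlt => /orP[/eqP->|lN].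
    (* No letter is left, and f does not involve the last variable, so z_b is effectively zero
       although the monomial still contains it. *)
    rewrite big_geq // spec_last //; last exact: Rp_last r.
    rewrite mcoeff_kill ifF //; apply/negbTE/forallPn; exists (inord b).
    by rewrite mnm_of_neq0 inordK // in_cons eqxx ltnn.
  rewrite spec_step // mcoeffD IHn; try lia.
  rewrite mnm_of_cons // [z b * _]mulrC /z mcoeffMX [in RHS]big_ltn // [RHS]natrD [RHS]addrC; congr (_ + _).
  case E: (up l x) => [y|]; first by apply: IH (Rp_up r E) hs' ab _; lia.
  by rewrite (Rp_none r _ E) ?rmorph0 ?mcoeff0 //.
move=> /andP[kj jN]; case: (b =P k) => [e|ne].
  by rewrite -e in kj *; apply: core; rewrite ?kj //; apply: leq_trans jN.
have {}bk : (b < k)%N by lia.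
(* The monomial has no variable behind z_b. Setting those variables to zero does not affect its
   coefficient and restarts the extraction at [spec b b]. *)
have <- : (kill (fun i => i < b.+1)%N (spec k j f))@_(mnm_of (b :: rb)) = (spec k j f)@_(mnm_of (b :: rb)).
  rewrite mcoeff_kill ifT //; apply/forallP => i; apply/implyP.
  by rewrite mnm_of_neq0 in_cons ltnS => /orP[/eqP->//|]; apply: (allP ab).
by rewrite kill_spec //; [apply: core|]; lia.
Qed.

Theorem mcoeff_wcount rb x f : Rp x f -> sorted geq rb -> all (fun b => b < N)%N rb ->
  f@_(mnm_of rb) = (wcount rb N' N' x)%:R.
Proof. by move=> r hs ha; rewrite -[in LHS](spec_id f); apply: mcoeff_spec; rewrite ?leqnn. Qed.

End WordCount.

Local Close Scope ring_scope.

(** * Words of sign words as fillings of tableaux *)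

Section Tableaux.

Variable N' : nat.
Local Notation N := N'.+1.
Local Notation supp := (@supp N').
Local Notation tail := (@minus_after N').

Implicit Type b : nat -> bool.

Definition pos b := [seq k <- iota 0 N | b k].

Local Notation ps b r := (nth 0 (pos b) r).

Lemma pos_sorted b : sorted ltn (pos b).
Proof. by apply: sorted_filter (iota_ltn_sorted 0 N); apply: ltn_trans. Qed.

Lemma mem_pos b k : (k \in pos b) = (k < N) && b k.
Proof. by rewrite mem_filter mem_iota andbC. Qed.

Lemma ps_mem b r : r < size (pos b) -> b (ps b r) /\ ps b r < N.
Proof. by move=> /(mem_nth 0); rewrite mem_pos => /andP[]. Qed.

Lemma ps_lt b r r' : r < r' -> r' < size (pos b) -> ps b r < ps b r'.
Proof. by move=> h h'; apply: (sorted_ltn_nth ltn_trans 0 (pos_sorted b)) => //; rewrite inE //; lia. Qed.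

Lemma ps_index b i : i < N -> b i -> index i (pos b) < size (pos b) /\ ps b (index i (pos b)) = i.
Proof. by move=> h1 h2; rewrite index_mem mem_pos h1 h2 nth_index // mem_pos h1 h2. Qed.

Lemma pos_split b i : i.+1 < N ->
  pos b = [seq k <- iota 0 i | b k] ++ [seq k <- [:: i; i.+1] | b k] ++ [seq k <- iota i.+2 (N - i.+2) | b k].
Proof.
move=> hi; rewrite /pos -!filter_cat; congr filter.
rewrite [in LHS](_ : N = i + (2 + (N - i.+2))); last lia.
by rewrite iotaD add0n iotaD /= addn2.
Qed.

Lemma pos_swap b i r : i.+1 < N -> b i -> ~~ b i.+1 ->
  size (pos (swap i b)) = size (pos b) /\
  (r < size (pos b) -> ps (swap i b) r = if r == index i (pos b) then i.+1 else ps b r).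
Proof.
move=> hi h1 /negbTE h2; rewrite !(pos_split _ hi) /= /swap swL swR h1 h2 /=.
have e1 : [seq k <- iota 0 i | b (sw i k)] = [seq k <- iota 0 i | b k].
  by apply: eq_in_filter => k; rewrite mem_iota => hk; rewrite swD //; lia.
have e2 : [seq k <- iota i.+2 (N - i.+2) | b (sw i k)] = [seq k <- iota i.+2 (N - i.+2) | b k].
  by apply: eq_in_filter => k; rewrite mem_iota => hk; rewrite swD //; lia.
rewrite e1 e2; set X := filter _ _; set Y := filter _ _.
split; first by rewrite !size_cat.
have -> : index i (X ++ i :: Y) = size X.
  by rewrite index_cat ifF /= ?eqxx ?addn0 // mem_filter mem_iota; lia.
move=> _; rewrite !nth_cat; case: ltngtP => // [h|->]; last by rewrite subnn.
by have -> : r - size X = (r - size X).-1.+1 by lia.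
Qed.

Lemma tail_le b k k' : k <= k' -> tail b k' <= tail b k.
Proof.
move=> h; rewrite /minus_after; case: (ltnP k' N) => h'; last by rewrite big_geq //; lia.
by rewrite [leqRHS](@big_cat_nat _ _ _ k'.+1) //= leq_addl.
Qed.

(* Row r has as many boxes as there are minus signs behind the r-th plus sign. *)
Definition tabl b (T : seq (seq nat)) : Prop :=
  [/\ size T = size (pos b),
      forall r, r < size T -> size (nth [::] T r) = tail b (ps b r),
      forall r, sorted leq (nth [::] T r)
    & forall r c, c < size (nth [::] T r.+1) ->
        nth 0 (nth [::] T r) c < nth 0 (nth [::] T r.+1) c].

Definition cont (rb : seq nat) (T : seq (seq nat)) := perm_eq (flatten T) (map S rb).

(** This is the tableau form of the lower bound [j] in [wcount]: if the entry k+1 is to be removed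
    again, its row must belong to a plus sign at [j] or later. *)
Definition late k j b (T : seq (seq nat)) : Prop :=
  forall r, r < size T -> last 0 (nth [::] T r) = k.+1 -> j <= ps b r.

Definition addbox (r x : nat) (T : seq (seq nat)) := set_nth [::] T r (rcons (nth [::] T r) x).

Lemma nth_addbox r x T r' :
  nth [::] (addbox r x T) r' = if r' == r then rcons (nth [::] T r) x else nth [::] T r'.
Proof. by rewrite /addbox nth_set_nth. Qed.

Lemma size_addbox r x T : r < size T -> size (addbox r x T) = size T.
Proof. by move=> h; rewrite /addbox size_set_nth; apply/maxn_idPr. Qed.

Lemma perm_addbox r x T : r < size T -> perm_eq (flatten (addbox r x T)) (x :: flatten T).
Proof.
elim: T r => // row T IH [|r] h; apply/seq.permP => a; rewrite /addbox /=.
  by rewrite -cats1 !count_cat /=; lia.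
have /seq.permP/(_ a) := IH r h; rewrite /addbox /= !count_cat => ->; lia.
Qed.

Lemma sorted_rcons_leq s x : sorted leq s -> all (fun y => y <= x) s -> sorted leq (rcons s x).
Proof.
case: s => //= y s hs /andP[h1 h2]; rewrite rcons_path hs /=.
by apply: (allP (a := fun y => y <= x) (s := y :: s)); [rewrite /= h1|apply: mem_last].
Qed.

Lemma last_max s x : sorted leq s -> all (fun y => y <= x) s -> x \in s -> last 0 s = x.
Proof.
move=> hs ha hx; apply/eqP; rewrite eqn_leq.
have hl : last 0 s \in s by case: s hx {hs ha} => // y s _; apply: mem_last.
rewrite (allP ha) //=.
have hi : index x s < size s by rewrite index_mem.
have := sorted_leq_nth leq_trans leqnn 0 hs (index x s) (size s).-1.
rewrite !inE nth_index // nth_last; apply=> //; lia.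
Qed.

Lemma nth_flatten_mem (T : seq (seq nat)) r y : y \in nth [::] T r -> y \in flatten T.
Proof.
move=> h; apply/flattenP; exists (nth [::] T r) => //; apply: mem_nth.
by rewrite ltnNge; apply/negP => h'; move: h; rewrite nth_default.
Qed.

Lemma cont_le rb x T r : cont rb T -> all (fun y => y <= x) rb ->
  all (fun y => y <= x.+1) (nth [::] T r).
Proof.
move=> hc ha; apply/allP => y /nth_flatten_mem; rewrite (perm_mem hc) => /mapP[y' hy' ->].
by rewrite ltnS; apply: (allP ha).
Qed.

Section Step.

Variables (b : nat -> bool) (i : nat).
Hypotheses (hi : i.+1 < N) (bi : b i) (bi1 : ~~ b i.+1).
Local Notation b' := (swap i b).
Let r := index i (pos b).

Lemma r_lt : r < size (pos b).
Proof. by have [] := @ps_index b i (ltnW hi) bi. Qed.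

Lemma ps_r : ps b r = i.
Proof. by have [] := @ps_index b i (ltnW hi) bi. Qed.

Lemma ps_swap_r : ps b' r = i.+1.
Proof. by have [_ ->] := pos_swap r hi bi bi1; rewrite ?eqxx ?r_lt. Qed.

Lemma ps_swap_other r' : r' < size (pos b) -> r' != r -> ps b' r' = ps b r'.
Proof. by move=> h /negbTE ne; have [_ ->] := pos_swap r' hi bi bi1; rewrite // ne. Qed.

Lemma tail_r : tail b i = (tail b' i.+1).+1.
Proof. by rewrite tail_swap_gt // (tail_rec b hi) bi1. Qed.

Lemma tail_other r' : r' < size (pos b) -> r' != r -> tail b' (ps b' r') = tail b (ps b r').
Proof.
move=> h ne; rewrite ps_swap_other //; case: (ltngtP (ps b r') i) => h'.
- by rewrite tail_swap_lt.
- by rewrite tail_swap_gt.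
- have [] : r' < r \/ r < r' by lia.
    by move=> /ps_lt/(_ r_lt); rewrite ps_r h' ltnn.
  by move=> /ps_lt/(_ h); rewrite ps_r h' ltnn.
Qed.

(** Column strictness could fail only at the box above the new one. An equal entry there would end
    its row, whose plus sign lies before [i], against [late]. The second conclusion, that [r] is the
    topmost row ending in x+1, makes the step reversible. *)
Lemma tabl_add x rb T : all (fun y => y <= x) rb -> tabl b' T -> cont rb T -> late x i.+1 b' T ->
  tabl b (addbox r x.+1 T) /\ (forall r', r' < size T -> last 0 (nth [::] (addbox r x.+1 T) r') = x.+1 ->
     r <= r').
Proof.
move=> hx [t1 t2 t3 t4] hc hl.
have sz : size (pos b') = size (pos b) by have [] := pos_swap 0 hi bi bi1.
have hr : r < size T by rewrite t1 sz r_lt.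
have le r' := cont_le r' hc hx.
split; last first.
  move=> r' hr'; rewrite nth_addbox; case: eqP => [->//|/eqP ne] /(hl _ hr').
  rewrite ps_swap_other -?sz -?t1 // => h; rewrite leqNgt; apply/negP => /ps_lt/(_ r_lt).
  by rewrite ps_r; lia.
have sR' r' : r' < size T -> r' != r -> size (nth [::] T r') = tail b (ps b r').
  by move=> h ne; rewrite t2 // tail_other // -sz -t1.
split.
- by rewrite size_addbox // t1.
- move=> r'; rewrite size_addbox // nth_addbox => h; case: eqP => [->|/eqP ne].
    by rewrite size_rcons t2 // ps_swap_r ps_r tail_r.
  exact: sR'.
- by move=> r'; rewrite nth_addbox; case: eqP => // _; apply: sorted_rcons_leq.
move=> r' c; rewrite !nth_addbox.
case: (r'.+1 =P r) => [e|ne1]; last first.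
  case: (r' =P r) => [e|ne2]; last exact: t4.
  move=> hc'; have hc2 := t4 r' c hc'; rewrite nth_rcons e in hc2 *.
  rewrite ifT //; apply: leq_trans (_ : size (nth [::] T r.+1) <= _); first by rewrite -e.
  have h : r.+1 < size T.
    by rewrite ltnNge; apply/negP => h; move: hc'; rewrite e nth_default.
  rewrite sR' ?t2 //; last lia.
  rewrite ps_swap_r -(@tail_swap_gt N' b i) //; last first.
    by have := @ps_lt b r r.+1 (ltnSn _); rewrite ps_r; apply; rewrite -sz -t1.
  by apply: tail_le; have := @ps_lt b r r.+1 (ltnSn _); rewrite ps_r; apply; rewrite -sz -t1.
rewrite ifF; last lia.
rewrite size_rcons nth_rcons -e => hc'.
case: (ltngtP c (size (nth [::] T r'.+1))) => [h|h|h]; [exact: t4|lia|].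
have hr' : r' < size T by lia.
have hp : ps b r' < i by rewrite -ps_r; apply: ps_lt; rewrite ?r_lt -?e.
have sz1 : c < size (nth [::] T r').
  rewrite sR' //; last lia.
  rewrite h t2 ?e // ps_swap_r; apply: leq_trans (tail_le _ (ltnW hp)).
  by rewrite tail_r.
have mem := mem_nth 0 sz1.
rewrite ltn_neqAle (allP (le r')) // andbT; apply/eqP => eqx.
have lst : last 0 (nth [::] T r') = x.+1 by apply: last_max (t3 r') (le r') _; rewrite -eqx.
by have := hl r' hr' lst; rewrite ps_swap_other -?sz -?t1 //; lia.
Qed.

End Step.

(** The box is taken from the topmost row ending in the largest entry. All other rows with that last
    entry are then further down, which gives [late] for the remaining tableau. *)
Lemma tabl_remove b x rb T : all (fun y => y <= x) rb -> tabl b T -> cont (x :: rb) T ->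
  exists i T', [/\ [/\ i.+1 < N, b i & ~~ b i.+1],
    T = addbox (index i (pos b)) x.+1 T',
    [/\ tabl (swap i b) T', cont rb T' & late x i.+1 (swap i b) T'] &
    exists r, [/\ r < size T, last 0 (nth [::] T r) = x.+1 & ps b r = i]].
Proof.
move=> hx [t1 t2 t3 t4] hc.
have hx' : all (fun y => y <= x) (x :: rb) by rewrite /= leqnn.
have le r' := cont_le r' hc hx'.
have hex : has (fun row => last 0 row == x.+1) T.
  have : x.+1 \in flatten T by rewrite (perm_mem hc) /= in_cons eqxx.
  case/flattenP => row hrow hxr; apply/hasP; exists row => //; apply/eqP.
  have hr : index row T < size T by rewrite index_mem.
  have er : nth [::] T (index row T) = row by rewrite nth_index.
  by apply: last_max => //; rewrite -er.
pose r := find (fun row => last 0 row == x.+1) T; pose i := ps b r.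
have hr : r < size T by rewrite -has_find.
have lr : last 0 (nth [::] T r) = x.+1 by apply/eqP/(nth_find [::] hex).
have minr r' : r' < r -> last 0 (nth [::] T r') <> x.+1.
  by move=> /(before_find [::])/eqP.
have hrp : r < size (pos b) by rewrite -t1.
have [bi iN] := ps_mem hrp.
have [row' erow] : exists row', nth [::] T r = rcons row' x.+1.
  case: (lastP (nth [::] T r)) lr => [//|s y]; rewrite last_rcons => ->; by exists s.
have szr : tail b i = (size row').+1 by rewrite -t2 // erow size_rcons.
have hi : i.+1 < N.
  rewrite ltn_neqAle iN andbT; apply/eqP => e; move: szr.
  by rewrite /minus_after big_geq // e.
have ir : index i (pos b) = r.
  apply/eqP; have := pos_sorted b; rewrite ltn_sorted_uniq_leq => /andP[u _].
  by rewrite index_uniq.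
(* With a plus sign at [i.+1], row [r.+1] would be as long as row [r], and strictness would force an
   entry larger than the maximum below the box x+1. *)
have bi1 : ~~ b i.+1.
  apply/negP => h; have [h1 h2] := @ps_index b i.+1 hi h.
  have hlt : r < index i.+1 (pos b).
    by rewrite ltnNge leq_eqVlt; apply/negP => /orP[/eqP e|/ps_lt/(_ hrp)];
      [move: h2; rewrite e -/i|rewrite h2 -/i]; lia.
  have en : index i.+1 (pos b) = r.+1.
    apply/eqP; rewrite eqn_leq hlt andbT leqNgt; apply/negP => hgt.
    have := ps_lt hlt h1; have := ps_lt hgt h1; have := @ps_lt b r r.+1 (ltnSn r) _.
    by rewrite h2 -/i => /(_ (ltn_trans hgt h1)); lia.
  rewrite en -t1 in h1; rewrite en in h2.
  have sz1 : size (nth [::] T r.+1) = (size row').+1.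
    by rewrite t2 // h2 -szr (tail_rec b hi) h.
  have := t4 r (size row'); rewrite sz1 => /(_ (ltnSn _)).
  rewrite erow nth_rcons ltnn eqxx => hh.
  have hs : size row' < size (nth [::] T r.+1) by rewrite sz1.
  by have := allP (le r.+1) _ (mem_nth 0 hs); rewrite leqNgt hh.
pose T' := set_nth [::] T r row'.
have sT' : size T' = size T by rewrite size_set_nth; apply/maxn_idPr.
have nT' r' : nth [::] T' r' = if r' == r then row' else nth [::] T r' by rewrite nth_set_nth.
have eT : T = addbox r x.+1 T'.
  apply: (@eq_from_nth _ [::]); first by rewrite size_addbox sT'.
  move=> r' _; rewrite nth_addbox !nT' eqxx; case: eqP => [->|//]; exact: erow.
have sz : size (pos (swap i b)) = size (pos b) by have [] := pos_swap 0 hi bi bi1.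
have pr : ps (swap i b) r = i.+1 by rewrite -ir ps_swap_r.
have sT r' : r' < size T -> size (nth [::] T' r') = tail (swap i b) (ps (swap i b) r').
  move=> h; rewrite nT'; case: eqP => [->|/eqP ne].
    by rewrite pr; apply: succn_inj; rewrite -szr (tail_r hi bi1).
  by rewrite t2 // (tail_other hi bi bi1) ?ir // -t1.
exists i, T'; split=> //; rewrite ?ir //; last by exists r.
split.
- split=> //.
  + by rewrite sT' sz.
  + by move=> r' h; apply: sT; rewrite -sT'.
  + move=> r'; rewrite nT'; case: eqP => // _.
    by have := t3 r; rewrite erow => /(subseq_sorted leq_trans); apply; apply: subseq_rcons.
  move=> r' c hc'.
  have h1 : r'.+1 < size T by rewrite ltnNge -sT'; apply/negP => h; rewrite nth_default in hc'.
  have hc2 : c < size (nth [::] T r'.+1).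
    move: hc'; rewrite nT'; case: eqP => [->|//]; rewrite erow size_rcons; lia.
  have hlt := t4 r' c hc2.
  have -> : nth 0 (nth [::] T' r'.+1) c = nth 0 (nth [::] T r'.+1) c.
    move: hc'; rewrite nT'; case: eqP => [->|//] hc'; rewrite erow nth_rcons hc'//.
  rewrite nT'; case: eqP => [e|//]; rewrite e erow nth_rcons in hlt.
  suff h : c < size row' by rewrite e; rewrite h in hlt.
  apply: leq_trans hc' _; have := sT r hr; rewrite nT' eqxx => ->.
  rewrite sT // e; apply: tail_le; rewrite pr.
  have hr1 : r.+1 < size (pos b) by rewrite -t1 -e.
  rewrite (ps_swap_other hi bi bi1) ?ir //; last lia.
  exact: ps_lt.
- have := perm_addbox x.+1 (_ : r < size T'); rewrite -eT sT' => /(_ hr) p.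
  by rewrite /cont -(perm_cons x.+1); apply: perm_trans hc; rewrite perm_sym.
move=> r' hr'; rewrite nT'; case: eqP => [-> _|/eqP ne hl]; first by rewrite pr.
have h : r < r'.
  rewrite ltn_neqAle eq_sym ne leqNgt; apply/negP => /minr; rewrite hl; exact.
rewrite (ps_swap_other hi bi bi1) ?ir // -?t1 -?sT' //.
by apply: ps_lt; rewrite // -t1 -sT'.
Qed.

Definition word_up i b := if [&& i.+1 < N, b i & ~~ b i.+1] then Some (swap i b) else None.

Definition word_top b := [forall i : 'I_N, (i.+1 < N) ==> ~~ (b i && ~~ b i.+1)].

Fixpoint tabs (rb : seq nat) (k j : nat) b : seq (seq (seq nat)) :=
  if rb is x :: rb' then
    let lo := if x == k then j else x in
    [seq addbox (index i (pos b)) x.+1 T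
      | i <- index_iota lo N', T <- if word_up i b is Some b' then tabs rb' x i.+1 b' else [::]]
  else if word_top b then [:: nseq (size (pos b)) [::]] else [::].

Lemma size_tabs rb k j b : size (tabs rb k j b) = wcount N' word_up word_top rb k j b.
Proof.
elim: rb k j b => [|x rb IH] k j b /=; first by case: word_top.
rewrite size_allpairs_dep sumnE big_map; apply: eq_bigr => i _.
by case: word_up => // b'; apply: IH.
Qed.

Lemma tabl_nil b T : tabl b T -> flatten T = [::] -> word_top b /\ T = nseq (size (pos b)) [::].
Proof.
move=> [t1 t2 t3 t4] fT.
have nT r : nth [::] T r = [::].
  case e: (nth [::] T r) => [//|y s]; have := @nth_flatten_mem T r y.
  by rewrite e fT in_cons eqxx => /(_ isT).
split; last first.
  by apply: (@eq_from_nth _ [::]); rewrite ?size_nseq // => r h; rewrite nT nth_nseq if_same.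
apply/forallP => -[i hi0]; apply/implyP => /= hi; apply/negP => /andP[bi bi1].
have [h1 h2] := @ps_index b i hi0 bi.
by have := t2 (index i (pos b)); rewrite t1 h2 nT tail_r // => /(_ h1).
Qed.

Lemma tail_top b k : word_top b -> b k -> tail b k = 0.
Proof.
move=> /forallP ht; have [n] := ubnP (N - k); elim: n k => // n IH k hn bk.
case: (ltnP k.+1 N) => hk; last by rewrite /minus_after big_geq.
have hk0 : k < N by lia.
have := ht (Ordinal hk0); rewrite hk /= bk /= negbK => bk1.
by rewrite tail_rec // bk1 IH //; lia.
Qed.

Lemma tabl_top b : word_top b -> tabl b (nseq (size (pos b)) [::]).
Proof.
move=> ht; have nT r : nth [::] (nseq (size (pos b)) ([::] : seq nat)) r = [::].
  by rewrite nth_nseq if_same.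
split=> [|r|r|r c]; rewrite ?size_nseq ?nT // => h.
by rewrite tail_top //; have [] := ps_mem h.
Qed.

(** If every plus sign stands at or behind all indices in [rb], the requirement that a letter be at
    least its entry is automatic, so no flag condition on the tableaux appears. Moving plus signs to
    the right preserves this. *)
Lemma mem_tabs rb k j b T : all (fun y => y <= k) rb -> sorted geq rb ->
  (forall i x, b i -> x \in rb -> x <= i) ->
  T \in tabs rb k j b <-> [/\ tabl b T, cont rb T & late k j b T].
Proof.
elim: rb k j b T => [|x rb IH] k j b T.
  move=> _ _ _ /=; split.
    case: ifP => // ht; rewrite inE => /eqP->; split; first exact: tabl_top.
      by rewrite /cont; elim: (size _).
    by move=> r _; rewrite nth_nseq if_same.
  case=> hT hc _; have [ht ->] := tabl_nil hT (perm_nilP hc).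
  by rewrite ht mem_seq1.
move=> ha hs hf; have hs' := path_sorted hs.
have /= /andP[xk ak] := ha.
have ax : all (fun y => y <= x) rb by apply: order_path_min hs; apply: (rev_trans leq_trans).
have hf' i : i.+1 < N -> b i -> ~~ b i.+1 -> forall i' y, swap i b i' -> y \in rb -> y <= i'.
  move=> hi bi bi1 i' y; rewrite /swap; case: swP => [->|->|_ _] h hy.
  - by rewrite h in bi1.
  - by apply: leqW; apply: hf h _; rewrite in_cons hy orbT.
  - by apply: hf h _; rewrite in_cons hy orbT.
split=> [/allpairsPdep [i [T' [hi hT' ->]]]|[hT hc hl]].
  move: hT'; rewrite /word_up; case: ifP => // /and3P[hi1 bi bi1] /(IH _ _ _ _ ax hs') [|t c l].
    exact: hf'.
  have [t' l'] := tabl_add hi1 bi bi1 ax t c l.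
  have sT' : index i (pos b) < size T'.
    by case: t => -> _ _ _; have [-> _] := pos_swap 0 hi1 bi bi1; apply: r_lt.
  have hcT : cont (x :: rb) (addbox (index i (pos b)) x.+1 T').
    by rewrite /cont; apply: perm_trans (perm_addbox _ sT') _; rewrite perm_cons.
  have ax' : all (fun y => y <= x) (x :: rb) by rewrite /= leqnn.
  split=> // r; rewrite size_addbox // => hr hl.
  have hmem : k.+1 \in nth [::] (addbox (index i (pos b)) x.+1 T') r.
    by rewrite -hl; case: (nth _ _ r) hl => [//|y s] _; apply: mem_last.
  have xk' : x = k.
    by apply/eqP; rewrite eqn_leq xk; apply: (allP (cont_le r hcT ax') _ hmem).
  rewrite xk' eqxx mem_index_iota in hi.
  rewrite -xk' in hl; have := l' r hr hl.
  have rs : r < size (pos b) by case: t' => <- _ _ _; rewrite size_addbox.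
  case/andP: hi => ji _.
  by rewrite leq_eqVlt => /orP[/eqP <-|/ps_lt/(_ rs)]; rewrite ps_r // => /ltnW; apply: leq_trans.
have [i [T' [[hi bi bi1] eT [t c l] [r [hr lr er]]]]] := tabl_remove ax hT hc.
apply/allpairsPdep; exists i, T'; split=> //.
  have hi' : i < N' := hi.
  rewrite mem_index_iota hi' andbT.
  case: eqP => [e|_]; last by apply: hf bi _; rewrite in_cons eqxx.
  by rewrite -er; apply: hl; rewrite // lr e.
by rewrite /word_up hi bi bi1 /=; apply/IH => //; apply: hf'.
Qed.

Lemma addbox_inj r x T T' : r < size T -> size T = size T' ->
  addbox r x T = addbox r x T' -> T = T'.
Proof.
move=> hr hs e; apply: (@eq_from_nth _ [::]) => // r' _.
have := congr1 (fun U => nth [::] U r') e; rewrite !nth_addbox.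
by case: eqP => [->|//]; move=> /rcons_inj[].
Qed.

(** The letter can be read off the finished tableau: the box added last lies in the topmost row that
    ends in the largest entry. *)
Lemma uniq_tabs rb k j b : all (fun y => y <= k) rb -> sorted geq rb ->
  (forall i x, b i -> x \in rb -> x <= i) -> uniq (tabs rb k j b).
Proof.
elim: rb k j b => [|x rb IH] k j b; first by move=> _ _ _ /=; case: word_top.
move=> ha hs hf; have hs' := path_sorted hs.
have ax : all (fun y => y <= x) rb by apply: order_path_min hs; apply: (rev_trans leq_trans).
have hf' i : i.+1 < N -> b i -> ~~ b i.+1 -> forall i' y, swap i b i' -> y \in rb -> y <= i'.
  move=> hi bi bi1 i' y; rewrite /swap; case: swP => [->|->|_ _] h hy.
  - by rewrite h in bi1.
  - by apply: leqW; apply: hf h _; rewrite in_cons hy orbT.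
  - by apply: hf h _; rewrite in_cons hy orbT.
apply: allpairs_uniq_dep; first exact: iota_uniq.
  move=> i _; rewrite /word_up; case: ifP => // /and3P[h1 h2 h3]; apply: IH => //; exact: hf'.
have key p : p \in [seq @Tagged nat i (fun _ => seq (seq nat)) T | i <- index_iota (if x == k then j else x) N', T <- if word_up i b is Some b' then tabs rb x i.+1 b' else [::]] ->
    [/\ (tag p).+1 < N, b (tag p), ~~ b (tag p).+1 &
      [/\ tabl (swap (tag p) b) (tagged p), cont rb (tagged p) & late x (tag p).+1 (swap (tag p) b) (tagged p)]].
  case/allpairsPdep => i [T [_ hT ->]] /=.
  move: hT; rewrite /word_up; case: ifP => // /and3P[h1 h2 h3] /(mem_tabs _ _ ax hs') [|t c l]; first exact: hf'.
  by split=> //; split.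
move=> [i T] [i' T'] /key /= [h1 h2 h3 [t c l]] /key /= [h1' h2' h3' [t' c' l']] e.
have s1 : size T = size (pos b) by case: t => -> _ _ _; have [] := pos_swap 0 h1 h2 h3.
have s2 : size T' = size (pos b) by case: t' => -> _ _ _; have [] := pos_swap 0 h1' h2' h3'.
have r1 : index i (pos b) < size T by rewrite s1 r_lt.
have r2 : index i' (pos b) < size T by rewrite s1 r_lt.
have [_ m1] := tabl_add h1 h2 h3 ax t c l.
have [_ m2] := tabl_add h1' h2' h3' ax t' c' l'.
have ei : index i (pos b) = index i' (pos b).
  apply/eqP; rewrite eqn_leq m1 ?m2 //; try by rewrite s2 -s1.
    by rewrite -e nth_addbox eqxx last_rcons.
  by rewrite e nth_addbox eqxx last_rcons.
have ii : i = i' by rewrite -(ps_r h1 h2) ei ps_r.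
subst i'; congr (Tagged _ _); apply: addbox_inj e => //; by rewrite s1 s2.
Qed.

End Tableaux.

Local Open Scope ring_scope.

(** * Constant terms from homogeneity *)

Section ConstantTerm.

Variable N' : nat.
Local Notation N := N'.+1.
Local Notation P := {mpoly int[N]}.
Local Notation D := (@ddiff N').

Variables (S : Type) (up : nat -> S -> option S) (istop : S -> bool) (Rp : S -> P -> Prop).
Variable ht : S -> nat.
Hypothesis Rp_up : forall x f i y, Rp x f -> up i x = Some y -> Rp y (D i f).
Hypothesis Rp_top : forall x f, Rp x f -> istop x -> f = 1.
Hypothesis Rp_progress : forall x f, Rp x f -> ~~ istop x ->
  exists i y, [/\ (i.+1 < N)%N, up i x = Some y & (ht y < ht x)%N].
Hypothesis Rp_ghom : forall x f, Rp x f -> exists a c, ghom a c f.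

(** Along a path to the top each divided difference lowers the degree by one, and the path ends at
    the polynomial 1. So the degree is the length of the path, which is positive away from the
    top. *)
Lemma ghom_top x f a c : Rp x f -> ghom a c f -> if istop x then a = c else (a < c)%N.
Proof.
have [n] := ubnP (ht x); elim: n x f a => // n IH x f a hn r h.
case: ifP => [t|/negbT t].
  by move: h; rewrite (Rp_top r t); apply: ghom_one.
have [i [y [hi e hy]]] := Rp_progress r t.
have := IH y _ _ (leq_trans hy (ltnSE hn)) (Rp_up r e) (ghom_ddiff hi h).
by case: ifP => _; lia.
Qed.

Lemma cst_istop x f : Rp x f -> cst N' f = (istop x)%:R.
Proof.
move=> r; have [a [c h]] := Rp_ghom r; have := ghom_top r h.
case: ifP => [t _|_ h']; first by rewrite (Rp_top r t) rmorph1.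
by apply: cst_ghom h _; lia.
Qed.

End ConstantTerm.

(** * Coefficients for sign words, then for clans *)

Section SignCoefficients.

Variable N' : nat.
Local Notation N := N'.+1.
Local Notation upA := (@word_up N').
Local Notation topA := (@word_top N').

Lemma topA_N b : ~~ topA b -> exists i, [/\ (i.+1 < N)%N, b i & ~~ b i.+1].
Proof.
rewrite negb_forall => /existsP[i]; rewrite negb_imply negbK => /andP[h /andP[h1 h2]].
by exists i.
Qed.

Lemma topA_A b : supp N' b -> topA b -> A N' b = 1.
Proof.
move=> sb /forallP ht.
have ex : exists k, b k || (N <= k)%N by exists N; rewrite leqnn orbT.
case: (ex_minnP ex) => q hq min.
have qN : (q <= N)%N by apply: min; rewrite leqnn orbT.
rewrite -(A_top qN); congr A; apply: funext => k.
case: (leqP q k) => [qk|kq] /=; last first.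
  by apply/negP => h; have := min k; rewrite h => /(_ isT); lia.
case: (ltnP k N) => kN; last by apply/negP => /sb; lia.
elim: k qk kN => [|k IH] qk kN.
  by have -> : 0%N = q by [lia|]; move: hq; rewrite leqNgt (_ : q < N)%N ?orbF //; lia.
case: (ltngtP q k.+1) => [h|h|h]; [|lia|].
  have kN' : (k < N)%N by lia.
  have qk' : (q <= k)%N by lia.
  by have := ht (Ordinal kN'); rewrite /= kN (IH qk' kN') /= negbK.
by move: hq; rewrite leqNgt h kN orbF.
Qed.

Theorem mcoeff_A b rb : supp N' b -> sorted geq rb -> all (fun x => x < N)%N rb ->
  (A N' b)@_(mnm_of N' rb) = (wcount N' upA topA rb N' N' b)%:R.
Proof.
move=> sb; pose Rp b f := supp N' b /\ f = A N' b.
have mu_le c : (mu N' c <= N * N)%N.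
  by rewrite /mu /ninv -[X in (_ <= X * X)%N](card_ord N) -card_prod max_card.
have Rp_up x f i y : Rp x f -> upA i x = Some y -> Rp y (ddiff i f).
  rewrite /word_up => -[sx ->]; case: ifP => // /and3P[h1 h2 h3] [<-].
  by split; [exact: supp_swap|exact: A_up].
apply: (@mcoeff_wcount N' _ upA topA Rp) => //.
- move=> x f i [sx ->] hi; rewrite /word_up hi /=; case: ifP => // h _.
  by apply: A_flat; rewrite // /flat h.
- move=> x f [sx ->]; have := A_degle sx (ltnSn N'); rewrite /minus_after big_geq //.
- move=> x f; apply: (@cst_istop N' _ upA topA Rp (fun c => N * N - mu N' c)%N) => //.
  + by move=> {}x {}f [sx ->]; apply: topA_A.
  + move=> {}x {}f [sx _] /topA_N[i [h1 h2 h3]]; exists i, (swap i x); split=> //.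
      by rewrite /word_up h1 h2 h3.
    have := mu_le (swap i x); rewrite mu_swap //; lia.
  + by move=> {}x {}f [sx ->]; apply: A_ghom.
Qed.

End SignCoefficients.

Section ClanCoefficients.

Variables (N' p q : nat).
Local Notation N := N'.+1.
Local Notation P := {mpoly int[N]}.
Local Notation up := (clan_up N).
Local Notation nest := (nest N').
Definition nsign (e : bool) (t : st) := (\sum_(k < N) ((io t k == k) && (sg t k == e)))%N.

(* #(+) - #(-) = p - q *)
Definition balanced (t : st) := (nsign true t + q == nsign false t + p)%N.

Lemma nsign_cconj e i t : (i.+1 < N)%N -> nsign e (cconj i t) = nsign e t.
Proof.
move=> hi; have swp (k : 'I_N) : (sw i k < N)%N by rewrite sw_lt.
pose f (k : 'I_N) : 'I_N := Ordinal (swp k).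
have fK : involutive f by move=> k; apply: val_inj; rewrite /= swK.
rewrite /nsign [RHS](reindex_inj (inv_inj fK)); apply: eq_bigr => k _ /=.
by rewrite -{2}(swK i k) (inj_eq (@sw_inj i)).
Qed.

Lemma nsign_mat e i t : (i.+1 < N)%N -> io t i = i -> io t i.+1 = i.+1 ->
  sg t i <> sg t i.+1 -> nsign e t = (nsign e (mat i t)).+1.
Proof.
move=> hi e1 e2 e3; have hi0 : (i < N)%N by lia.
have split2 (F : 'I_N -> nat) : (\sum_(k < N) F k = F (Ordinal hi0) + (F (Ordinal hi) +
    \sum_(k < N | (k != Ordinal hi0) && (k != Ordinal hi)) F k))%N.
  rewrite (bigD1 (Ordinal hi0)) //= (bigD1 (Ordinal hi)) //=.
  by rewrite -val_eqE /=; lia.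
rewrite /nsign !split2 /= !swL !swR e1 e2 !eqxx /=.
rewrite (_ : (i.+1 == i) = false) /=; last lia.
rewrite (_ : (i == i.+1) = false) /=; last lia.
rewrite addnA !add0n (_ : ((sg t i == e) + (sg t i.+1 == e))%N = 1%N); last first.
  by case: (sg t i) (sg t i.+1) e e3 => [] [] [].
rewrite add1n; congr _.+1; apply: eq_bigr => k /andP[].
rewrite -!val_eqE /= => k1 k2.
by rewrite swD // k1 k2 !andbT.
Qed.

Lemma balanced_up i t t' : balanced t -> up i t = Some t' -> balanced t'.
Proof.
move=> h; rewrite /clan_up; case: ifP => // hi.
case: ifP => [/andP[/eqP e1 /eqP e2]|_].
  case: eqP => // ne [<-]; move: h; rewrite /balanced.
  by rewrite !(nsign_mat _ hi e1 e2 ne) !addSn eqSS.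
by case: ifP => // _ [<-]; rewrite /balanced !nsign_cconj.
Qed.

Lemma nest_const m e : (m.*2 <= N)%N ->
  nsign e (nest m (fun=> e)) = (N - m.*2)%N /\ nsign (~~ e) (nest m (fun=> e)) = 0%N.
Proof.
move=> hm; split.
  rewrite /nsign -(big_mkord xpredT (fun k => (io (nest m (fun=> e)) k == k) && (sg (nest m (fun=> e)) k == e) : nat)).
  rewrite (@big_cat_nat _ _ _ m) //=; last lia.
  rewrite (@big_cat_nat _ _ _ (N - m) m) //=; try lia.
  have z1 a c : (forall k, (a <= k < c)%N -> ((k < m) || (N - m <= k < N))%N) ->
    (\sum_(a <= k < c) nat_of_bool (((if (k < N) && ((k < m) || (N - m <= k)) then N' - k else k) == k) && ((m <= k < N - m) && e == e)))%N = 0%N.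
    move=> h; rewrite big_nat big1 // => k hk; have := h k hk.
    by case: eqP => //; case: ifP; lia.
  rewrite (z1 0%N m); last by move=> k; lia.
  rewrite (z1 (N - m)%N N); last by move=> k; lia.
  rewrite add0n addn0 big_nat (eq_bigr (fun=> 1%N)) => [|k hk]; last first.
    by rewrite hk ifF ?eqxx //; lia.
  by rewrite -big_nat sum_nat_const_nat muln1; lia.
rewrite /nsign big1 // => k _ /=; case: eqP => //=; case: ifP => h; first by lia.
by move=> _; rewrite (_ : (m <= k < N - m)%N = true); [case: (e)|have := ltn_ord k; lia].
Qed.

(** Work inwards: once l outer arcs are found, the window from l to N - l is stable. If l is matched
    to c inside it, c must be its last position, or else there is an upward step at c. If l is
    fixed, the absence of upward steps forces each following position of the window to be fixed with
    the same sign. *)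
Lemma no_up_nest t : valid N t -> (forall i, up i t = None) ->
  exists m e, (m.*2 <= N)%N /\ t = nest m (fun=> e).
Proof.
move=> v hu; have [h1 h2 h3] := v.
have fin l e : (l.*2 <= N)%N -> (forall k, k < l -> io t k = N' - k)%N ->
    (forall k, l <= k < N - l -> io t k = k /\ sg t k = e)%N -> t = nest l (fun=> e).
  move=> hl ho hi.
  have io_hi k : (N - l <= k < N)%N -> io t k = (N' - k)%N.
    move=> hk; apply: (validI v); rewrite ho; lia.
  apply: st_eq => k /=.
    case: ifP => h; first by case: (ltnP k l) => h'; [apply: ho|apply: io_hi; lia].
    by case: (ltnP k N) => hk; [apply: (hi _ _).1; lia|apply: h2].
  case: (boolP (l <= k < N - l)%N) => h; first by have [_ ->] := hi k h.
  case: (ltnP k N) => hk; last first.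
    by apply/negP => /h3 [_]; lia.
  apply: (valid_sg v); case: (ltnP k l) => hkl; first by rewrite ho //; lia.
  by rewrite io_hi; lia.
have step l : (l.*2 <= N)%N -> (forall k, k < l -> io t k = N' - k)%N ->
    (exists m e, (m.*2 <= N)%N /\ t = nest m (fun=> e)) \/ ((l.+1.*2 <= N)%N /\ io t l = N' - l)%N.
  move=> hl ho.
  have win k : (l <= k < N - l)%N -> (l <= io t k < N - l)%N.
    move=> hk; have hkN : (k < N)%N by lia.
    have hiN := valid_lt v hkN.
    rewrite leqNgt; apply/andP; split; first by apply/negP => h; have := ho _ h; rewrite h1; lia.
    rewrite ltnNge; apply/negP => h.
    have e := ho (N' - io t k)%N; have := h1 (N' - io t k)%N; rewrite e; last lia.
    by rewrite (_ : N' - (N' - io t k) = io t k)%N ?h1; lia.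
  case: (ltnP l.*2 N) => hl2; last first.
    by left; exists l, true; split=> //; apply: fin => // k; lia.
  have hwl : (l <= l < N - l)%N by lia.
  case: (io t l =P l) => [el|nl].
    left; exists l, (sg t l); split=> //; apply: fin => // k.
    elim/ltn_ind: k => k IH hk.
    case: (l =P k) => [<- //|ne]; case: k IH hk ne => [|k] IH hk ne; first by exfalso; lia.
    have [ek es] : io t k = k /\ sg t k = sg t l by apply: IH; lia.
    have fixed m : (l <= m <= k)%N -> io t m = m by move=> hm; apply: (IH m _ _).1; lia.
    have hkN : (k.+1 < N)%N by lia.
    have wk := win k.+1 hk.
    have := hu k; rewrite /clan_up hkN ek eqxx /=.
    case: (k.+1 =P io t k.+1) => [e|ne'].
      rewrite -e eqxx; case: eqP => // e' _; rewrite -es; split=> //.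
    rewrite eq_sym; case: eqP => [e|_]; first by case: ne'.
    case: ltnP => // hle; exfalso.
    have hne : io t k.+1 <> k by move=> e; have := validI v e; rewrite ek; lia.
    have hkk : (l <= io t k.+1 < k)%N by lia.
    by have := fixed (io t k.+1); rewrite h1; lia.
  have wl := win l hwl; right.
  have cl : (l < io t l)%N by lia.
  split; first lia.
  case: (ltnP (io t l).+1 (N - l)) => hc; last lia.
  exfalso; have hcN : ((io t l).+1 < N)%N by lia.
  have wc : (l <= io t (io t l).+1 < N - l)%N by apply: win; lia.
  have ne : io t (io t l).+1 <> l by move=> e; have := validI v e; lia.
  have := hu (io t l); rewrite /clan_up hcN h1 ifF; last by apply/negP => /andP[/eqP e _]; lia.
  by rewrite ifT //; lia.
suff main l : (l.*2 <= N)%N -> (exists m e, (m.*2 <= N)%N /\ t = nest m (fun=> e)) \/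
    (forall k, k < l -> io t k = N' - k)%N.
  case: (main N./2) => //; first by lia.
  move=> ho; case: (step N./2) => //; first lia.
  by case; lia.
elim: l => [|l IH] hl; first by right.
case: IH => [|h|ho]; [lia|by left|].
case: (step l _ ho) => [|h|[_ e]]; [lia|by left|right].
by move=> k; rewrite ltnS leq_eqVlt => /orP[/eqP->|]; [exact: e|exact: ho].
Qed.

Hypothesis Npq : N = (p + q)%N.

Definition top_state := nest (minn p q) (fun=> (q < p)%N).

Lemma balanced_max t : valid N t -> balanced t -> (forall i, up i t = None) -> t = top_state.
Proof.
move=> v bt /(no_up_nest v)[m [e [hm et]]]; subst t.
have [s1 s2] := nest_const e hm; move: bt {v}; rewrite /balanced.
case: e s1 s2 => /= -> ->.
  move=> /eqP h; have -> : m = minn p q by lia.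
  by apply: st_eq => //= k; rewrite andbT; case: (ltnP q p) => h'; rewrite ?andbT ?andbF; lia.
move=> /eqP h; have -> : m = minn p q by lia.
by apply: st_eq => //= k; rewrite andbF; case: (ltnP q p) => h'; rewrite ?andbT ?andbF; lia.
Qed.

Lemma clan_rep_top (f : P) : clan_rep top_state f -> f = 1.
Proof. by move=> r; apply: clan_rep_uniq r _; apply: rep_top; lia. Qed.

Definition is_top_state (t : st) : bool := `[< t = top_state >].

Theorem mcoeff_clan t (f : P) rb : clan_rep t f -> balanced t -> sorted geq rb ->
  all (fun x => x < N)%N rb ->
  f@_(mnm_of N' rb) = (wcount N' up is_top_state rb N' N' t)%:R.
Proof.
move=> r bt; pose Rp t f := @clan_rep N' t f /\ balanced t.
have Rp_up x g i y : Rp x g -> up i x = Some y -> Rp y (ddiff i g).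
  by case=> r' b' e; split; [apply: clan_rep_up r' e|apply: balanced_up b' e].
have ninv_le c : (ninv N c <= N * N)%N.
  by rewrite /ninv -[X in (_ <= X * X)%N](card_ord N) -card_prod max_card.
apply: (@mcoeff_wcount N' _ up is_top_state Rp) => //.
- by move=> x g i [r' _]; apply: clan_rep_none r'.
- by move=> x g [r' _]; have := clan_rep_degle r' (ltnSn N'); rewrite subnn.
- move=> x g; apply: (@cst_istop N' _ up is_top_state Rp (fun c => N * N - ninv N (io c))%N) => //.
  + by move=> {}x {}g [r' _] /asboolP e; rewrite e in r'; apply: clan_rep_top r'.
  + move=> {}x {}g [r' b'] /asboolPn nt.
    have v := clan_rep_valid r'.
    case: (pselect (exists i y, up i x = Some y)) => [[i [y e]]|h].
      exists i, y; split=> //; first by move: e; rewrite /clan_up; case: ifP.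
      have := ninv_up v e; have := ninv_le (io y); lia.
    case: nt; apply: balanced_max => // i; case E: (up i x) => [y|//].
    by case: h; exists i, y.
  + by move=> {}x {}g [r' _]; apply: clan_rep_ghom r'.
Qed.

End ClanCoefficients.

Local Close Scope ring_scope.

(** * Power series *)

Section ClanToState.

Variable n : nat.
Implicit Types (g e : clan n) (o i j : 'I_n).

Definition toS g := St (fun k => if insub k is Some o then val (invol g o) else k)
  (fun k => if insub k is Some o then sgn g o == Some true else false).

Lemma io_toS g o : io (toS g) o = invol g o.
Proof. by rewrite /= valK. Qed.

Lemma sg_toS g o : sg (toS g) o = (sgn g o == Some true).
Proof. by rewrite /= valK. Qed.

Lemma toS_out g k : n <= k -> io (toS g) k = k /\ sg (toS g) k = false.
Proof. by move=> h /=; rewrite insubF // ltnNge h. Qed.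

Lemma eq_toS g s : (forall o, (invol g o : nat) = io s o) -> (forall o, (sgn g o == Some true) = sg s o) ->
  (forall k, n <= k -> io s k = k /\ sg s k = false) -> toS g = s.
Proof.
move=> h1 h2 h3; apply: st_eq => k; case: (ltnP k n) => h.
- by rewrite -[k]/(val (Ordinal h)) io_toS h1.
- by rewrite (toS_out g h).1 (h3 k h).1.
- by rewrite -[k]/(val (Ordinal h)) sg_toS h2.
- by rewrite (toS_out g h).2 (h3 k h).2.
Qed.

Lemma val_tperm i j o : j = i.+1 :> nat -> tperm i j o = sw i o :> nat.
Proof.
move=> h; case: tpermP => [->|->|/eqP h1 /eqP h2]; rewrite ?swL ?h ?swR //.
by rewrite swD // -h.
Qed.

Lemma toS_conj g i j : j = i.+1 :> nat -> toS (clan_conj g i j) = cconj i (toS g).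
Proof.
move=> h; apply: eq_toS => [o|o|k hk] /=.
- by rewrite !permM val_tperm // -(val_tperm o h) valK.
- by rewrite ffunE -(val_tperm o h) valK.
- rewrite swD ?insubF ?swD //; have := ltn_ord j; lia.
Qed.

Lemma toS_mat g i j : j = i.+1 :> nat -> invol g i = i -> invol g j = j ->
  toS (Clan (invol g * tperm i j)%g [ffun k => if (k == i) || (k == j) then None else sgn g k])
  = mat i (toS g).
Proof.
move=> h e1 e2; apply: eq_toS => [o|o|k hk] /=.
- rewrite permM -(val_tperm o h) valK; congr val; case: (tpermP i j o) => [->|->|h1 h2].
  + by rewrite e1 e2 tpermL.
  + by rewrite e1 e2 tpermR.
  + rewrite tpermD //; apply/eqP => e.
      by apply: h1; apply: (@perm_inj _ (invol g)); rewrite -e e1.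
    by apply: h2; apply: (@perm_inj _ (invol g)); rewrite -e e2.
- rewrite ffunE valK -!val_eqE /= h.
  by case: ifP => [/orP[]->|/norP[-> ->]]; rewrite ?andbF ?andbT.
- rewrite swD ?insubF //; have := ltn_ord j; lia.
Qed.

Lemma num_inv_toS g : num_inv (invol g) = ninv n (io (toS g)).
Proof. by apply: eq_card => -[a b]; rewrite !inE !io_toS. Qed.

End ClanToState.

Section ClanState.

Variables p q : nat.

Lemma is_clanP n (g : clan n) : is_clan p q g <->
  [/\ n = p + q, (forall o, invol g (invol g o) = o), (forall o, (sgn g o != None) = (invol g o == o))
    & #|[set i | sgn g i == Some true]| + q = #|[set i | sgn g i == Some false]| + p].
Proof.
split=> [/and4P[/eqP h1 /forallP h2 /forallP h3 /eqP h4]|[h1 h2 h3 h4]].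
  by split=> // o; [exact: eqP (h2 o)|exact: eqP (h3 o)].
by apply/and4P; split; [exact/eqP|apply/forallP=> o; exact/eqP|apply/forallP => o; exact/eqP|exact/eqP].
Qed.

Lemma clan_valid n (g : clan n) : is_clan p q g -> valid n (toS g).
Proof.
move=> /is_clanP[_ h2 h3 _]; split=> k.
- case: (ltnP k n) => h; last by rewrite !(toS_out g h).1.
  by rewrite -[k]/(val (Ordinal h)) !io_toS h2.
- by move=> h; rewrite (toS_out g h).1.
- case: (ltnP k n) => h; last by rewrite (toS_out g h).2.
  rewrite -[k]/(val (Ordinal h)) io_toS sg_toS => /eqP e; split=> //.
  by apply/eqP; rewrite val_eqE -h3 e.
Qed.

Lemma nsign_toS N' (g : clan N'.+1) e : (forall o, (sgn g o != None) = (invol g o == o)) ->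
  nsign N' e (toS g) = #|[set i | sgn g i == Some e]|.
Proof.
move=> h; rewrite -sum1_card /nsign big_mkcond [RHS]big_mkcond /=.
apply: eq_bigr => k _; rewrite !valK val_eqE -h inE.
by case: (sgn g k) => [[]|] //; case: e.
Qed.

Lemma clan_balanced N' (g : clan N'.+1) : is_clan p q g -> balanced N' p q (toS g).
Proof. by move=> /is_clanP[_ _ h /eqP]; rewrite /balanced !nsign_toS. Qed.

Lemma balanced_clan N' (g : clan N'.+1) : N'.+1 = p + q -> valid N'.+1 (toS g) ->
  (forall o, (sgn g o != None) = (invol g o == o)) -> balanced N' p q (toS g) -> is_clan p q g.
Proof.
move=> h1 [h2 _ _] h3; rewrite /balanced !nsign_toS // => /eqP h4; apply/is_clanP; split=> // o.
by apply: val_inj; have := h2 o; rewrite !io_toS.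
Qed.

(** [sg] is false both at minus signs and at matched positions; for genuine clans the involution
    tells the two apart. *)
Lemma toS_inj n (g e : clan n) : is_clan p q g -> is_clan p q e -> toS g = toS e -> g = e.
Proof.
move=> /is_clanP[_ _ h _] /is_clanP[_ _ h' _] ge.
have e1 : invol g = invol e by apply/permP => o; apply: val_inj; have := io_toS g o; rewrite ge io_toS.
have e2 : sgn g = sgn e.
  apply/ffunP => o; have := h o; have := h' o; rewrite e1.
  have := sg_toS g o; rewrite ge sg_toS.
  by case: (sgn g o) (sgn e o) => [[]|] [[]|] //= _ <-.
by case: g e e1 e2 {h h' ge} => [a b] [c d] /= -> ->.
Qed.

End ClanState.

Section Steps.

Variables p q : nat.

Lemma star_match n (g : clan n) i j b : sgn g i = Some b -> sgn g j = Some (~~ b) ->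
  clan_star g i j = Some (Clan (invol g * tperm i j)%g
     [ffun k => if (k == i) || (k == j) then None else sgn g k]).
Proof. by rewrite /clan_star => -> ->; case: b. Qed.

Lemma step_up n (g e : clan n) a : is_clan p q g -> clan_step g a e ->
  [/\ 0 < a, a < n & clan_up n a.-1 (toS g) = Some (toS e)].
Proof.
move=> cg [i [j [<- hj hs]]]; rewrite !num_inv_toS => hn.
have v := clan_valid cg; have [_ h2 h3 _] := (is_clanP _ _ _).1 cg.
have hi : i.+1 < n by rewrite -hj.
split=> //; rewrite succnK /clan_up hi.
have ej : io (toS g) i.+1 = invol g j by rewrite -hj io_toS.
have sj : sg (toS g) i.+1 = (sgn g j == Some true) by rewrite -hj sg_toS.
rewrite io_toS ej sg_toS sj -hj !val_eqE -!h3; move: hs; rewrite /clan_star.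
have conj_case : (if invol g i == j then None else Some (clan_conj g i j)) = Some e ->
    ~~ ((sgn g i != None) && (sgn g j != None)) ->
    (if invol g i < invol g j then Some (cconj i (toS g)) else None) = Some (toS e).
  case: eqP => // ne [ee] _; move: hn; rewrite -ee toS_conj //; case: (ltngtP (invol g i) (invol g j)) => // h hn.
    (* If the values decrease, conjugation is a downward step, which contradicts the growth of the
       inversion number. *)
    have u : clan_up n i (cconj i (toS g)) = Some (toS g).
      by apply: up_conj => //; rewrite ?io_toS ?ej // -hj val_eqE; apply/eqP.
    by have := ninv_up (valid_conj hi v) u; move: hn; lia.
  have /eqP := perm_inj (val_inj h); rewrite -val_eqE /= hj; lia.
case ei: (sgn g i) => [b|]; case e2: (sgn g j) => [c|] /=; try by move=> h; apply: conj_case => //; rewrite ei e2.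
case: eqP => // bc [<-]; rewrite toS_mat //; try by apply/eqP; rewrite -h3 ?ei ?e2.
by case: b c bc {ei e2} => [] [].
Qed.

Lemma up_step N' (g : clan N'.+1) i s : is_clan p q g -> clan_up N'.+1 i (toS g) = Some s ->
  exists e : clan N'.+1, [/\ is_clan p q e, clan_step g i.+1 e & toS e = s].
Proof.
move=> cg us; have v := clan_valid cg; have b := clan_balanced cg.
have [hN h2 h3 _] := (is_clanP _ _ _).1 cg.
have [hi vs _] := up_inv v us; have bs := balanced_up b us; have hn := ninv_up v us.
have hi0 : i < N'.+1 by lia.
pose oi := Ordinal hi0; pose oj := Ordinal hi.
have main e : clan_star g oi oj = Some e -> toS e = s ->
    (forall o, (sgn e o != None) = (invol e o == o)) ->
    exists e : clan N'.+1, [/\ is_clan p q e, clan_step g i.+1 e & toS e = s].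
  move=> h1 hs h; exists e; split=> //; first by apply: balanced_clan; rewrite ?hs.
  by exists oi, oj; split=> //; rewrite !num_inv_toS hs.
have ei : io (toS g) i = invol g oi by rewrite -io_toS.
have ej : io (toS g) i.+1 = invol g oj by rewrite -io_toS.
have si : sg (toS g) i = (sgn g oi == Some true) by rewrite -sg_toS.
have sj : sg (toS g) i.+1 = (sgn g oj == Some true) by rewrite -sg_toS.
have ij : oj != oi by rewrite -val_eqE /=; lia.
move: us; rewrite /clan_up hi ei ej si sj.
rewrite -[X in (_ == X) && _]/(val oi) -[X in _ && (_ == X)]/(val oj) !val_eqE -!h3.
case E1: (sgn g oi) => [c|]; case E2: (sgn g oj) => [d|] /=.
- have f1 : invol g oi = oi by apply/eqP; rewrite -h3 E1.
  have f2 : invol g oj = oj by apply/eqP; rewrite -h3 E2.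
  case: ifP => // /negbT cd [es]; apply: (main _ (star_match E1 _)).
  + by rewrite E2; case: c d cd {E1 E2} => [] [].
  + by rewrite toS_mat.
  + move=> o /=; rewrite ffunE permM; case: (o =P oi) => [->|k1] /=.
      by rewrite f1 tpermL (negbTE ij).
    case: (o =P oj) => [->|k2]; first by rewrite f2 tpermR eq_sym (negbTE ij).
    rewrite h3 tpermD //; apply/eqP => e.
      by apply: k1; apply: (@perm_inj _ (invol g)); rewrite -e f1.
    by apply: k2; apply: (@perm_inj _ (invol g)); rewrite -e f2.
all: case: ifP => // lt [es]; apply: (main (clan_conj g oi oj)); rewrite ?toS_conj //.
all: try (by move=> o /=; rewrite ffunE h3 !permM -(inj_eq (@perm_inj _ (tperm oi oj))) tpermK).
all: rewrite /clan_star E1 ?E2; case: eqP => // h; have := h2 oi; rewrite h => h'.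
all: by move: lt; rewrite h h' /=; lia.
Qed.

End Steps.

(** * The top clan as a nested state *)

Section Top.

Lemma prod_rev n l (r : seq 'I_n) o : l.*2 <= n -> uniq r ->
  (\prod_(i <- r | (i < l)%N) tperm i (rev_ord i))%g o =
  if has (fun i : 'I_n => (i < l) && ((i == o) || (rev_ord i == o))) r then rev_ord o else o.
Proof.
move=> hl; elim: r o => [|i r IH] o /=; first by rewrite big_nil perm1.
case/andP=> ir ur; rewrite big_cons; case: ifP => hi; last exact: IH.
have nohas x : x = i \/ x = rev_ord i ->
    has (fun j : 'I_n => (j < l) && ((j == x) || (rev_ord j == x))) r = false.
  move=> hx; apply/negbTE/hasPn => j jr; rewrite negb_and; case: ltnP => //= hj.
  have ne : j != i by apply: contraNneq ir => <-.
  move: ne; case: hx => ->; rewrite -!val_eqE /=; have := ltn_ord i; have := ltn_ord j; lia.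
rewrite permM IH //=; case: tpermP => [->|->|/eqP h1 /eqP h2].
- by rewrite nohas ?eqxx //=; right.
- by rewrite nohas ?eqxx ?orbT /= ?rev_ordK //; left.
- by rewrite [i == o]eq_sym (negbTE h1) [rev_ord i == o]eq_sym (negbTE h2).
Qed.

Variables (N' p q : nat).
Local Notation N := N'.+1.
Hypothesis Npq : N = p + q.

Lemma invol_top (o : 'I_N) : invol (clan_top p q N) o =
  if (o < minn p q) || (N - minn p q <= o) then rev_ord o else o.
Proof.
rewrite /= prod_rev ?index_enum_uniq //; last lia.
congr (if _ then _ else _); apply/hasP/idP => [[i _ /andP[hi]]|h].
  by rewrite -!val_eqE /= => /orP[] /eqP; have := ltn_ord i; lia.
case: ltnP h => [h _|_ h] /=.
  by exists o; rewrite ?mem_index_enum // h eqxx.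
exists (rev_ord o); rewrite ?mem_index_enum // rev_ordK eqxx orbT andbT /=.
by have := ltn_ord o; lia.
Qed.

Lemma sgn_top (o : 'I_N) : sgn (clan_top p q N) o =
  if (o < minn p q) || (N - minn p q <= o) then None else Some (q < p).
Proof.
rewrite ffunE -[X in X == _]/(invol (clan_top p q N) o) invol_top.
case: (boolP (_ || _)) => h; last by rewrite eqxx.
by rewrite ifF //; apply/negP; rewrite -val_eqE /=; have := ltn_ord o; lia.
Qed.

Lemma toS_top : toS (clan_top p q N) = top_state N' p q.
Proof.
apply: eq_toS => [o|o|k hk].
- by rewrite invol_top /= ltn_ord /=; case: ifP.
- rewrite sgn_top; have ho := ltn_ord o; case: (boolP (_ || _)) => h /=.
    by symmetry; apply/negP => /andP[]; lia.
  by rewrite (_ : (_ <= o < _) = true); [case: (q < p)|lia].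
- by split; rewrite /= ?ifF //; lia.
Qed.

Lemma is_clan_top : is_clan p q (clan_top p q N).
Proof.
apply: balanced_clan => //.
- by rewrite toS_top; apply: valid_nest; lia.
- move=> o; rewrite sgn_top invol_top; case: ifP => h; last by rewrite eqxx.
  by symmetry; apply/negP; rewrite -val_eqE /=; have := ltn_ord o; lia.
rewrite toS_top /balanced; have hm : (minn p q).*2 <= N by lia.
have [] := nest_const (q < p) hm; rewrite -/(top_state N' p q).
by case: ltnP => h /= -> ->; lia.
Qed.

End Top.

(** * Padding by outer arcs *)

Section Pad.

Variable n : nat.

Definition mid (o : 'I_n) : 'I_n.+2 := lift ord0 (lift ord_max o).

Lemma val_mid o : mid o = o.+1 :> nat.
Proof. by rewrite /mid lift0 lift_max. Qed.

Lemma mid_inj : injective mid.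
Proof. by move=> a b /lift_inj /lift_inj. Qed.

Lemma lift0_max : lift ord0 ord_max = ord_max :> 'I_n.+2.
Proof. by apply: ord_inj; rewrite lift0. Qed.

Lemma midP (P : 'I_n.+2 -> Prop) : P ord0 -> P ord_max -> (forall o, P (mid o)) -> forall o, P o.
Proof.
move=> h1 h2 h3 o; case: (unliftP ord0 o) => [o'|] -> //.
case: (unliftP ord_max o') => [o''|] ->; first exact: h3.
by rewrite lift0_max.
Qed.

Lemma mid_neq o : (ord0 != mid o) && (ord_max != mid o).
Proof. by rewrite -!val_eqE -[val (mid o)]/(nat_of_ord (mid o)) val_mid /=; have := ltn_ord o; lia. Qed.

Variable g : clan n.
Local Notation g1 := (clan_pad1 g).

Lemma invol_pad0 : invol g1 ord0 = ord_max.
Proof. by rewrite /= permM lift_perm_id tpermL. Qed.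

Lemma invol_pad_max : invol g1 ord_max = ord0.
Proof.
by rewrite -{1}lift0_max /= permM lift_perm_lift lift_perm_id lift0_max tpermR.
Qed.

Lemma invol_pad_mid o : invol g1 (mid o) = mid (invol g o).
Proof. by rewrite /= permM !lift_perm_lift; case/andP: (mid_neq (invol g o)) => h1 h2; rewrite tpermD. Qed.

Lemma sgn_pad0 : sgn g1 ord0 = None.
Proof. by rewrite ffunE unlift_none. Qed.

Lemma sgn_pad_max : sgn g1 ord_max = None.
Proof.
by rewrite -lift0_max ffunE liftK /= unlift_none.
Qed.

Lemma sgn_pad_mid o : sgn g1 (mid o) = sgn g o.
Proof. by rewrite ffunE liftK /= liftK. Qed.

Lemma is_clan_pad1 p q : is_clan p q g -> is_clan p.+1 q.+1 g1.
Proof.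
move=> /is_clanP[h1 h2 h3 h4]; apply/is_clanP; split.
- by rewrite h1 addnS addSn.
- by apply: midP => [||o]; rewrite ?invol_pad0 ?invol_pad_max ?invol_pad_mid ?invol_pad0 ?h2.
- apply: midP => [||o]; rewrite ?sgn_pad0 ?sgn_pad_max ?sgn_pad_mid ?invol_pad0 ?invol_pad_max //.
  by rewrite invol_pad_mid (inj_eq mid_inj) h3.
have card e : #|[set i | sgn g1 i == Some e]| = #|[set i | sgn g i == Some e]|.
  rewrite -(card_imset _ mid_inj); apply: eq_card; apply: midP => [||o].
  - rewrite inE sgn_pad0; symmetry; apply/imsetP => -[o _ /eqP].
    by have /andP[/negbTE-> _] := mid_neq o.
  - rewrite inE sgn_pad_max; symmetry; apply/imsetP => -[o _ /eqP].
    by have /andP[_ /negbTE->] := mid_neq o.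
  - by rewrite (mem_imset _ _ mid_inj) !inE sgn_pad_mid.
by rewrite !card !addnS h4.
Qed.

Lemma toS_pad1 : toS g1 =
  St (fun k => if k == 0 then n.+1 else if k == n.+1 then 0 else (io (toS g) k.-1).+1)
     (fun k => (0 < k) && sg (toS g) k.-1).
Proof.
apply: eq_toS => [||k hk]; cycle -1.
- have hk' : n <= k.-1 by lia.
  have [k0 k1] : k == 0 = false /\ k == n.+1 = false by lia.
  have [e1 e2] := toS_out g hk'.
  by rewrite -[io (St _ _) k]/(if k == 0 then n.+1 else if k == n.+1 then 0 else (io (toS g) k.-1).+1)
    -[sg (St _ _) k]/((0 < k) && sg (toS g) k.-1) k0 k1 e1 e2 andbF; split=> //; lia.
- apply: midP => [||o]; rewrite ?invol_pad0 ?invol_pad_max ?invol_pad_mid ?val_mid //=; rewrite ?eqxx //.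
  by rewrite eqSS (ltn_eqF (ltn_ord o)) valK.
- apply: midP => [||o]; rewrite ?sgn_pad0 ?sgn_pad_max ?sgn_pad_mid ?val_mid //=.
    by rewrite insubF ?ltnn.
  by rewrite valK.
Qed.

End Pad.

Lemma pad_sizeE m n : pad_size m n = n + m.*2.
Proof. by elim: m => [|m /= ->]; rewrite ?addn0 // doubleS !addnS. Qed.

Lemma is_clan_pad p q n (g : clan n) m : is_clan p q g -> is_clan (p + m) (q + m) (clan_pad m g).
Proof.
move=> h; elim: m => [|m IH]; first by rewrite !addn0.
by rewrite !addnS; apply: is_clan_pad1.
Qed.

Lemma toS_pad n (g : clan n) m : matchless g -> toS (clan_pad m g) =
  St (fun k => if (k < n + m.*2) && ((k < m) || (n + m <= k)) then (n + m.*2).-1 - k else k)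
     (fun k => (m <= k < n + m) && sg (toS g) (k - m)).
Proof.
move=> hm; elim: m => [|m IH].
  apply: eq_toS => [o|o|k hk].
  - by rewrite hm perm1 /= ifF //; have := ltn_ord o; lia.
  - by rewrite -sg_toS -[LHS]andTb /= subn0 addn0 ltn_ord.
  - split; rewrite [LHS]/=; first by rewrite ifF //; lia.
  by apply/negP => /andP[h _]; rewrite /= in hk; lia.
rewrite /= toS_pad1 IH pad_sizeE; apply: st_eq => k /=.
  case: eqP => [->|k0]; first by rewrite ifT; lia.
  case: eqP => [->|k1]; first by rewrite ifT; lia.
  by case: ifP; case: ifP; lia.
rewrite (_ : k.-1 - m = k - m.+1); last lia.
by rewrite andbA; congr (_ && _); lia.
Qed.

(** * Reduced words and compatible sequences, read from the last letter *)

Section ReducedWords.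

Variables (p q n : nat).

Lemma reduced_words_clan (g : clan n) w : reduced_words p q g w -> is_clan p q g.
Proof. by case=> d [h _ <- _]; apply: h. Qed.

Lemma reduced_words_nil (g : clan n) : is_clan p q g ->
  reduced_words p q g [::] <-> g = clan_top p q n.
Proof.
move=> cg; split=> [[d [_ h1 h2 _]]|h]; first by rewrite -h2 -h1.
by exists (fun=> g); split.
Qed.

Lemma reduced_words_rcons (g : clan n) w x :
  reduced_words p q g (rcons w x) <->
  exists e, [/\ is_clan p q g, clan_step g x e & reduced_words p q e w].
Proof.
split=> [[d []]|[e [cg sg [d [h1 h2 h3 h4]]]]].
  rewrite size_rcons => h1 h2 h3 h4; exists (d (size w)); split.
  - by rewrite -h3; apply: h1.
  - by have := h4 _ (ltnSn (size w)); rewrite nth_rcons ltnn eqxx h3.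
  - exists d; split=> // [k hk|k hk]; first by apply: h1; lia.
    by have := h4 k; rewrite nth_rcons hk; apply; lia.
exists (fun k => if k <= size w then d k else g); split=> //.
- by move=> k _; case: ifP => // hk; apply: h1.
- by rewrite size_rcons ltnn.
- move=> k; rewrite size_rcons ltnS => hk; rewrite hk nth_rcons.
  case: (ltngtP k (size w)) hk => // [hk _|-> _]; first exact: h4.
  by rewrite h3.
Qed.

End ReducedWords.

Lemma compatible_nil : compatible [::] [::].
Proof. by split. Qed.

Lemma compatible_size w b : compatible w b -> size b = size w.
Proof. by case. Qed.

Lemma compatible_rcons w x b y : size b = size w ->
  compatible (rcons w x) (rcons b y) <->
  compatible w b /\ [/\ 0 < y, last 0 b <= y, y <= x & last 0 w < x -> last 0 b < y].
Proof.
move=> hs; have srt : sorted leq (rcons b y) = sorted leq b && (last 0 b <= y).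
  by case: b {hs} => //= b0 b; rewrite rcons_path.
have nw k : nth 0 (rcons w x) k = if k < size w then nth 0 w k else if k == size w then x else 0.
  exact: nth_rcons.
have nb k : nth 0 (rcons b y) k = if k < size w then nth 0 b k else if k == size w then y else 0.
  by rewrite nth_rcons hs.
have lw : last 0 w = nth 0 w (size w).-1 by rewrite nth_last.
have lb : last 0 b = nth 0 b (size w).-1 by rewrite -hs nth_last.
split=> [[_]|[[_ h1 h2 h3 h4] [c1 c2 c3 c4]]].
  rewrite all_rcons size_rcons srt => /andP[c1 h1] /andP[h2 c2] h3 h4.
  split; split=> //.
  - by move=> k hk; have := h3 k; rewrite nw nb hk; apply; lia.
  - by move=> k hk; have := h4 k; rewrite !nw !nb hk (_ : (k < size w) = true); [apply; lia|lia].
  - by have := h3 (size w); rewrite nw nb ltnn eqxx; apply.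
  - rewrite lw lb; case e: (size w) => [|k] h.
      by rewrite nth_default // hs e.
    have := h4 k; by rewrite !nw !nb e !ltnSn ltnn eqxx; apply.
split; rewrite ?size_rcons ?hs ?all_rcons ?srt ?c1 ?h2 //.
- move=> k; rewrite ltnS nw nb => hk; case: ifP => [/h3 //|_]; case: ifP => //.
- move=> k; rewrite ltnS => hk; rewrite !nw !nb hk.
  case: ifP => [hk'|hk']; first exact: h4.
  have -> : k.+1 = size w by lia.
  by rewrite eqxx; move: c4; rewrite lw lb (_ : (size w).-1 = k) //; lia.
Qed.

Section Words.

Variables (N' p q : nat).
Local Notation N := N'.+1.
Local Notation up := (clan_up N).
Local Notation is_top := (is_top_state N' p q).
Hypothesis Npq : N = p + q.

(* Unlike those of [wcount], the letters are 1-based. *)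
Fixpoint words (rb : seq nat) (k j : nat) (s : st) : seq (seq nat) :=
  if rb is x :: rb' then
    [seq rcons w i.+1 | i <- index_iota (if x == k then j else x) N',
                        w <- if up i s is Some s' then words rb' x i.+1 s' else [::]]
  else if is_top s then [:: [::]] else [::].

Lemma size_words rb k j s : size (words rb k j s) = wcount N' up is_top rb k j s.
Proof.
elim: rb k j s => [|x rb IH] k j s /=; first by case: is_top.
rewrite size_allpairs_dep sumnE big_map; apply: eq_bigr => i _.
by case: clan_up => // s'; apply: IH.
Qed.

Lemma uniq_words rb k j s : uniq (words rb k j s).
Proof.
elim: rb k j s => [|x rb IH] k j s /=; first by case: is_top.
apply: allpairs_uniq_dep; first exact: iota_uniq.
  by move=> i _; case: clan_up.
by move=> [i w] [i' w'] _ _ /= /rcons_inj [-> ->].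
Qed.

(** After an upward step at a letter the same letter cannot step up again. Hence letters with equal
    entries strictly decrease from left to right, which accounts for the bound [i.+1] in [words]. *)
Lemma reduced_words_no_repeat (g e : clan N) w x : is_clan p q g -> clan_step g x e ->
  reduced_words p q e w -> w != [::] -> last 0 w != x.
Proof.
move=> cg sg; case/lastP: w => // w y; rewrite last_rcons => /reduced_words_rcons[f [ce se _]] _.
apply/eqP => yx; subst y; have [_ _ u] := step_up cg sg; have [_ _] := step_up ce se.
by rewrite (up_none_dn (clan_valid cg) u).
Qed.

(** The last condition compares the 0-based bound [j] with a 1-based letter, so the inequality is
    strict. *)
Lemma mem_words rb k j (g : clan N) w : is_clan p q g -> sorted geq rb -> k <= j ->
  w \in words rb k j (toS g) <->
  [/\ reduced_words p q g w, compatible w (map S (rev rb)) &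
      (if rb is x :: _ then x == k else false) -> j < last 0 w].
Proof.
elim: rb k j g w => [|x rb IH] k j g w cg srt kj /=.
  split.
    case: ifP => // /asboolP e; rewrite mem_seq1 => /eqP ->. split; [|exact: compatible_nil|by []].
    apply/reduced_words_nil => //; apply: toS_inj cg (is_clan_top Npq) _.
    by rewrite e toS_top.
  case=> rw /compatible_size /esym /size0nil w0 _; move: rw; rewrite w0 => /(reduced_words_nil cg) ->.
  by rewrite /is_top_state toS_top // (_ : `[< _ >]) ?mem_seq1 //; apply/asboolP.
have lastb : last 0 (map S (rev rb)) = if rb is y :: _ then y.+1 else 0.
  by case: rb {IH srt} => //= y rb; rewrite rev_cons map_rcons last_rcons.
have hdx : (if rb is y :: _ then y <= x else true) by case: rb srt {IH lastb} => //= y rb /andP[].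
have srt' := path_sorted srt.
have le_lastb : last 0 (map S (rev rb)) <= x.+1 by rewrite lastb; case: rb hdx {IH srt srt' lastb}.
have szc v : compatible v (map S (rev rb)) -> size v = size rb.
  by move=> /compatible_size; rewrite size_map size_rev.
rewrite rev_cons map_rcons; split.
  case/allpairsPdep => i [v [hi hv ->]]; rewrite mem_index_iota in hi.
  case u: (clan_up N i (toS g)) hv => [s'|//] hv.
  have xi : x <= i by move: hi; case: eqP => [->|]; lia.
  have [e [ce se es]] := up_step cg u; subst s'.
  have [h1 h2 h3] := (IH _ _ _ _ ce srt' (leqW xi)).1 hv.
  split.
  - by apply/reduced_words_rcons; exists e.
  - apply/compatible_rcons; first by rewrite size_map size_rev (szc v).
    split=> //; split=> // hl; rewrite ltn_neqAle le_lastb andbT lastb.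
    by case: rb h3 {IH srt lastb hdx srt' le_lastb szc hv h2} => // y rb; rewrite eqSS; case: eqP => //; lia.
  - by rewrite last_rcons => /eqP xk; move: hi; rewrite xk eqxx; lia.
case/lastP: w => [|w a] [h1 h2 h3].
  by have := compatible_size h2; rewrite size_rcons.
have szw : size (map S (rev rb)) = size w by have := compatible_size h2; rewrite !size_rcons => -[].
have [c [c1 c2 c3 c4]] := (compatible_rcons _ _ szw).1 h2.
have /reduced_words_rcons[e [_ se rw]] := h1.
have [a0 aN u] := step_up cg se; have ce := reduced_words_clan rw.
rewrite last_rcons in h3.
apply/allpairsPdep; exists a.-1, w; rewrite (ltn_predK a0) mem_index_iota u; split=> //.
  by case: ifP h3 => h h3; [have := h3 isT; lia|lia].
apply/IH => //; first by lia.
split=> //.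
case: rb lastb c4 szw {IH srt hdx srt' szc le_lastb h2 c c2} => // y rb -> c4 szw /eqP yx.
rewrite ltn_neqAle eq_sym (reduced_words_no_repeat cg se rw) /=; last by case: (w) szw => //; rewrite size_map size_rev.
by rewrite leqNgt; apply/negP => /c4; rewrite yx ltnn.
Qed.

End Words.

Local Open Scope ring_scope.

Lemma fsum_indicator (T : choiceType) (A : set T) (F : T -> int) (l : seq T) :
  uniq l -> (forall x, x \in l -> A x /\ F x = 1) ->
  (forall x, A x -> x \notin l -> F x = 0) -> \sum_(x \in A) F x = (size l)%:R.
Proof.
move=> ul h1 h2; rewrite (fsbigE l) //; last by move=> x /h1[].
rewrite big_seq_cond (eq_bigr (fun=> 1)) => [|x /andP[/h1[] //]].
rewrite (eq_bigl (mem l)) => [|x]; last first.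
  by rewrite /=; case: (boolP (x \in l)) => //= /h1[h _]; apply/mem_set.
by rewrite -big_seq big_const_seq count_predT iter_addr_0.
Qed.

(** * Monomials as multisets and the coefficients of clan Schubert polynomials *)

Local Notation ms := {mset nat}%mset.
Implicit Type M : ms.

(* The index i stands for the variable x_(i+1). *)
Definition idxs M : seq nat := rev (map predn (sort leq M)).

Lemma sorted_idxs M : sorted geq (idxs M).
Proof.
rewrite /idxs rev_sorted; apply: (homo_sorted (e := leq)); first by move=> a b; lia.
exact: (sort_sorted leq_total).
Qed.

Lemma eq_msetE M s : (M == seq_mset s) = perm_eq s M.
Proof.
by apply/eqP/idP => [->|h]; [rewrite perm_sym perm_eq_seq_mset|rewrite -[LHS]seq_mset_id; apply/eq_seq_msetP; rewrite perm_sym].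
Qed.

Section Indices.

Variable M : ms.
Hypothesis M0 : 0%N \notin M.

Lemma S_idxs : map S (rev (idxs M)) = sort leq M.
Proof.
rewrite /idxs revK -map_comp map_id_in // => x; rewrite mem_sort => h /=.
by case: x h => // h; move: M0; rewrite h.
Qed.

Lemma perm_idxs : perm_eq (map S (idxs M)) M.
Proof.
apply: perm_trans (permEl (perm_sort leq M)).
by rewrite -S_idxs; apply: perm_map; rewrite perm_sym perm_rev.
Qed.

Lemma mem_idxs x : (x \in idxs M) = (x.+1 \in M).
Proof. by rewrite -(perm_mem perm_idxs) mem_map //; apply: succn_inj. Qed.

Lemma idxs_lt K : (forall x, x \in M -> x <= K)%N -> all (fun x => x < K)%N (idxs M).
Proof. by move=> h; apply/allP => x; rewrite mem_idxs => /h. Qed.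

Lemma mnm_idxs N' : mnm_of N' (idxs M) = [multinom M i.+1 | i < N'.+1].
Proof.
apply/mnmP => i; rewrite mnm_ofE mnmE -count_mem_mset.
rewrite -((seq.permP perm_idxs) (pred1 i.+1)) count_map.
by apply: eq_count => x /=; rewrite eqSS.
Qed.

End Indices.

Lemma eq_mset_sorted M b : sorted leq b -> (M == seq_mset b) = (b == sort leq M).
Proof.
move=> hb; rewrite eq_msetE; apply/idP/eqP => [h|->]; last by rewrite (permEl (perm_sort _ _)).
apply: (sorted_eq leq_trans anti_leq hb (sort_sorted leq_total _)).
by rewrite (perm_trans h) // perm_sym perm_sort.
Qed.

Lemma compatible_monom_sum a M :
  \sum_(b \in compatible a) ps_monom b M = (`[< compatible a (sort leq M) >])%:R.
Proof.
case: asboolP => h.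
  apply: (@fsum_indicator _ _ _ [:: sort leq M]) => // b; rewrite inE.
    by move=> /eqP->; split=> //; rewrite /ps_monom eq_mset_sorted ?eqxx //; apply: (sort_sorted leq_total).
  by move=> [_ _ hb _ _] /negbTE e; rewrite /ps_monom eq_mset_sorted // e.
apply: (@fsum_indicator _ _ _ [::]) => // b hb _.
have [_ _ hs _ _] := hb.
by rewrite /ps_monom eq_mset_sorted //; case: eqP => // e; case: h; rewrite -e.
Qed.

Lemma clan_schubert_coeff N' p q (g : clan N'.+1) M : is_clan p q g -> 0%N \notin M ->
  (forall x, x \in M -> x <= N'.+1)%N ->
  clan_schubert p q g M = (wcount N' (clan_up N'.+1) (is_top_state N' p q) (idxs M) N' N' (toS g))%:R.
Proof.
move=> cg M0 hM; have [Npq _ _ _] := (is_clanP _ _ _).1 cg.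
rewrite -size_words /clan_schubert.
have mem w := mem_words Npq w cg (sorted_idxs M) (leqnn N').
apply: fsum_indicator; first exact: uniq_words.
  move=> w /mem[h1 h2 _]; split=> //; rewrite compatible_monom_sum -S_idxs //.
  by rewrite (_ : `[< _ >]) //; apply/asboolP.
move=> w rw nw; rewrite compatible_monom_sum -S_idxs //; case: asboolP => // cw.
case/negP: nw; apply/mem; split=> //.
(* If the largest entry is N, [mem_words] asks for a last letter beyond [N']. Compatibility provides
   it, because an entry never exceeds its letter. *)
move: cw (idxs_lt M0 hM); case: (idxs M) => [//|x rb] cw /andP[hx _] /eqP xN; subst x.
move: cw rw; case/lastP: w => [|w a].
  by move=> /compatible_size; rewrite size_map size_rev.
rewrite rev_cons map_rcons last_rcons => cw _.
have szw : size (map S (rev rb)) = size w by have := compatible_size cw; rewrite !size_rcons => -[].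
by have [_ []] := (compatible_rcons _ _ szw).1 cw.
Qed.

Lemma clan_schubert0 p q n (g : clan n) M : 0%N \in M -> clan_schubert p q g M = 0.
Proof.
move=> M0; rewrite /clan_schubert fsbig1 // => a _; rewrite fsbig1 // => b [_ hb _ _ _].
rewrite /ps_monom; case: eqP => // e; move: M0; rewrite e (perm_mem (perm_eq_seq_mset _)).
by move/(allP hb).
Qed.

Lemma schur0 mu M : 0%N \in M -> schur mu M = 0.
Proof.
move=> M0; rewrite /schur fsbig1 // => T [_ hT _ _].
rewrite /ps_monom; case: eqP => // e; move: M0; rewrite e (perm_mem (perm_eq_seq_mset _)).
by case/flattenP => r /(allP hT) /allP h /h.
Qed.

Local Close Scope ring_scope.

(** * The partitions of a matchless clan and the rows of the padded sign word *)

Section Shapes.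

Variable n : nat.
Implicit Types (g : clan n) (c : nat -> bool).

Definition shape_of c : seq nat :=
  [seq \sum_(k.+1 <= j < n) ~~ c j | k <- iota 0 n & c k].

Lemma val_phi p q g s : is_clan p q g -> matchless g ->
  map val (phi s g) = [seq k <- iota 0 n | sg (toS g) k == s].
Proof.
move=> /is_clanP[_ _ hs _] hm; rewrite -val_enum_ord filter_map /phi; congr map.
apply: eq_filter => i /=; rewrite valK; have := hs i; rewrite hm perm1 eqxx.
by case: (sgn g i) => [[]|] //; case: s.
Qed.

Lemma count_gt c k : k < n ->
  count (fun j => k < j) [seq j <- iota 0 n | ~~ c j] = \sum_(k.+1 <= j < n) ~~ c j.
Proof.
move=> hk; have -> : iota 0 n = iota 0 k.+1 ++ index_iota k.+1 n.
  by rewrite /index_iota -iotaD subnKC.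
rewrite filter_cat count_cat (eq_in_count (a2 := pred0)) => [|j]; last first.
  by rewrite mem_filter mem_iota /=; lia.
rewrite count_pred0 add0n (eq_in_count (a2 := predT)) => [|j]; last first.
  by rewrite mem_filter mem_index_iota => /andP[_ /andP[]].
by rewrite count_predT size_filter -sum1_count big_mkcond.
Qed.

Lemma lamE p q g s : is_clan p q g -> matchless g ->
  lam s g = shape_of (fun k => sg (toS g) k == s).
Proof.
move=> cg hm; rewrite /lam /shape_of -(val_phi s cg hm) -map_comp.
apply: eq_map => i /=; rewrite -count_gt //.
have e : [seq j <- iota 0 n | ~~ (sg (toS g) j == s)] = map val (phi (~~ s) g).
  by rewrite (val_phi _ cg hm); apply: eq_filter => j; case: sg; case: s.
by rewrite e count_map.
Qed.

Section Padded.

Variables (m N' : nat).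
Hypothesis NE : N'.+1 = n + m.*2.
Variable c : nat -> bool.
Local Notation b := (pad_signs N' m (fun k => c (k - m))).

Lemma supp_pad : supp N' b.
Proof. by move=> k /and3P[]. Qed.

Lemma pad_signs_ge k : b k -> m <= k.
Proof. by case/and3P. Qed.

Lemma pos_pad : pos N' b = map (addn m) [seq k <- iota 0 n | c k] ++ iota (m + n) m.
Proof.
rewrite /pos NE -addnn addnCA iotaD iotaD !filter_cat add0n.
rewrite (eq_in_filter (a2 := pred0)) => [|k]; last first.
  by rewrite mem_iota => h; apply/negP => /pad_signs_ge; lia.
rewrite filter_pred0 cat0s; congr (_ ++ _).
  rewrite (_ : iota m n = map (addn m) (iota 0 n)) ?filter_map -?iotaDl ?addn0 //; congr map.
  apply: eq_in_filter => k; rewrite mem_iota /= /pad_signs => h.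
  by rewrite addKn; case: (c k); rewrite ?orbT ?orbF; lia.
rewrite (eq_in_filter (a2 := predT)) ?filter_predT // => k.
rewrite mem_iota /pad_signs => h.
have [-> -> ->] // : [/\ k < N'.+1, m <= k & N'.+1 - m <= k] by split; lia.
Qed.

Lemma tail_pad k : k < n -> minus_after N' b (m + k) = \sum_(k.+1 <= j < n) ~~ c j.
Proof.
move=> hk; rewrite /minus_after (@big_cat_nat _ _ _ (n + m)) //=; try lia.
rewrite [X in _ + X]big_nat [X in _ + X]big1 => [|j hj]; last first.
  have [h1 h2 h3] : [/\ j < N'.+1, m <= j & N'.+1 - m <= j] by split; lia.
  by rewrite /pad_signs h1 h2 h3.
rewrite addn0 (_ : (m + k).+1 = k.+1 + m) ?big_addn ?addnK; last lia.
rewrite big_nat [RHS]big_nat; apply: eq_bigr => j hj.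
rewrite /pad_signs addnK leq_addl.
have -> : j + m < N'.+1 by lia.
by have -> : (N'.+1 - m <= j + m) = false by lia.
Qed.

Lemma tail_pad_out k : m + n <= k -> minus_after N' b k = 0.
Proof.
move=> hk; rewrite /minus_after big_nat big1 // => j hj.
have [h1 h2 h3] : [/\ j < N'.+1, m <= j & N'.+1 - m <= j] by split; lia.
by rewrite /pad_signs h1 h2 h3.
Qed.

Lemma size_pos_pad : size (pos N' b) = size (shape_of c) + m.
Proof. by rewrite pos_pad size_cat !size_map size_iota. Qed.

(** The m plus signs appended on the right have no minus sign behind them; their rows are empty, in
    agreement with the default value 0 beyond the end of the shape. *)
Lemma tail_shape r : r < size (pos N' b) -> minus_after N' b (nth 0 (pos N' b) r) = nth 0 (shape_of c) r.
Proof.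
rewrite size_pos_pad {1}pos_pad nth_cat size_map /shape_of size_map => hr.
case: ltnP => h.
  rewrite (nth_map 0) ?(nth_map 0) ?size_map // tail_pad //.
  by have := mem_nth 0 h; rewrite mem_filter mem_iota => /and3P[].
rewrite [RHS]nth_default ?size_map // tail_pad_out //.
by rewrite nth_iota; lia.
Qed.

End Padded.

End Shapes.

(** * Coefficients of Schur functions in the stable range *)

Section SchurCoefficient.

Variables (n m N' : nat) (c : nat -> bool).
Hypothesis NE : N'.+1 = n + m.*2.
Local Notation b := (pad_signs N' m (fun k => c (k - m))).
Local Notation mu := (shape_of n c).
Implicit Type T : seq (seq nat).

Lemma flatten_nseq_nil k : flatten (nseq k [::]) = [::] :> seq nat.
Proof. by elim: k. Qed.

Lemma tabl_size_row T r : tabl N' b T -> r < size T -> size (nth [::] T r) = nth 0 mu r.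
Proof. by case=> t1 t2 _ _ hr; rewrite t2 // (tail_shape NE) // -t1. Qed.

Lemma tabl_take T : tabl N' b T -> T = take (size mu) T ++ nseq m [::].
Proof.
move=> t; have [t1 _ _ _] := t; rewrite -{1}(cat_take_drop (size mu) T); congr (_ ++ _).
have sT : size (drop (size mu) T) = m by rewrite size_drop t1 (size_pos_pad NE) addKn.
apply: (@eq_from_nth _ [::]); rewrite ?size_nseq // => r hr; rewrite nth_nseq -sT hr.
apply/size0nil; rewrite nth_drop (tabl_size_row t) ?nth_default ?leq_addr //.
by rewrite -ltn_subRL -size_drop.
Qed.

Lemma take_ssyt T : tabl N' b T -> all (all (leq 1)) T -> ssyt mu (take (size mu) T).
Proof.
move=> t h; have [t1 _ t3 t4] := t.
have sT : size mu <= size T by rewrite t1 (size_pos_pad NE) leq_addr.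
have nthT r : r < size mu -> nth [::] (take (size mu) T) r = nth [::] T r.
  by move=> hr; rewrite nth_take.
split.
- apply: (@eq_from_nth _ 0); rewrite size_map size_takel // => r hr.
  by rewrite (nth_map [::]) ?size_takel // nthT // (tabl_size_row t) //; apply: leq_trans sT.
- by move: h; rewrite {1}(tabl_take t) all_cat => /andP[].
- apply/(all_nthP [::]) => r; rewrite size_takel // => hr; rewrite nthT //; apply: t3.
- move=> r d hd; have hr : r.+1 < size mu.
    by rewrite ltnNge; apply/negP => h'; move: hd; rewrite nth_default.
  rewrite !nthT ?(ltnW hr) //; apply: t4; rewrite (tabl_size_row t) //.
  exact: leq_trans sT.
Qed.

Lemma ssyt_tabl T : ssyt mu T -> tabl N' b (T ++ nseq m [::]).
Proof.
case=> [s1 s2 s3 s4].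
have sT : size T = size mu by rewrite -s1 size_map.
have nthT r : nth [::] (T ++ nseq m [::]) r = nth [::] T r.
  by rewrite nth_cat; case: ltnP => // h; rewrite nth_nseq if_same nth_default.
have szT r : size (nth [::] T r) = nth 0 mu r.
  rewrite -s1; case: (ltnP r (size T)) => h; first by rewrite (nth_map [::]).
  by rewrite !nth_default // size_map.
have st : size (T ++ nseq m [::]) = size (pos N' b).
  by rewrite size_cat size_nseq (size_pos_pad NE) sT.
split=> // [r hr|r|r d].
- by rewrite nthT szT (tail_shape NE) // -st.
- rewrite nthT; case: (ltnP r (size T)) => h; last by rewrite nth_default.
  exact: (all_nthP _ s3).
- by rewrite !nthT szT; apply: s4.
Qed.

Local Open Scope ring_scope.

Lemma schur_coeff (M : {mset nat}%mset) : (0 < m)%N -> 0%N \notin M ->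
  (forall x, x \in M -> x <= m)%N ->
  schur mu M = (A N' b)@_[multinom M i.+1 | i < N'.+1].
Proof.
move=> m0 M0 hM; have hI := idxs_lt M0 hM.
have hN : all (fun x => x < N'.+1)%N (idxs M) by apply: sub_all hI => x; lia.
rewrite -mnm_idxs // mcoeff_A ?sorted_idxs //; last exact: supp_pad.
have hle : all (fun x => x <= N')%N (idxs M) by apply: sub_all hI => x; lia.
(* Padding has moved every plus sign to [m] or later, while all variable indices are below [m]. This
   is where the flag conditions disappear. *)
have flag i x : b i -> x \in idxs M -> (x <= i)%N.
  by move=> /pad_signs_ge h /(allP hI); lia.
have mem T := mem_tabs N' N' T hle (sorted_idxs M) flag.
have hcont T : cont (idxs M) T -> (M == seq_mset (flatten T)) /\ all (all (leq 1)) T.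
  move=> hc; have hp : perm_eq (flatten T) M by apply: perm_trans hc (perm_idxs M0).
  split; first by rewrite eq_msetE.
  apply/allP => r hr; apply/allP => x hx; rewrite lt0n; apply: contraNneq M0 => <-.
  by rewrite -(perm_mem hp); apply/flattenP; exists r.
rewrite -size_tabs -(size_map (take (size mu))); apply: fsum_indicator.
- rewrite map_inj_in_uniq ?uniq_tabs ?sorted_idxs // => T T' /mem[t _ _] /mem[t' _ _] e.
  by rewrite (tabl_take t) (tabl_take t') e.
- move=> T0 /mapP[T /mem[t hc _] ->]; have [h1 h2] := hcont T hc.
  split; first exact: take_ssyt.
  by move: h1; rewrite {1}(tabl_take t) flatten_cat flatten_nseq_nil cats0 /ps_monom => ->.
- move=> T0 hT0; rewrite /ps_monom eq_msetE; case: (boolP (perm_eq _ _)) => //= hp /negP[].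
  have s0 : size T0 = size mu by case: hT0 => <-; rewrite size_map.
  apply/mapP; exists (T0 ++ nseq m [::]); last by rewrite take_cat s0 ltnn subnn take0 cats0.
  apply/mem; split; first exact: ssyt_tabl.
    by rewrite /cont flatten_cat flatten_nseq_nil cats0 (perm_trans hp) // perm_sym perm_idxs.
  (* No row can end in [N'.+1]: the entries are at most [m], and [0 < m] makes [N'.+1 = n + m.*2]
     larger. *)
  move=> r hr; case: (ltnP r (size T0)) => h; last first.
    by rewrite nth_cat ltnNge h /= nth_nseq if_same.
  rewrite nth_cat h => hl; exfalso.
  have : last 0%N (nth [::] T0 r) \in flatten T0.
    apply/flattenP; exists (nth [::] T0 r); first exact: mem_nth.
    by move: hl; case: (nth [::] T0 r) => //= x s _; apply: mem_last.
  by rewrite hl (perm_mem hp) => /hM; lia.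
Qed.

End SchurCoefficient.

Local Open Scope ring_scope.

(** * Products of power series compared with products of polynomials *)

Section Product.

Variable N' : nat.
Local Notation N := N'.+1.
Implicit Types (u v : ms) (k : 'X_{1..N}).

Definition mset_of_mnm k : ms := seq_mset (flatten [seq nseq (k i) i.+1 | i <- enum 'I_N]).

Lemma mset_of_mnmE k x : mset_of_mnm k x = (\sum_(i < N) (i.+1 == x) * k i)%N.
Proof.
rewrite mset_seqE count_flatten sumnE 2!big_map big_enum /=.
by apply: eq_bigr => i _; rewrite count_nseq.
Qed.

Lemma mset_of_mnmS k (i : 'I_N) : mset_of_mnm k i.+1 = k i.
Proof.
rewrite mset_of_mnmE (bigD1 i) //= eqxx mul1n big1 ?addn0 // => j ji.
by rewrite eqSS val_eqE (negbTE ji).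
Qed.

Lemma mset_of_mnm_out k x : (x == 0)%N || (N < x)%N -> mset_of_mnm k x = 0%N.
Proof.
move=> h; rewrite mset_of_mnmE big1 // => i _.
by rewrite (_ : (i.+1 == x) = false) //; have := ltn_ord i; lia.
Qed.

Lemma mset_of_mnmK k : [multinom mset_of_mnm k i.+1 | i < N] = k.
Proof. by apply/mnmP => i; rewrite mnmE mset_of_mnmS. Qed.

Lemma mset_of_mnmD k1 k2 : mset_of_mnm (k1 + k2)%MM = msetD (mset_of_mnm k1) (mset_of_mnm k2).
Proof.
apply/msetP => x; rewrite msetE2 !mset_of_mnmE -big_split; apply: eq_bigr => i _ /=.
by rewrite mnmDE mulnDr.
Qed.

Lemma mnm_of_msetK u : 0%N \notin u -> (forall x, x \in u -> x <= N)%N ->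
  mset_of_mnm [multinom u i.+1 | i < N] = u.
Proof.
move=> u0 hu; apply/msetP => x; case: (boolP ((x == 0)%N || (N < x)%N)) => h.
  rewrite mset_of_mnm_out //; symmetry; apply/eqP; rewrite mset_eq0.
  by case/orP: h => [/eqP->//|h]; apply/negP => /hu; lia.
case: x h => [|x] h; first by [].
have hx : (x < N)%N by move: h; lia.
by rewrite -[x]/(val (Ordinal hx)) mset_of_mnmS mnmE.
Qed.

Lemma ps_mul0 f h M : (forall u, 0%N \in u -> f u = 0) -> (forall u, 0%N \in u -> h u = 0) ->
  0%N \in M -> ps_mul f h M = 0.
Proof.
move=> hf hh M0; rewrite /ps_mul fsbig1 // => -[u v] /= e; move: M0; rewrite -e in_msetD.
by case/orP => [/hf->|/hh->]; rewrite ?mul0r ?mulr0.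
Qed.

(** Both factors of a monomial use only its own variables, so the bound [K] on the entries of [M]
    passes to them, and factorizations of the multiset correspond to those of the exponent
    vector. *)
Lemma ps_mul_coeff f h (P Q : {mpoly int[N]}) K M : (K <= N)%N ->
  (forall u, 0%N \notin u -> (forall x, x \in u -> x <= K)%N ->
     f u = P@_[multinom u i.+1 | i < N] /\ h u = Q@_[multinom u i.+1 | i < N]) ->
  0%N \notin M -> (forall x, x \in M -> x <= K)%N ->
  ps_mul f h M = (P * Q)@_[multinom M i.+1 | i < N].
Proof.
move=> KN hfh M0 hM; set m := [multinom M i.+1 | i < N].
pose I := 'X_{1..N < (mdeg m).+1, (mdeg m).+1} : finType.
pose pr (k : I) : ms * ms :=
  (mset_of_mnm k.1, mset_of_mnm k.2).
have prK : injective pr.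
  move=> [k1 k2] [l1 l2] [e1 e2]; congr pair; apply: val_inj => /=.
    by rewrite -[LHS]mset_of_mnmK e1 mset_of_mnmK.
  by rewrite -[LHS]mset_of_mnmK e2 mset_of_mnmK.
have mM : mset_of_mnm m = M by apply: mnm_of_msetK => // x /hM; lia.
have sub u v x : msetD u v = M -> (x \in u) || (x \in v) -> x \in M by move=> <-; rewrite in_msetD.
pose r := [seq pr w | w : I <- index_enum _ & m == (w.1 + w.2)%MM].
have key u v : msetD u v = M -> (u, v) \in r.
  move=> e; apply/mapP.
  have u0 : 0%N \notin u by apply: contra M0 => h0; apply: (sub u v); rewrite ?h0.
  have v0 : 0%N \notin v by apply: contra M0 => h0; apply: (sub u v); rewrite ?h0 ?orbT.
  have hu x : x \in u -> (x <= N)%N.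
    by move=> hx; apply: leq_trans KN; apply: hM; apply: (sub u v); rewrite ?hx.
  have hv x : x \in v -> (x <= N)%N.
    by move=> hx; apply: leq_trans KN; apply: hM; apply: (sub u v); rewrite ?hx ?orbT.
  pose k1 := [multinom u i.+1 | i < N]; pose k2 := [multinom v i.+1 | i < N].
  have e12 : m = (k1 + k2)%MM.
    by apply/mnmP => i; rewrite mnmDE !mnmE -e msetE2.
  have d1 : (mdeg k1 < (mdeg m).+1)%N by rewrite e12 mdegD; lia.
  have d2 : (mdeg k2 < (mdeg m).+1)%N by rewrite e12 mdegD; lia.
  exists (BMultinom d1, BMultinom d2); first by rewrite mem_filter mem_index_enum /= e12 eqxx.
  by rewrite /pr /= !mnm_of_msetK.
rewrite mcoeffM /ps_mul (fsbigE r); first last.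
- by move=> [u v] /= /key->.
- by move=> uv /= /mapP[k]; rewrite mem_filter => /andP[/eqP e _] ->; rewrite /= -mset_of_mnmD -e.
- by rewrite map_inj_uniq // filter_uniq // index_enum_uniq.
rewrite big_map big_filter_cond; apply: eq_big => k.
  case: eqP => //= e; apply/mem_set; by rewrite /= -mset_of_mnmD -e.
case/andP=> /eqP e _; have e' : msetD (pr k).1 (pr k).2 = M by rewrite /= -mset_of_mnmD -e.
have good l : (l == k.1 :> 'X_{1..N}) || (l == k.2 :> 'X_{1..N}) ->
    f (mset_of_mnm l) = P@_l /\ h (mset_of_mnm l) = Q@_l.
  move=> hl; rewrite -{2 4}(mset_of_mnmK l); apply: hfh.
    by rewrite -mset_eq0 mset_of_mnm_out.
  move=> x hx; apply: hM; apply: sub e' _ => /=.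
  by case/orP: hl hx => /eqP-> ->; rewrite ?orbT.
by rewrite (good _ _).1 ?(good _ _).2 ?eqxx ?orbT.
Qed.

End Product.

Lemma mset_bound (M : {mset nat}%mset) : exists K, forall x, x \in M -> (x <= K)%N.
Proof.
exists (\max_(x <- M) x)%N => x hx.
by apply: (@leq_bigmax_seq _ _ xpredT (fun x => x)).
Qed.

(** * Stabilization and the limit *)

Section Main.

Variables (p q n : nat) (g : clan n).
Hypotheses (cg : is_clan p q g) (hm : matchless g).

Lemma toS_pad_nest m : toS (clan_pad m.+1 g) =
  nest (pad_size m n).+1 m.+1 (fun k => sg (toS g) (k - m.+1)).
Proof.
rewrite toS_pad //; have e := pad_sizeE m n.
apply: st_eq => k.
  rewrite [LHS]/= [RHS]/=; have -> : (pad_size m n).+2 = (n + m.+1.*2)%N by lia.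
  have -> : (n + m.+1.*2 - m.+1)%N = (n + m.+1)%N by lia.
  by have -> : (pad_size m n).+1 = (n + m.+1.*2).-1 by lia.
have h : ((pad_size m n).+2 - m.+1)%N = (n + m.+1)%N by lia.
by rewrite [RHS]/(_ && _) /= h.
Qed.

(** A coefficient has its final value as soon as the number of added arcs is positive and reaches
    the largest entry of the monomial. *)
Lemma approx_coeff m (M : {mset nat}%mset) : 0%N \notin M -> (forall x, x \in M -> x <= m.+1)%N ->
  clan_approx p q g m.+1 M = ps_mul (schur (lam true g)) (schur (lam false g)) M.
Proof.
move=> M0 hM; set N' := (pad_size m n).+1; have e := pad_sizeE m n.
have NE : N'.+1 = (n + m.+1.*2)%N by lia.
have cp := is_clan_pad m.+1 cg.
have [Npq _ _ _] := (is_clanP _ _ _).1 cp.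
have hMN x : x \in M -> (x <= N'.+1)%N by move=> /hM; lia.
have hl : (m.+1.*2 <= N'.+1)%N by lia.
have r := rep_nest hl (fun k => sg (toS g) (k - m.+1)).
rewrite -toS_pad_nest in r; rewrite /clan_approx (@clan_schubert_coeff N') //.
rewrite -(mcoeff_clan Npq r (clan_balanced cp) (sorted_idxs M) (idxs_lt M0 hMN)).
rewrite mnm_idxs //; symmetry; apply: (@ps_mul_coeff N' _ _ _ _ m.+1) => //; first lia.
move=> u u0 hu; split; rewrite (lamE _ cg hm).
  rewrite (_ : (fun k => _) = sg (toS g)); last by apply: funext => k; rewrite eqb_id.
  by rewrite (schur_coeff _ NE).
rewrite (_ : (fun k => _) = (fun k => ~~ sg (toS g) k)); last first.
  by apply: funext => k; rewrite eqbF_neg.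
by rewrite (schur_coeff (fun k => ~~ sg (toS g) k) NE).
Qed.

Lemma approx_cvg : ps_cvg (clan_approx p q g) (ps_mul (schur (lam true g)) (schur (lam false g))).
Proof.
move=> M; have [K hK] := mset_bound M; exists K.+1 => -[//|m] hm'.
case: (boolP (0%N \in M)) => M0.
  rewrite /clan_approx clan_schubert0 // ps_mul0 // => u; exact: schur0.
by apply: approx_coeff => // x /hK; lia.
Qed.

End Main.

Lemma ps_lim_eq u f : ps_cvg u f -> ps_lim u = f.
Proof.
move=> hf; apply: xget_unique => // h hh; apply: funext => M.
have [K1 h1] := hf M; have [K2 h2] := hh M.
by rewrite -(h1 (maxn K1 K2)) ?leq_maxl // h2 ?leq_maxr.
Qed.

Theorem mainTheorem4 (p q n : nat) (g : clan n)
    (hg : is_clan p q g) (hm : matchless g) :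
  ps_cvg (clan_approx p q g) (clan_F p q g) /\
  clan_F p q g = ps_mul (schur (lam true g)) (schur (lam false g)).
Proof.
have c := approx_cvg hg hm; have e : clan_F p q g = _ := ps_lim_eq c.
by rewrite e.
Qed.
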